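(* Let the Gaussian fully connected network, the inputs $\{x_\alpha\}_{\alpha\in A}$, and all the notation be as in the context, and assume: (i) $\sigma$ is continuous and bounded; (ii) there exist $\widehat{\ell}\in\{1,\ldots,L\}$ and $\gamma_1,\ldots,\gamma_L\in[1,\infty]$ such that $\lim_{n\to\infty} n_\ell(n)/n_{\widehat{\ell}}(n)=\gamma_\ell$ for all $\ell=1,\ldots,L$; set $v_n^*:=n_{\widehat{\ell}}(n)$. Then the sequence of $\mathbb{R}^{|A|\times n_{L+1}}$-valued random variables $\{(Z_h^{(L+1)}(x_\alpha)/\sqrt{v_n^*})_{\alpha\in A,\,h=1,\ldots,n_{L+1}}\}_n$ satisfies the large deviation principle on $\mathbb{R}^{|A|\times n_{L+1}}$ with speed $v_n^*$ and good rate function $$I_{Z^{(L+1)}(\underline{x})}(z):=\inf_{g^{(L)}\in\mathcal{S}_{|A|,C_b},\,r\in\mathbb{R}^{|A|\times n_{L+1}}}\{I_{G^{(L)}(\underline{x})}(g^{(L)})+\|r\|^2/2:\ g^{(L),\#}r=z\},$$ where $\|\cdot\|$ is the Euclidean norm on $\mathbb{R}^{|A|\times n_{L+1}}$, $g^{(L),\#}r$ is the matrix product $(\sum_{\gamma\in A}g^{(L),\#}_{\alpha\gamma}r_{\gamma h})_{\alpha h}$, $$I_{G^{(L)}(\underline{x})}(g^{(L)}):=\inf\Big\{\sum_{\ell=1}^L J(g^{(\ell)}|g^{(\ell-1)}):\ g^{(0)}=g^{(0)}(\underline{x}),\ g^{(1)},\ldots,g^{(L-1)}\in\mathcal{S}_{|A|,C_b}\Big\}\quad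 (g^{(L)}\in\mathcal{S}_{|A|,C_b}),$$ and, for $g^{(\ell-1)},g^{(\ell)}\in\mathcal{S}_{|A|,C_b}$, $$J(g^{(\ell)}|g^{(\ell-1)}):=\begin{cases}\gamma_\ell\,\kappa^*\big(\tfrac{g^{(\ell)}-C_b\mathbf{1}}{C_W};g^{(\ell-1)}\big)&\text{if }\gamma_\ell<\infty,\\ \Delta\big(g^{(\ell)};C_b\mathbf{1}+C_W y(g^{(\ell-1)})\big)&\text{if }\gamma_\ell=\infty.\end{cases}$$
   Context: Fix integers $L\ge1$, $n_0\ge1$, $n_{L+1}\ge1$, constants $C_b\ge0$, $C_W>0$ and a function $\sigma:\mathbb{R}\to\mathbb{R}$. For each $n\ge1$ let $n_1(n),\ldots,n_L(n)$ be positive integers with $n_\ell(n)\to\infty$ as $n\to\infty$ (write $n_\ell=n_\ell(n)$). The network is defined, for $x=(x_1,\ldots,x_{n_0})\in\mathbb{R}^{n_0}$, by $Z_i^{(1)}(x)=b_i^{(1)}+\sum_{r=1}^{n_0}W^{(1)}_{ir}x_r$ ($i=1,\ldots,n_1$) and $Z_i^{(\ell+1)}(x)=b_i^{(\ell+1)}+\sum_{j=1}^{n_\ell}W^{(\ell+1)}_{ij}\sigma(Z_j^{(\ell)}(x))$ ($i=1,\ldots,n_{\ell+1}$, $1\le\ell\le L$), where all biases $b_i^{(\ell)}$ are centered Normal with variance $C_b$ (degenerate at $0$ if $C_b=0$), all weights $W_{ij}^{(\ell+1)}$ ($0\le\ell\le L$) are centered Normal with variance $C_W/n_\ell$, and all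 these random variables are independent. Let $A$ be a finite set and $x_\alpha=(x_{\alpha,1},\ldots,x_{\alpha,n_0})\in\mathbb{R}^{n_0}$, $\alpha\in A$, fixed inputs; $\underline{x}$ denotes $\{x_\alpha\}_{\alpha\in A}$. Notation: for a symmetric positive semidefinite matrix $q=(q_{\alpha\beta})_{\alpha,\beta\in A}$, $q^\#$ is its unique symmetric positive semidefinite square root ($q^\#q^\#=q$). $\mathbf{1}$ is the $A\times A$ matrix with all entries $1$. $\mathcal{S}_{|A|,C_b}$ is the set of symmetric positive semidefinite $A\times A$ matrices $q$ such that $q-C_b\mathbf{1}$ is also positive semidefinite. Let $(N_\gamma)_{\gamma\in A}$ be i.i.d. standard Normal and $\langle q^\#_{\alpha\cdot},N_\cdot\rangle:=\sum_{\gamma\in A}q^\#_{\alpha\gamma}N_\gamma$. For $\eta\in\mathbb{R}^{A\times A}$, $\kappa(\eta;q):=\log\mathbb{E}[\exp(\sum_{\alpha,\beta\in A}\eta_{\alpha\beta}\sigma(\langle q^\#_{\alpha\cdot},N_\cdot\rangle)\sigma(\langle q^\#_{\beta\cdot},N_\cdot\rangle))]$ and $\kappa^*(y;q):=\sup_{\eta\in\mathbb{R}^{A\times A}}\{\langle\eta,y\rangle-\kappa(\eta;q)\}$ with $\langle\eta,y\rangle=\sum_{\alpha,\beta}\eta_{\alpha\beta}y_{\alpha\beta}$. $y(q)$ is the $A\times A$ matrix with entries $y_{\alpha\beta}(q):=\mathbb{E}[\sigma(\langle q^\#_{\alpha\cdot},N_\cdot\rangle)\sigma(\langle q^\#_{\beta\cdot},N_\cdot\rangle)]$.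 $g^{(0)}(\underline{x})$ is the $A\times A$ matrix with entries $C_b+\frac{C_W}{n_0}\sum_{r=1}^{n_0}x_{\alpha,r}x_{\beta,r}$. For $\bar g\in\mathcal{S}_{|A|,C_b}$, $\Delta(g;\bar g):=0$ if $g=\bar g$ and $+\infty$ otherwise. A sequence of random variables satisfies the LDP with speed $v_n\to\infty$ and rate function $I$ (lower semicontinuous, values in $[0,\infty]$) if $\limsup\frac1{v_n}\log P(\cdot\in C)\le-\inf_C I$ for closed $C$ and $\liminf\frac1{v_n}\log P(\cdot\in O)\ge-\inf_O I$ for open $O$; $I$ is good if its sublevel sets are compact. *)

(* Defs.v *)
From HB Require Import structures.
From mathcomp Require Import all_boot all_order all_algebra.
From mathcomp Require Import all_classical all_reals all_analysis.
Set Implicit Arguments. Unset Strict Implicit. Unset Printing Implicit Defensive.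
Import Order.TTheory GRing.Theory Num.Theory.
Import numFieldNormedType.Exports.
Local Open Scope classical_set_scope.
Local Open Scope ring_scope.

Section Defs.
Context {R : realType}.

(* law of a centered Normal with variance v (degenerate at 0 if v = 0);
   normal_prob m s is parameterized by the standard deviation s *)
Definition gauss_law (v : R) : set R -> \bar R :=
  if v == 0 then (\d_(0 : R) : set R -> \bar R) else normal_prob 0 (Num.sqrt v).

Definition centered_gaussian {d} {Omega : measurableType d}
  (P : probability Omega R) (X : Omega -> R) (v : R) : Prop :=
  measurable_fun setT X /\
  forall B : set R, measurable B -> P (X @^-1` B) = gauss_law v B.

Definition mutually_independent {d} {Omega : measurableType d}
  (P : probability Omega R) {I : eqType} (D : set I) (X : I -> Omega -> R) : Prop :=
  (forall i, D i -> measurable_fun setT (X i)) /\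
  forall (s : seq I) (B : I -> set R), uniq s -> (forall i, i \in s -> D i) ->
    (forall i, measurable (B i)) ->
    fine (P (\bigcap_(i in [set j | j \in s]) (X i @^-1` B i)))
      = \prod_(i <- s) fine (P (X i @^-1` B i)).

Definition elog (x : \bar R) : \bar R :=
  match x with
  | r%:E => if (r <= 0)%R then -oo%E else (ln r)%:E
  | +oo%E => +oo%E
  | -oo%E => -oo%E
  end.

Definition rate_function {T : topologicalType} (I : T -> \bar R) : Prop :=
  (forall z, (0 <= I z)%E) /\ lower_semicontinuous I.

Definition good_rate_function {T : topologicalType} (I : T -> \bar R) : Prop :=
  rate_function I /\ forall a : R, compact [set z | (I z <= a%:E)%E].

Definition LDP {d} {Omega : measurableType d} (P : probability Omega R)
  {T : topologicalType} (v : nat -> R) (Y : nat -> Omega -> T) (I : T -> \bar R) : Prop :=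
  rate_function I /\
  (forall C : set T, closed C ->
     (limn_esup (fun n => ((v n)^-1)%:E * elog (P (Y n @^-1` C)))
       <= - ereal_inf (I @` C))%E) /\
  (forall O : set T, open O ->
     (- ereal_inf (I @` O)
       <= limn_einf (fun n => ((v n)^-1)%:E * elog (P (Y n @^-1` O))))%E).

Definition psd {k} (q : 'M[R]_k) : Prop :=
  q^T = q /\ forall v : 'cV[R]_k, 0 <= (v^T *m q *m v) 0 0.

Definition msqrt {k} (q : 'M[R]_k) : 'M[R]_k :=
  xget 0 [set s : 'M[R]_k | psd s /\ s *m s = q].

Definition SCb {k} (Cb : R) (q : 'M[R]_k) : Prop :=
  psd q /\ psd (q - Cb *: const_mx 1).

(* giter m f = E[f(N_0,...,N_{m-1},0,0,...)], N_i i.i.d. standard normal,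
   computed as an iterated integral *)
Fixpoint giter (m : nat) (f : (nat -> R) -> \bar R) : \bar R :=
  match m with
  | 0 => f (fun _ => 0)
  | m'.+1 => (\int[normal_prob 0 1]_t
                giter m' (fun v => f (fun i => if i == m' then t else v i)))%E
  end.

Definition gexp (k : nat) (f : ('I_k -> R) -> \bar R) : \bar R :=
  giter k (fun v => f (fun i : 'I_k => v (nat_of_ord i))).

Definition qN {k} (q : 'M[R]_k) (N : 'I_k -> R) (a : 'I_k) : R :=
  \sum_(c < k) msqrt q a c * N c.

Definition kappa (sigma : R -> R) {k} (eta q : 'M[R]_k) : \bar R :=
  elog (gexp (fun N => (expR (\sum_(a < k) \sum_(b < k)
          eta a b * sigma (qN q N a) * sigma (qN q N b)))%:E)).

Definition kappa_star (sigma : R -> R) {k} (y q : 'M[R]_k) : \bar R :=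
  ereal_sup (range (fun eta : 'M[R]_k =>
     ((\sum_(a < k) \sum_(b < k) eta a b * y a b)%:E - kappa sigma eta q)%E)).

Definition ymat (sigma : R -> R) {k} (q : 'M[R]_k) : 'M[R]_k :=
  \matrix_(a, b) fine (gexp (fun N => (sigma (qN q N a) * sigma (qN q N b))%:E)).

Definition Delta {k} (g gbar : 'M[R]_k) : \bar R := if g == gbar then 0%E else +oo%E.

Definition Jcond (sigma : R -> R) (Cb CW : R) (gam : \bar R) {k} (g' g : 'M[R]_k) : \bar R :=
  match gam with
  | +oo%E => Delta g' (Cb *: const_mx 1 + CW *: ymat sigma g)
  | _ => let y := CW^-1 *: (g' - Cb *: const_mx 1) in
         (gam * kappa_star sigma y g)%E
  end.

Definition g0mat {k n0} (Cb CW : R) (x : 'M[R]_(k, n0)) : 'M[R]_k :=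
  \matrix_(a, b) (Cb + CW / n0%:R * \sum_(r < n0) x a r * x b r).

Definition IG (sigma : R -> R) (Cb CW : R) (L : nat) (gam : nat -> \bar R)
  {k} (g0 gL : 'M[R]_k) : \bar R :=
  ereal_inf [set (\sum_(1 <= l < L.+1) Jcond sigma Cb CW (gam l) (gs l) (gs l.-1))%E
            | gs in [set gs : nat -> 'M[R]_k |
                       gs 0%N = g0 /\ gs L = gL /\
                       forall l, (1 <= l < L)%N -> SCb Cb (gs l)]].

Definition sqnorm {m n} (r : 'M[R]_(m, n)) : R := \sum_(i < m) \sum_(j < n) r i j ^+ 2.

Definition IZ (sigma : R -> R) (Cb CW : R) (L : nat) (gam : nat -> \bar R)
  {k n0 nL1} (x : 'M[R]_(k, n0)) (z : 'M[R]_(k, nL1)) : \bar R :=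
  ereal_inf [set e | exists (g : 'M[R]_k) (r : 'M[R]_(k, nL1)),
     SCb Cb g /\ msqrt g *m r = z /\
     e = (IG sigma Cb CW L gam (g0mat Cb CW x) g + (sqnorm r / 2)%:E)%E].

Definition width (n0 nL1 L : nat) (nn : nat -> nat -> nat) (n l : nat) : nat :=
  if l == 0%N then n0 else if l == L.+1 then nL1 else nn n l.

(* preactivations Z^{(l)}_i(x) for l >= 1, given realized biases b l i
   and weights W l i j; wd l is the width of layer l *)
Fixpoint netZ (sigma : R -> R) (wd : nat -> nat) (b : nat -> nat -> R)
  (W : nat -> nat -> nat -> R) {n0} (x : 'I_n0 -> R) (l : nat) : nat -> R :=
  match l with
  | 0 => fun _ => 0
  | 1 => fun i => b 1%N i + \sum_(r < n0) W 1%N i r * x r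
  | l'.+1 => fun i => b l i + \sum_(j < wd l') W l i j * sigma (netZ sigma wd b W x l' j)
  end.

End Defs.

(* Main.v *)
(** The argument is a recursion over the layers. Given layer l, the neurons of
    layer l+1 are independent and their preactivations are Gaussian with
    covariance the matrix G of layer l; hence the empirical Gram matrix S of the
    n activations satisfies, exactly, E[exp(n <eta, S>) | G] = exp(n kappa(eta; G)).
    Gaussianity enters only through this identity, which rests on the fact that
    the law of a linear image of a standard Gaussian vector is determined by
    its Gram matrix.

    As sigma is bounded, kappa is finite, continuous in G, and has second
    differences in eta bounded by C t^2. This suffices for Gartner-Ellis bounds
    that hold uniformly for G in a small box, without differentiating kappa: the
    upper bound is Markov's inequality, and the lower bound tilts by an almost
    maximizer of <eta, y> - kappa(eta) - delta |eta|^2 / 2. Summing over boxes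
    covering a compact set, local bounds at layer l with rate I become local
    bounds at layer l+1 with rate inf_G (I(G) + gamma kappa^*(.; G)). For
    gamma = oo the convention oo * 0 = 0 gives the deterministic transition,
    because kappa^* vanishes only at the mean.

    The output layer is the same step with <theta, G theta> / 2 in place of
    kappa; its Legendre transform at z is the minimum of |r|^2 / 2 over the r
    with G^# r = z. *)

(* Conditional laws are never formed. Each layer is described by an equality of integrals over the
   events that [G] lies in a box, which is all that Markov's inequality and tilting require. The
   equality comes from integrating out the parameters of one neuron after another, and independence
   is used one coordinate at a time.

   A layer with [N] neurons concentrates at speed [N], whereas all estimates are at the common speed
   [v]. When [N / v] tends to infinity, the lower bound needs a tilt of cost exactly zero, since any
   positive cost would be multiplied without bound.

   A Gartner-Ellis lower bound usually demands differentiability. Here the quadratic penalty keeps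
   almost maximizers bounded, and the second-difference bound turns almost maximality into a
   one-sided bound on increments, so that no maximizer has to exist.

   Boundedness of [sigma] confines every hidden covariance to a fixed compact set, so covers are
   finite and exponential tightness has to be proved for the output only. *)
Require Import Defs.
From HB Require Import structures.
From mathcomp Require Import all_boot all_order all_algebra.
From mathcomp Require Import all_classical all_reals all_analysis measurable_realfun.
From mathcomp Require Import spectral complex.
From mathcomp Require Import ring lra.
Import Order.TTheory GRing.Theory Num.Theory.
Import numFieldNormedType.Exports.
Import HBNNSimple.
Local Open Scope classical_set_scope.
Local Open Scope ring_scope.

Set Implicit Arguments. Unset Strict Implicit. Unset Printing Implicit Defensive.

(** * Square roots of positive semidefinite matrices *)

Section Diagonalization.
Context {F : fieldType} (n : nat).
Variables (V A : 'M[F]_n.+1) (D : 'rV[F]_n.+1).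
Hypotheses (Vu : V \in unitmx) (AE : A = invmx V *m diag_mx D *m V).

Lemma diagonalized_row i : row i V *m A = D 0 i *: row i V.
Proof. by rewrite -row_mul AE !mulmxA mulmxV// mul1mx row_mul row_diag_mx -scalemxAl -rowE. Qed.

Lemma unitmx_row_neq0 i : row i V != 0.
Proof.
apply/eqP => Vi0; have : delta_mx 0 i *m V = 0 :> 'rV_(n.+1) by rewrite -rowE.
move/(congr1 (mulmxr (invmx V))); rewrite /= mulmxK// mul0mx => /rowP/(_ i).
by rewrite !mxE !eqxx => /eqP; rewrite oner_eq0.
Qed.

Lemma horner_mx_diagonalized (p : {poly F}) :
  horner_mx A p = invmx V *m diag_mx (\row_i p.[D 0 i]) *m V.
Proof.
rewrite AE horner_mx_uconjC// horner_mx_diag; congr (_ *m diag_mx _ *m _).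
by apply/rowP => i; rewrite !mxE.
Qed.

Lemma mulmx_diagonalized (D1 D2 : 'rV[F]_n.+1) :
  invmx V *m diag_mx D1 *m V *m (invmx V *m diag_mx D2 *m V) =
  invmx V *m diag_mx (\row_i (D1 0 i * D2 0 i)) *m V.
Proof. by rewrite -!mulmxA (mulmxA V) mulmxV// mul1mx (mulmxA (diag_mx D1)) mulmx_diag. Qed.

(** Fourth roots are taken because the square of a symmetric matrix is positive semidefinite: for
    symmetric [p(A)], the matrix [p(A)^2] is then a square root of the required kind. *)
Lemma horner_mx_exp4 (p : {poly F}) : (forall i, p.[D 0 i] ^+ 4 = D 0 i) ->
  horner_mx A p *m horner_mx A p *m (horner_mx A p *m horner_mx A p) = A.
Proof.
move=> pD; rewrite horner_mx_diagonalized !mulmx_diagonalized [RHS]AE.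
by congr (_ *m diag_mx _ *m _); apply/rowP => i; rewrite !mxE -[RHS]pD; ring.
Qed.

End Diagonalization.

Section SquareRoot.
Context {R : realType}.

Lemma poly_interpolation (F : fieldType) (s : seq F) (g : F -> F) :
  exists p : {poly F}, forall x, x \in s -> p.[x] = g x.
Proof.
elim: s => [|x s [p pE]]; first by exists 0.
have [xs|xs] := boolP (x \in s).
  by exists p => y; rewrite inE => /predU1P[->|]; exact: pE.
pose q := \prod_(y <- s) ('X - y%:P).
have qx : q.[x] != 0.
  by apply: contra xs; rewrite -[_ == 0]/(root q x) root_prod_XsubC.
exists (p + ((g x - p.[x]) / q.[x])%:P * q) => y; rewrite inE => /predU1P[->|ys].
  by rewrite hornerD hornerM hornerC divfK// addrC subrK.
have /eqP qy : root q y by rewrite root_prod_XsubC.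
by rewrite hornerD hornerM qy mulr0 addr0 pE.
Qed.

Lemma row_quad_ge0 n (u : 'rV[R]_n) : 0 <= (u *m u^T) 0 0.
Proof. by rewrite mxE; apply: sumr_ge0 => i _; rewrite mxE -expr2 sqr_ge0. Qed.

Lemma row_quad_eq0 n (u : 'rV[R]_n) : (u *m u^T) 0 0 = 0 -> u = 0.
Proof.
rewrite mxE => /eqP; rewrite psumr_eq0; last by move=> i _; rewrite mxE -expr2 sqr_ge0.
move=> /allP h; apply/rowP => i; have := h i (mem_index_enum _).
by rewrite !mxE mulf_eq0 orbb => /eqP.
Qed.

Lemma horner_mx_sym n (q : 'M[R]_n.+1) (p : {poly R}) : q^T = q ->
  (horner_mx q p)^T = horner_mx q p.
Proof.
move=> qT; elim/poly_ind: p => [|p c IH]; first by rewrite rmorph0 trmx0.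
rewrite rmorphD rmorphM /= horner_mx_X horner_mx_C linearD/= tr_scalar_mx.
rewrite -[_ * q]/(_ *m q) trmx_mul IH qT; congr (_ + _).
exact/esym/comm_horner_mx.
Qed.

(* The square root is a polynomial in [q], interpolating the fourth root on
   the (real, nonnegative) spectrum and then squared. *)
Lemma psd_sqrt_exists n (q : 'M[R]_n) : psd q -> exists s, psd s /\ s *m s = q.
Proof.
case: n q => [|n] q [qT q0].
  exists q; split; first by split.
  by rewrite [LHS]flatmx0 [RHS]flatmx0.
(* The spectral theorem is applied over the complex numbers; as [p] has real coefficients, the
   identity descends along the injective map [f]. *)
pose f := real_complex R; pose A := map_mx f q.
have AT : A^T = A by rewrite map_trmx qT.
have Ah : A \is hermsymmx.
  apply: realsym_hermsym.
    by apply/is_hermitianmxP; rewrite expr0 scale1r map_mx_id.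
  by apply/mxOverP => i j; rewrite !mxE; apply/complex_realP; exists (q i j).
have /hermitian_normalmx /orthomx_spectralP Aeq := Ah.
have Dreal := hermitian_spectral_diag_real Ah.
have := @spectral_unit _ _ A; move: (spectralmx A) (spectral_diag A) Aeq Dreal => V D Aeq Dreal Vu.
pose l i := complex.Re (D 0 i).
have Dl i : D 0 i = f (l i).
  by rewrite /f /l RRe_real//; move/mxOverP: Dreal; exact.
(* The rows of [V] are complex. Eigenvalues, unlike eigenvectors, transfer through the field
   extension, and a real eigenvector is needed to use positivity of [q]. *)
have eigl i : eigenvalue q (l i).
  have -> : eigenvalue q (l i) = eigenvalue A (D 0 i) by rewrite Dl -(eigenvalue_map f).
  apply/eigenvalueP; exists (row i V); first exact: (diagonalized_row Vu Aeq).
  exact: (unitmx_row_neq0 Vu).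
have l0 i : 0 <= l i.
  have /eigenvalueP[v vq v0] := eigl i.
  have := q0 v^T; rewrite trmxK vq -scalemxAl mxE.
  rewrite pmulr_lge0// lt_neqAle row_quad_ge0 andbT eq_sym.
  by apply: contra v0 => /eqP/row_quad_eq0 ->.
have [p pE] := poly_interpolation [seq l i | i : 'I_n.+1] (fun y => Num.sqrt (Num.sqrt y)).
pose B := horner_mx q p.
have BT : B^T = B by exact: horner_mx_sym.
have B4 : B *m B *m (B *m B) = q.
  apply: (@map_mx_inj _ _ f); rewrite !map_mxM /B map_horner_mx -/A.
  apply: (horner_mx_exp4 Vu Aeq) => i; rewrite Dl horner_map -rmorphXn; congr (f _).
  rewrite pE; last by apply/mapP; exists i; rewrite ?mem_enum.
  by rewrite (exprM _ 2 2) !sqr_sqrtr ?sqrtr_ge0.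
exists (B *m B); split => //; split; first by rewrite trmx_mul BT.
by move=> v; rewrite mulmxA -mulmxA -{1}BT -trmx_mul -[X in _ *m X]trmxK row_quad_ge0.
Qed.

(** Along the line [v - e *: (s *m v)] the form equals [e^2 c - 2 e N], with [N] the squared norm of
    [s *m v]; nonnegativity at [e = N / (c + 1)] forces [N = 0]. *)
Lemma psd_quad0 n (s : 'M[R]_n) (v : 'cV[R]_n) : psd s -> (v^T *m s *m v) 0 0 = 0 -> s *m v = 0.
Proof.
move=> [sT s0] v0.
pose w := s *m v; pose c := (w^T *m s *m w) 0 0; pose N := (w^T *m w) 0 0.
have N0 : 0 <= N by have := row_quad_ge0 w^T; rewrite trmxK.
have c0 : 0 <= c by exact: s0.
have E e : 0 <= e ^+ 2 * c - 2 * e * N.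
  have := s0 (v - e *: w).
  have -> : (v - e *: w)^T = v^T - e *: w^T by apply/matrixP => i j; rewrite !mxE.
  rewrite !mulmxBl !mulmxBr -!scalemxAl -!scalemxAr.
  have -> : w^T *m s *m v = w^T *m w by rewrite -mulmxA.
  have -> : v^T *m s *m w = w^T *m w by rewrite /w trmx_mul sT.
  rewrite mxE [X in _ <= X + _ -> _]mxE [X in _ <= _ + X -> _]mxE. rewrite v0 -/c.
  rewrite [X in _ <= X -> _](_ : _ = e ^+ 2 * c - 2 * e * N)//.
  by rewrite /c /N !mxE; ring.
have NE : N = 0.
  have := E (N / (c + 1)); have c1 : 0 < c + 1 by rewrite ltr_wpDl.
  have -> : (N / (c + 1)) ^+ 2 * c - 2 * (N / (c + 1)) * N =
     (N / (c + 1)) ^+ 2 * (- c - 2) by field; rewrite gt_eqF.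
  move=> h; apply/eqP; rewrite eq_le N0 andbT leNgt; apply/negP => Np.
  have : 0 < (N / (c + 1)) ^+ 2 by rewrite exprn_gt0// divr_gt0.
  by nra.
have /row_quad_eq0 : (w^T *m w^T^T) 0 0 = 0 by rewrite trmxK.
by rewrite -/w => /(congr1 trmx); rewrite trmxK trmx0.
Qed.

Lemma mxtrace_quad n (s D : 'M[R]_n) : D^T = D ->
  \tr (D *m s *m D) = \sum_i ((col i D)^T *m s *m col i D) 0 0.
Proof.
move=> DT; apply: eq_bigr => i _.
by rewrite tr_col DT -row_mul mxE [RHS]mxE; apply: eq_bigr => j _; rewrite !mxE.
Qed.

(** With [D = s - t], equality of the squares gives [D (s + t) = s t - t s], and cyclicity of the
    trace yields [tr (D s D) + tr (D t D) = 0]. Both terms are nonnegative, so [s D = t D = 0],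
    whence [D D = 0] and [D = 0] by symmetry. *)
Lemma psd_sqrt_unique n (s t : 'M[R]_n) : psd s -> psd t -> s *m s = t *m t -> s = t.
Proof.
move=> ps pt st; have [sT s0] := ps; have [tT t0] := pt.
pose D := s - t; have DT : D^T = D by rewrite linearB/= sT tT.
have trD : \tr (D *m s *m D) + \tr (D *m t *m D) = 0.
  rewrite -mxtraceD -mulmxDl -mulmxDr mxtrace_mulC mulmxA.
  have -> : D *m D *m (s + t) = s *m (s *m t) - s *m t *m s - t *m s *m t + t *m (t *m s).
    have st' : (s - t) *m (s + t) = s *m t - t *m s.
      by rewrite mulmxBl !mulmxDr -st [s *m s + _]addrC [t *m s + _]addrC addrKA.
    have gen (a b c e : 'M[R]_n) : a - b - (c - e) = a - c - b + e.
      by apply/matrixP => i j; rewrite !mxE; ring.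
    by rewrite /D -!mulmxA st' mulmxBr !mulmxBl gen.
  by rewrite !(mxtraceD, raddfN, raddfB)/= [\tr (s *m t *m s)]mxtrace_mulC [\tr (t *m s *m t)]mxtrace_mulC; ring.
have trs : \tr (D *m s *m D) = 0 /\ \tr (D *m t *m D) = 0.
  have a0 : 0 <= \tr (D *m s *m D) by rewrite mxtrace_quad//; apply: sumr_ge0.
  have b0 : 0 <= \tr (D *m t *m D) by rewrite mxtrace_quad//; apply: sumr_ge0.
  by split; lra.
have z (r : 'M[R]_n) : psd r -> \tr (D *m r *m D) = 0 -> r *m D = 0.
  move=> pr; rewrite mxtrace_quad// => /eqP; rewrite psumr_eq0; last by move=> i _; case: pr.
  move=> /allP h; apply/matrixP => i j.
  have /eqP /(psd_quad0 pr) := h j (mem_index_enum _).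
  by rewrite colE mulmxA -colE => /colP/(_ i); rewrite !mxE.
have DD : D *m D = 0 by rewrite {1}/D mulmxBl (z s)// ?(z t)// ?subrr; case: trs.
suff : D = 0 by move/eqP; rewrite subr_eq0 => /eqP.
apply/row_matrixP => i; rewrite row0; apply: row_quad_eq0.
rewrite tr_row DT; transitivity ((D *m D) i i); last by rewrite DD mxE.
by rewrite mxE [RHS]mxE; apply: eq_bigr => j _; rewrite !mxE.
Qed.

Lemma msqrtP n (q : 'M[R]_n) : psd q -> psd (msqrt q) /\ msqrt q *m msqrt q = q.
Proof. by move=> pq; exact: (xgetPex 0 (psd_sqrt_exists pq)). Qed.

End SquareRoot.

(** * Topology of matrix spaces and continuity of the square root *)

Section MatrixTopology.
Context {R : realType}.
Local Notation "''M_' ( m , n )" := 'M[R]_(m, n).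

(** Boxes replace norm balls throughout: membership is a finite conjunction of scalar conditions,
    hence a measurable event, and linear forms vary on a box by at most [norm1] times the radius. *)
Definition mbox {m n} (y : 'M[R]_(m, n)) (rho : R) : set 'M[R]_(m, n) :=
  [set z | forall i j, `|z i j - y i j| < rho].

Lemma mbox_center m n (y : 'M[R]_(m, n)) (rho : R) : 0 < rho -> mbox y rho y.
Proof. by move=> r0 i j; rewrite subrr normr0. Qed.

Lemma mbox_sub m n (y : 'M[R]_(m, n)) (r1 r2 : R) : r1 <= r2 -> mbox y r1 `<=` mbox y r2.
Proof. by move=> r12 z zy i j; exact: lt_le_trans (zy i j) r12. Qed.

Lemma nbhs_mboxP m n (y : 'M[R]_(m, n)) (U : set 'M[R]_(m, n)) :
  nbhs y U <-> exists2 rho, 0 < rho & mbox y rho `<=` U.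
Proof.
split=> [/nbhs_ballP[e e0 eU]|[rho r0 rU]].
  exists e => // z zy; apply: eU; split => // i j.
  by rewrite /ball/= distrC.
apply/nbhs_ballP; exists rho => // z [_ zy]; apply: rU => i j.
by have := zy i j; rewrite /ball/= distrC.
Qed.

Lemma nbhs_mbox m n (y : 'M[R]_(m, n)) (rho : R) : 0 < rho -> nbhs y (mbox y rho).
Proof. by move=> r0; apply/nbhs_mboxP; exists rho. Qed.

Lemma cvg_mxP (T : Type) (F : set_system T) {FF : Filter F} m n (f : T -> 'M[R]_(m, n)) (y : 'M[R]_(m, n)) :
  f x @[x --> F] --> y <-> forall i j, f x i j @[x --> F] --> y i j.
Proof.
split=> [fy i j|fy].
  exact: (cvg_comp f (fun z : 'M[R]_(m, n) => z i j) fy (@coord_continuous R m n i j y)).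
move=> U /nbhs_mboxP[rho r0 rU].
suff : \forall x \near F, forall i j, `|f x i j - y i j| < rho.
  by apply: filterS => x; exact: rU.
apply: (@filter_forall _ _ (fun i x => forall j, `|f x i j - y i j| < rho)) => i.
apply: (@filter_forall _ _ (fun j x => `|f x i j - y i j| < rho)) => j.
have /cvgrPdist_lt/(_ _ r0) := fy i j.
by apply: filterS => x; rewrite distrC.
Qed.

Lemma mcube_compact m n (C : R) :
  compact [set z : 'M[R]_(m, n) | forall i j, `|z i j| <= C].
Proof.
have c1 : compact [set v : 'rV[R]_(m * n) | forall i, `[- C, C]%classic (v ord0 i)].
  by apply: (@rV_compact R (m * n) (fun=> `[- C, C]%classic)) => _; exact: segment_compact.
have cv : continuous (vec_mx : 'rV[R]_(m * n) -> 'M[R]_(m, n)).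
  move=> v; apply/(@cvg_mxP _ (nbhs v) _) => i j.
  rewrite (_ : (fun x : 'rV_(m * n) => _) = fun x => x ord0 (mxvec_index i j)); last first.
    by apply/funext => x; rewrite mxE.
  by rewrite mxE; exact: coord_continuous.
have := continuous_compact (continuous_subspaceT cv) c1.
congr compact; apply/seteqP; split => [_ [v vC <-] i j|z zC].
  by rewrite mxE; have := vC (mxvec_index i j); rewrite /= in_itv/= ler_norml.
exists (mxvec z); last by rewrite mxvecK.
move=> ij; case/mxvec_indexP: ij => i j.
by rewrite mxvecE /= in_itv/= -ler_norml.
Qed.

Lemma mx_hausdorff m n : hausdorff_space 'M[R]_(m, n).
Proof. exact: norm_hausdorff. Qed.

Lemma closed_le_fun (T : topologicalType) (f : T -> R) (c : R) :
  continuous f -> closed [set x | f x <= c].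
Proof. by move=> cf; apply: (@preimage_closed _ _ f [set y | y <= c]) => //; exact: closed_le. Qed.

Lemma closed_eq_fun (T : topologicalType) (f : T -> R) (c : R) :
  continuous f -> closed [set x | f x = c].
Proof. by move=> cf; apply: (@preimage_closed _ _ f [set y | y = c]) => //; exact: closed_eq. Qed.

Lemma closed_ge_fun (T : topologicalType) (f : T -> R) (c : R) :
  continuous f -> closed [set x | c <= f x].
Proof. by move=> cf; apply: (@preimage_closed _ _ f [set y | c <= y]) => //; exact: closed_ge. Qed.

Lemma cvg_sumr (T : Type) (F : set_system T) {FF : Filter F} (I : Type) (r : seq I)
    (f : I -> T -> R) (l : I -> R) :
  (forall i, f i x @[x --> F] --> l i) ->
  \sum_(i <- r) f i x @[x --> F] --> \sum_(i <- r) l i.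
Proof.
move=> fl; elim: r => [|i r IH].
  by under eq_fun do rewrite big_nil; rewrite big_nil; exact: cvg_cst.
by under eq_fun do rewrite big_cons; rewrite big_cons; apply: cvgD.
Qed.

Lemma cvg_mulmx (T : Type) (F : set_system T) {FF : Filter F} m n p
    (f : T -> 'M[R]_(m, n)) (g : T -> 'M[R]_(n, p)) (A : 'M[R]_(m, n)) (B : 'M[R]_(n, p)) :
  f x @[x --> F] --> A -> g x @[x --> F] --> B -> f x *m g x @[x --> F] --> A *m B.
Proof.
move=> /cvg_mxP fA /cvg_mxP gB; apply/cvg_mxP => i j.
under eq_fun do rewrite mxE; rewrite mxE.
by apply: cvg_sumr => k; apply: cvgM.
Qed.

Lemma psd_closed n : closed [set q : 'M[R]_n | psd q].
Proof.
rewrite (_ : mkset _ = (\bigcap_(ij in [set: 'I_n * 'I_n]) [set q : 'M[R]_n | q ij.1 ij.2 - q ij.2 ij.1 = 0]) `&`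
   (\bigcap_(v in [set: 'cV[R]_n]) [set q : 'M[R]_n | 0 <= (v^T *m q *m v) 0 0])); last first.
  apply/seteqP; split=> [q [qT q0]|q [qT q0]]; split => //.
  - by move=> [i j] _ /=; rewrite -{1}qT mxE subrr.
  - by move=> v _; exact: q0.
  - by apply/matrixP => i j; rewrite mxE; have /eqP := qT (j, i) I; rewrite subr_eq0 => /eqP.
  - by move=> v; apply: (q0 v).
apply: closedI; apply: closed_bigI.
  move=> [i j] _ /=; apply: closed_eq_fun => q.
  by apply: (@cvgB _ _ _ (nbhs q) (nbhs_filter q)); [exact: (@coord_continuous R n n i j q)|exact: (@coord_continuous R n n j i q)].
move=> v _; apply: closed_ge_fun => q.
have h : (v^T *m x *m v) @[x --> q] --> v^T *m q *m v.
  by apply: (@cvg_mulmx _ (nbhs q) (nbhs_filter q)); [apply: (@cvg_mulmx _ (nbhs q) (nbhs_filter q)); [exact: cvg_cst|exact: cvg_id]|exact: cvg_cst].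
by have /cvg_mxP := h; exact.
Qed.

Lemma psd_entry_bound n (s : 'M[R]_n) i j : psd s -> s i j ^+ 2 <= (s *m s) i i.
Proof.
move=> [sT _]; rewrite mxE (bigD1 j)//= -{3}sT mxE -expr2 lerDl.
by apply: sumr_ge0 => k _; rewrite -{2}sT mxE -expr2 sqr_ge0.
Qed.

(** A compactness argument: near [q] the roots stay in a cube, and every cluster point is positive
    semidefinite with square [q], hence equals [msqrt q] by uniqueness. Off the positive
    semidefinite matrices [msqrt] is a default value, which explains the filter [within]. *)
Lemma msqrt_cvg n (q : 'M[R]_n) : psd q ->
  msqrt q' @[q' --> within [set q' | psd q'] (nbhs q)] --> msqrt q.
Proof.
move=> pq; pose F := within [set q' : 'M[R]_n | psd q'] (nbhs q).
have FF : ProperFilter F by apply: within_nbhs_proper; apply: subset_closure.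
(* [C - 1] is at least 1 and at least each [q i i + 1], so it bounds any entry whose square is at
   most [q i i + 1]. The extra unit makes the cube a neighbourhood of [msqrt q]. *)
pose C := 1 + \sum_i (q i i + 1).
have qii i : 0 <= q i i.
  have [ps sE] := msqrtP pq; rewrite -{1}sE; apply: le_trans (psd_entry_bound i i ps).
  exact: sqr_ge0.
have C1 : 1 <= C by rewrite lerDl; apply: sumr_ge0 => i _; rewrite addr_ge0.
have qC i : q i i + 1 <= C - 1.
  rewrite /C [1 + _]addrC addrK (bigD1 i)//= lerDl.
  by apply: sumr_ge0 => j _; rewrite addr_ge0.
have bound q' i j : psd q' -> q' i i <= q i i + 1 -> `|msqrt q' i j| <= C - 1.
  move=> pq' q'i; have [ps sE] := msqrtP pq'.
  have h := psd_entry_bound i j ps; rewrite sE in h.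
  have C10 : 1 <= C - 1 by rewrite (le_trans _ (qC i))// lerDr.
  rewrite -(@ler_pXn2r _ 2)// ?nnegrE//; last by rewrite (le_trans _ C10).
  rewrite -normrX ger0_norm ?sqr_ge0// (le_trans h)// (le_trans q'i)// (le_trans (qC i))//.
  by rewrite expr2 ler_peMr// (le_trans _ C10).
pose K := [set z : 'M[R]_n | forall i j, `|z i j| <= C].
have F1 : \forall q' \near F, psd q' /\ forall i, `|q' i i - q i i| < 1.
  rewrite /F near_withinE; have : nbhs q (mbox q 1) by exact: nbhs_mbox.
  by apply: filterS => q' q'q pq'; split => // i.
have FK : \forall q' \near F, psd q' /\ forall i j, `|msqrt q' i j| <= C - 1.
  apply: filterS F1 => q' [pq' q'q]; split => // i j; apply: bound => //.
  by have := q'q i; rewrite ltr_norml; lra.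
apply: (@compact_cluster_set1 'M[R]_n (msqrt q) _ K).
- exact: mx_hausdorff.
- exact: mcube_compact.
- apply/nbhs_mboxP; exists 1 => // z zq i j.
  have /= := bound q i j pq; rewrite lerDl ler01 => /(_ isT) h.
  have := ler_normD (z i j - msqrt q i j) (msqrt q i j); rewrite subrK => h'.
  by have := zq i j; lra.
- by apply: filterS FK => q' [_ h] i j; rewrite (le_trans (h i j))// gerBl.
have cvgsq : (msqrt q' *m msqrt q') @[q' --> F] --> q.
  have : q' @[q' --> F] --> q by apply: cvg_within.
  apply: cvg_trans; apply: near_eq_cvg.
  by apply: filterS F1 => q' [/msqrtP[_ ->]].
have sub z : cluster (msqrt @ F) z -> z = msqrt q.
  move=> zc.
  have zF (V : set 'M[R]_n) : closed V -> (\forall q' \near F, V (msqrt q')) -> V z.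
    by move=> cV FV; apply: cV => U Uz; exact: zc.
  have pz : psd z.
    apply: (zF _ (@psd_closed n)).
    by apply: filterS F1 => q' [/msqrtP[]].
  have zz : z *m z = q.
    apply/matrixP => i j; apply/eqP; rewrite -subr_eq0 -normr_le0; apply/ler_addgt0Pr => e e0.
    rewrite add0r; apply: (zF [set z : 'M[R]_n | `|(z *m z) i j - q i j| <= e]).
      apply: closed_le_fun => y.
      have h : (x *m x) @[x --> y] --> y *m y by apply: (@cvg_mulmx _ (nbhs y) (nbhs_filter y)); exact: cvg_id.
      have /cvg_mxP/(_ i j) h1 := h.
      have h2 : (x *m x) i j - q i j @[x --> y] --> (y *m y) i j - q i j by apply: cvgB h1 (cvg_cst _).
      exact: (cvg_norm h2).
    have /cvg_mxP/(_ i j)/cvgrPdist_le/(_ e e0) := cvgsq.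
    by apply: filterS => q' /=; rewrite distrC.
  have [ps sE] := msqrtP pq.
  by apply: psd_sqrt_unique => //; rewrite sE.
apply/seteqP; split => [z /sub -> //|_ ->].
have [|z [_ /[dup] zc /sub <-//]] := @mcube_compact n n C (msqrt @ F) _ _.
by apply: filterS FK => q' [_ h] i j; rewrite (le_trans (h i j))// gerBl.
Qed.

End MatrixTopology.

(** * Gaussian integrals *)

Section LebesgueShear.
Context {R : realType}.
Local Open Scope ereal_scope.
Notation mu := (@lebesgue_measure R).

(** Checked on indicators, extended to simple functions, and passed to the limit by monotone
    convergence. *)
Lemma ge0_integral_density d (T : measurableType d) (m nu : {measure set T -> \bar R})
  (g : T -> R) (f : T -> \bar R) :
  measurable_fun setT g -> (forall x, 0 <= g x)%R ->
  (forall A, measurable A -> nu A = \int[m]_(x in A) (g x)%:E) ->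
  measurable_fun [set: T] f -> (forall x, 0 <= f x) ->
  \int[nu]_x f x = \int[m]_x (f x * (g x)%:E).
Proof.
move=> mg g0 nuE mf f0.
pose f_ := nnsfun_approx measurableT mf.
transitivity (limn (fun n => \int[nu]_x (f_ n x)%:E)).
  rewrite -monotone_convergence//.
  - by apply: eq_integral => y _; apply/esym/cvg_lim => //; apply: cvg_nnsfun_approx.
  - by move=> n; exact/measurable_EFinP/measurable_funP.
  - by move=> n y _; rewrite lee_fin.
  - by move=> x _ a b ab; rewrite lee_fin; exact/lefP/nd_nnsfun_approx.
have fE x : f x = limn (fun n => (f_ n x)%:E).
  by apply/esym/cvg_lim => //; apply: cvg_nnsfun_approx.
have -> : \int[m]_x (f x * (g x)%:E) = limn (fun n => \int[m]_x ((f_ n x)%:E * (g x)%:E)).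
  rewrite -monotone_convergence//.
  - apply: eq_integral => y _; apply/esym/cvg_lim => //.
    apply: cvgeZr; first by [].
    by apply: cvg_nnsfun_approx.
  - move=> n; apply: emeasurable_funM; first exact/measurable_EFinP/measurable_funP.
    exact/measurable_EFinP.
  - by move=> n y _; rewrite mule_ge0// lee_fin.
  - move=> x _ a b ab; rewrite lee_wpmul2r ?lee_fin//.
    exact/lefP/nd_nnsfun_approx.
congr (limn _); apply/funext => n.
under eq_integral do rewrite fimfunE -fsumEFin//.
rewrite ge0_integral_fsum//; last 2 first.
  - by move=> y; exact/measurable_EFinP/measurable_funM.
  - by move=> y x _; rewrite nnfun_muleindic_ge0.
have -> : \int[m]_x ((f_ n x)%:E * (g x)%:E) =
   \int[m]_x (\sum_(y \in range (f_ n)) ((y * \1_(f_ n @^-1` [set y]) x)%:E * (g x)%:E)).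
  apply: eq_integral => x _.
  by rewrite -ge0_mule_fsuml ?fsumEFin -?fimfunE// => y; rewrite nnfun_muleindic_ge0.
rewrite ge0_integral_fsum//; last 2 first.
  - by move=> y; apply: emeasurable_funM => //; [exact/measurable_EFinP/measurable_funM|exact/measurable_EFinP].
  - by move=> y x _; rewrite mule_ge0// ?nnfun_muleindic_ge0// lee_fin.
apply: eq_fsbigr => y _.
have mpre : measurable (f_ n @^-1` [set y]) by [].
have [y0|y0] := ltP y 0%R.
  have -> : f_ n @^-1` [set y] = set0 by apply: preimage_nnfun0.
  by rewrite !integral0_eq// => x _; rewrite indic0 mulr0 ?mul0e.
transitivity (y%:E * \int[m]_(x in f_ n @^-1` [set y]) (g x)%:E).
  rewrite -nuE//; under eq_integral do rewrite EFinM.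
  rewrite (@ge0_integralZl _ _ _ nu setT measurableT (fun x => (\1_(f_ n @^-1` [set y]) x)%:E)) ?lee_fin//; first by rewrite integral_indic// setIT.
  exact/measurable_EFinP/measurable_indic.
rewrite integral_mkcond -ge0_integralZl//.
- apply: eq_integral => x _; rewrite patchE indicE.
  by case: ifPn => _ /=; rewrite ?mulr1 ?mulr0 ?mul0e ?mule0.
- by apply: (measurable_restrictT (fun x => (g x)%:E) mpre).1; apply: measurable_funTS; exact/measurable_EFinP.
- by move=> x _; rewrite patchE; case: ifPn => //; rewrite lee_fin.
Qed.

Lemma ge0_integral_shift (f : R -> \bar R) (a : R) :
  measurable_fun [set: R] f -> (forall x, 0 <= f x) ->
  \int[mu]_x f (x + a)%R = \int[mu]_x f x.
Proof.
move=> mf f0.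
have ma : measurable_fun setT (fun x : measurableTypeR R => (x + a)%R : measurableTypeR R).
  by apply: measurable_funD.
rewrite -[LHS](@ge0_integral_pushforward _ _ _ _ _ _ ma mu setT f)//.
apply: eq_measure_integral => A mA _; apply/esym.
apply: (@lebesgue_measure_unique R (pushforward mu _)) => //= _ [[u v]] _ <-.
rewrite /pushforward.
have -> : (fun x : R => x + a)%R @^-1` `](u, v).1, (u, v).2]%classic = `](u - a)%R, (v - a)%R]%classic.
  apply/seteqP; split => x /=; rewrite !in_itv/=; lra.
rewrite !lebesgue_measure_itv/= !lte_fin.
have -> : (u - a < v - a)%R = (u < v)%R by apply/idP/idP; lra.
by case: ifP => // _; rewrite -!EFinB; congr EFin; lra.
Qed.


Lemma ge0_lebesgue2_shear (F : R * R -> \bar R) (a : R) :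
  measurable_fun setT F -> (forall z, 0 <= F z) ->
  \int[mu]_x \int[mu]_y F ((x + a * y)%R, y) = \int[mu]_x \int[mu]_y F (x, y).
Proof.
move=> mF F0.
have mS : measurable_fun setT (fun z : R * R => F ((z.1 + a * z.2)%R, z.2)).
  apply: (measurableT_comp mF); apply/measurable_fun_pairP; split.
    by apply: measurable_funD => //; apply: measurable_funM.
  exact: measurable_snd.
have /= -> := @fubini_tonelli _ _ _ _ _ mu mu (fun z : R * R => F ((z.1 + a * z.2)%R, z.2)) mS (fun=> F0 _).
have /= -> := @fubini_tonelli _ _ _ _ _ mu mu F mF F0.
apply: eq_integral => y _.
rewrite (ge0_integral_shift (f := fun x => F (x, y)))//.
by apply: (measurableT_comp mF); exact: pair2_measurable.
Qed.

Lemma ge0_lebesgue2_shear' (F : R * R -> \bar R) (b : R) :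
  measurable_fun setT F -> (forall z, 0 <= F z) ->
  \int[mu]_x \int[mu]_y F (x, (y + b * x)%R) = \int[mu]_x \int[mu]_y F (x, y).
Proof.
move=> mF F0; apply: eq_integral => x _.
rewrite (ge0_integral_shift (f := fun y => F (x, y)))//.
by apply: (measurableT_comp mF); exact: pair1_measurable.
Qed.

Lemma measurable_linear2 (a b c e : R) :
  measurable_fun setT (fun z : R * R => ((a * z.1 + b * z.2)%R, (c * z.1 + e * z.2)%R)).
Proof.
by apply/measurable_fun_pairP; split; apply: measurable_funD => //; apply: measurable_funM.
Qed.

(* A rotation with [s != 0] is a product of three shears. *)
Lemma ge0_lebesgue2_rot (F : R * R -> \bar R) (c s : R) :
  (c ^+ 2 + s ^+ 2 = 1)%R -> (s != 0)%R ->
  measurable_fun setT F -> (forall z, 0 <= F z) ->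
  \int[mu]_x \int[mu]_y F ((c * x + s * y)%R, (- s * x + c * y)%R) = \int[mu]_x \int[mu]_y F (x, y).
Proof.
move=> cs1 s0 mF F0.
(* [a] is the tangent of half the angle: the rotation is a vertical shear by [- s] between two
   horizontal shears by [a]. *)
pose a := ((1 - c) / s)%R.
have sa : (s * a = 1 - c)%R by rewrite /a mulrC divfK.
have ac : (a * (1 + c) = s)%R.
  by apply: (mulfI s0); rewrite mulrA sa (_ : s * s = 1 - c ^+ 2)%R ?mulrBl; [ring|rewrite -cs1; ring].
pose F1 z := F ((z.1 + a * z.2)%R, z.2).
pose F2 z := F1 (z.1, (z.2 + - s * z.1)%R).
have mF1 : measurable_fun setT F1.
  apply: (measurableT_comp mF).
  apply/measurable_fun_pairP; split; last exact: measurable_snd.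
  by apply: measurable_funD => //; apply: measurable_funM.
have mF2 : measurable_fun setT F2.
  apply: (measurableT_comp mF1).
  apply/measurable_fun_pairP; split; first exact: measurable_fst.
  by apply: measurable_funD => //; apply: measurable_funM.
have F10 z : 0 <= F1 z by exact: F0.
have F20 z : 0 <= F2 z by exact: F0.
have e1 := ge0_lebesgue2_shear a mF F0.
have e2 := ge0_lebesgue2_shear' (- s) mF1 F10.
have e3 := ge0_lebesgue2_shear a mF2 F20.
transitivity (\int[mu]_x \int[mu]_y F2 ((x + a * y)%R, y)); last exact: (etrans e3 (etrans e2 e1)).
apply: eq_integral => x _; apply: eq_integral => y _; rewrite /F2 /F1 /=; congr (F (_, _)).
- transitivity (x * (1 - s * a) + y * a * (2 - s * a))%R; last by ring.
  by rewrite sa -{1}ac; ring.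
- transitivity (- s * x + (1 - s * a) * y)%R; last by ring.
  by rewrite sa; ring.
Qed.

End LebesgueShear.

Section StandardGaussian.
Context {R : realType}.
Local Open Scope ereal_scope.
Notation mu := (@lebesgue_measure R).
Notation gam := (@normal_prob R 0%R 1%R).

Lemma normal_pdf01E (x : R) : normal_pdf 0%R 1%R x = (normal_peak 1 * expR (- x ^+ 2 / 2))%R.
Proof. by rewrite normal_pdfE ?oner_neq0// /normal_fun subr0 expr1n. Qed.

Lemma ge0_integral_normal (f : R -> \bar R) : measurable_fun [set: R] f -> (forall x, 0 <= f x) ->
  \int[gam]_x f x = \int[mu]_x (f x * (normal_pdf 0%R 1%R x)%:E).
Proof.
move=> mf f0; apply: (@ge0_integral_density _ _ _ mu) => //.
  exact: measurable_normal_pdf.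
by move=> x; exact: normal_pdf_ge0.
Qed.

Lemma ge0_integral_normalN (f : R -> \bar R) : measurable_fun [set: R] f -> (forall x, 0 <= f x) ->
  \int[gam]_x f (- x)%R = \int[gam]_x f x.
Proof.
move=> mf f0.
have mN : measurable_fun setT (fun x : measurableTypeR R => - x : measurableTypeR R)%R. exact: oppr_measurable.
have mg : measurable_fun [set: R] (fun x => f x * (normal_pdf 0%R 1%R x)%:E).
  by apply: emeasurable_funM => //; apply/measurable_EFinP; exact: measurable_normal_pdf.
have g0 x : 0 <= f x * (normal_pdf 0%R 1%R x)%:E by rewrite mule_ge0// lee_fin normal_pdf_ge0.
rewrite !ge0_integral_normal//; last exact: measurableT_comp.
transitivity (\int[mu]_x ((fun x => f x * (normal_pdf 0%R 1%R x)%:E) \o -%R)%FUN x).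
  by apply: eq_integral => x _ /=; rewrite !normal_pdf01E sqrrN.
rewrite -[LHS](@ge0_integral_pushforward _ _ _ _ _ _ mN mu setT (fun x => f x * (normal_pdf 0%R 1%R x)%:E))//.
by apply: eq_measure_integral => A mA _; exact: lebesgue_measureN.
Qed.

Lemma integral_normal_expR (a : R) : \int[gam]_x (expR (a * x))%:E = (expR (a ^+ 2 / 2))%:E.
Proof.
have mexp (b : R) : measurable_fun [set: R] (fun x => (expR (b * x))%:E).
  by apply/measurable_EFinP; exact: (measurableT_comp (@measurable_expR R) (mulrl_measurable b)).
rewrite ge0_integral_normal//.
transitivity (\int[mu]_x ((expR (a ^+ 2 / 2))%:E * (normal_pdf 0%R 1%R (x + - a)%R)%:E)).
  apply: eq_integral => x _; rewrite -!EFinM !normal_pdf01E; congr EFin.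
  rewrite mulrCA [RHS]mulrCA -!expRD; congr (_ * expR _)%R; by field.
have mpdf : measurable_fun [set: R] (fun x => (normal_pdf 0%R 1%R x)%:E).
  by apply/measurable_EFinP; exact: measurable_normal_pdf.
rewrite ge0_integralZl//.
- rewrite (ge0_integral_shift (f := fun x => (normal_pdf 0%R 1%R x)%:E))//; last first.
    by move=> x; rewrite lee_fin normal_pdf_ge0.
  by rewrite integral_normal_pdf mule1.
- apply: (measurableT_comp mpdf); exact: measurable_funD.
- by move=> x _; rewrite lee_fin normal_pdf_ge0.
Qed.


(** The product density depends on [x ^+ 2 + y ^+ 2] only, so invariance is inherited from Lebesgue
    measure. *)
Lemma ge0_integral_normal2_rot (h : R * R -> \bar R) (c s : R) :
  (c ^+ 2 + s ^+ 2 = 1)%R -> (s != 0)%R ->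
  measurable_fun [set: R * R] h -> (forall z, 0 <= h z) ->
  \int[gam]_x \int[gam]_y h ((c * x + s * y)%R, (- s * x + c * y)%R) =
  \int[gam]_x \int[gam]_y h (x, y).
Proof.
move=> cs1 s0 mh h0.
pose p (x : R) := normal_pdf 0%R 1%R x.
have p0 x : (0 <= p x)%R by exact: normal_pdf_ge0.
have mp : measurable_fun [set: R] p by exact: measurable_normal_pdf.
have E (g : R * R -> \bar R) : measurable_fun [set: R * R] g -> (forall z, 0 <= g z) ->
    \int[gam]_x \int[gam]_y g (x, y) = \int[mu]_x \int[mu]_y (g (x, y) * (p x * p y)%:E).
  move=> mg g0.
  rewrite ge0_integral_normal; last 2 first.
  - exact: (@measurable_fun_fubini_tonelli_F _ _ _ _ _ gam g).
  - by move=> x; apply: integral_ge0.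
  apply: eq_integral => x _; rewrite ge0_integral_normal//; last first.
    by apply: (measurableT_comp mg); exact: pair1_measurable.
  rewrite -ge0_integralZr//.
  - by apply: eq_integral => y _; rewrite EFinM (muleC (p x)%:E) muleA.
  - apply: emeasurable_funM; last exact/measurable_EFinP.
    by apply: (measurableT_comp mg); exact: pair1_measurable.
  - by move=> y _; rewrite mule_ge0// lee_fin.
  - by rewrite lee_fin.
pose F z := h z * (p z.1 * p z.2)%:E.
have mF : measurable_fun [set: R * R] F.
  apply: emeasurable_funM => //; apply/measurable_EFinP.
  by apply: measurable_funM; apply: (measurableT_comp mp).
have F0 z : 0 <= F z by rewrite mule_ge0// lee_fin mulr_ge0.
rewrite (E h)// -[RHS](ge0_lebesgue2_rot cs1 s0 mF F0).
pose h' z := h ((c * z.1 + s * z.2)%R, (- s * z.1 + c * z.2)%R).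
have mh' : measurable_fun [set: R * R] h' by apply: (measurableT_comp mh); exact: measurable_linear2.
have h'0 z : 0 <= h' z by exact: h0.
transitivity (\int[mu]_x \int[mu]_y (h' (x, y) * (p x * p y)%:E)); first exact: (E h' mh' h'0).
  apply: eq_integral => x _; apply: eq_integral => y _; rewrite /h' /F /=; congr (_ * EFin _).
  rewrite /p !normal_pdf01E mulrACA [RHS]mulrACA -!expRD; congr (_ * expR _)%R.
  rewrite -!mulrDl -!opprD; congr (- _ / _)%R.
  transitivity ((c ^+ 2 + s ^+ 2) * (x ^+ 2 + y ^+ 2))%R; first by rewrite cs1 mul1r.
  ring.
Qed.

End StandardGaussian.

Section YonedaMeasurability.
Context {R : realType}.

(* Measurability of a functional of a family of reals, tested against all
   measurable families: this replaces a product sigma-algebra on [I -> R]. *)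
Definition ymeas (I : Type) (f : (I -> R) -> \bar R) : Prop :=
  forall d (T : measurableType d) (X : T -> I -> R),
    (forall i, measurable_fun [set: T] (X^~ i)) ->
    measurable_fun [set: T] (fun t => f (X t)).

End YonedaMeasurability.

Section GaussianColumns.
Context {R : realType} (J : finType).
Local Open Scope ereal_scope.
Notation gam := (@normal_prob R 0%R 1%R).
Implicit Types (cs ds : seq (J -> R)) (phi : (J -> R) -> \bar R).

(* [gcols cs phi u] is E phi(u + sum_p xi_p c_p), the xi_p i.i.d. standard
   normal and the c_p the columns in the list [cs]. *)
Fixpoint gcols cs phi (u : J -> R) : \bar R :=
  match cs with
  | [::] => phi u
  | c :: cs' => \int[gam]_t gcols cs' phi (fun j => u j + t * c j)%R
  end.

Definition gram cs (i j : J) : R := (\sum_(c <- cs) c i * c j)%R.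

Lemma gram_cons c cs i j : gram (c :: cs) i j = (c i * c j + gram cs i j)%R.
Proof. by rewrite /gram big_cons. Qed.

Lemma gram_diag_ge0 cs i : (0 <= gram cs i i)%R.
Proof. by apply: sumr_ge0 => c _; rewrite -expr2 sqr_ge0. Qed.

Lemma gram_diag0 cs i j : gram cs i i = 0%R -> gram cs i j = 0%R.
Proof.
elim: cs => [|c cs IH]; first by rewrite /gram !big_nil.
rewrite !gram_cons => /eqP; rewrite paddr_eq0 ?gram_diag_ge0//; last first.
  by rewrite -expr2 sqr_ge0.
by rewrite mulf_eq0 orbb => /andP[/eqP -> /eqP /IH ->]; rewrite mul0r add0r.
Qed.

Variable phi : (J -> R) -> \bar R.
Hypothesis mphi : ymeas phi.
Hypothesis phi0 : forall u, 0 <= phi u.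

Lemma gcols_ge0 cs u : 0 <= gcols cs phi u.
Proof. by elim: cs u => [|c cs IH] u //=; apply: integral_ge0. Qed.

Lemma ymeas_gcols cs : ymeas (gcols cs phi).
Proof.
elim: cs => [//|c cs IH] d T X mX /=.
apply: (@measurable_fun_fubini_tonelli_F _ _ T _ R gam
  (fun z => gcols cs phi (fun j => X z.1 j + z.2 * c j)%R)).
  apply: IH => j; apply: measurable_funD.
    exact: (measurableT_comp (mX j)).
  by apply: measurable_funM.
by move=> z; exact: gcols_ge0.
Qed.

Lemma measurable_gcols_line cs (u c : J -> R) :
  measurable_fun [set: R] (fun t => gcols cs phi (fun j => u j + t * c j)%R).
Proof.
apply: ymeas_gcols => j; apply: measurable_funD => //; exact: mulrr_measurable.
Qed.

Lemma gcolsN c cs u : gcols ((fun j => - c j)%R :: cs) phi u = gcols (c :: cs) phi u.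
Proof.
rewrite /= -[RHS]ge0_integral_normalN.
- by apply: eq_integral => t _; congr gcols; apply/funext => j; rewrite mulrN mulNr.
- exact: measurable_gcols_line.
- by move=> t; exact: gcols_ge0.
Qed.

Lemma gcols_rot (c d : J -> R) cs u (a b : R) : (a ^+ 2 + b ^+ 2 = 1)%R -> b != 0%R ->
  gcols ((fun j => a * c j + b * d j)%R :: (fun j => - b * c j + a * d j)%R :: cs) phi u =
  gcols (c :: d :: cs) phi u.
Proof.
move=> ab1 b0 /=.
pose h z := gcols cs phi (fun j => u j + z.1 * c j + z.2 * d j)%R.
rewrite -[RHS](@ge0_integral_normal2_rot _ h a (- b)).
- apply: eq_integral => x _; apply: eq_integral => y _; rewrite /h /=.
  by congr gcols; apply/funext => j; ring.
- by rewrite sqrrN.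
- by rewrite oppr_eq0.
- apply: ymeas_gcols => j; apply: measurable_funD; first apply: measurable_funD => //.
    by apply: measurable_funM.
  by apply: measurable_funM.
- by move=> z; exact: gcols_ge0.
Qed.

Lemma gcols_zero cs u : (forall i, gram cs i i = 0%R) -> gcols cs phi u = phi u.
Proof.
elim: cs u => [//|c cs IH] u g0 /=.
have c0 i : c i = 0%R /\ gram cs i i = 0%R.
  move: (g0 i); rewrite gram_cons => /eqP; rewrite paddr_eq0 ?gram_diag_ge0//; last first.
    by rewrite -expr2 sqr_ge0.
  by rewrite mulf_eq0 orbb => /andP[/eqP -> /eqP ->].
under eq_integral => t _.
  rewrite IH; last by move=> i; have [] := c0 i.
  rewrite (_ : (fun j => _) = u); last first.
    by apply/funext => j; have [-> _] := c0 j; rewrite mulr0 addr0.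
  over.
by rewrite integral_cst//= probability_setT mule1.
Qed.

(* Givens rotations move the whole of row [i] into the first column. *)
Lemma gcols_reduce (i : J) cs : cs <> [::] ->
  exists (c : J -> R) (rest : seq (J -> R)),
    [/\ gram rest i i = 0%R, (0 <= c i)%R, forall a b, gram (c :: rest) a b = gram cs a b &
      forall u, gcols (c :: rest) phi u = gcols cs phi u].
Proof.
elim: cs => [//|c [|c1 cs] IH] _.
  have [ci|ci] := leP 0%R (c i).
    by exists c, [::]; split => //; rewrite /gram big_nil.
  exists (fun j => - c j)%R, [::]; split.
  - by rewrite /gram big_nil.
  - by rewrite oppr_ge0 ltW.
  - by move=> a b; rewrite !gram_cons mulrNN.
  - by move=> u; rewrite gcolsN.
have [//|d [rest [rest0 d0 Gd Ed]]] := IH.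
have {}Ed u : gcols (c :: c1 :: cs) phi u = gcols (c :: d :: rest) phi u.
  by apply: eq_integral => t _; exact/esym/Ed.
have {}Gd a b : gram (c :: c1 :: cs) a b = gram (c :: d :: rest) a b.
  by rewrite gram_cons -Gd [RHS]gram_cons.
(* The rotation by three shears needs a nonzero sine; when [d i] vanishes a change of sign is
   enough. *)
have [di|di] := eqVneq (d i) 0%R.
  have dr0 : gram (d :: rest) i i = 0%R by rewrite gram_cons di mul0r add0r.
  have [ci|ci] := leP 0%R (c i).
    by exists c, (d :: rest); split => //.
  exists (fun j => - c j)%R, (d :: rest); split => //.
  - by rewrite oppr_ge0 ltW.
  - by move=> a b; rewrite Gd [LHS]gram_cons [RHS]gram_cons mulrNN.
  - by move=> u; rewrite gcolsN.
pose r := Num.sqrt (c i ^+ 2 + d i ^+ 2).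
have r2 : (r ^+ 2 = c i ^+ 2 + d i ^+ 2)%R by rewrite sqr_sqrtr// addr_ge0 ?sqr_ge0.
have r0 : (0 < r)%R.
  by rewrite sqrtr_gt0 ltr_wpDl ?sqr_ge0// exprn_even_gt0.
have rN0 : r != 0%R by rewrite gt_eqF.
pose a := (c i / r)%R; pose b := (d i / r)%R.
have ab1 : (a ^+ 2 + b ^+ 2 = 1)%R.
  by rewrite /a /b !expr_div_n -mulrDl -r2 divff// expf_neq0.
have b0 : b != 0%R by rewrite mulf_neq0// invr_neq0.
exists (fun j => a * c j + b * d j)%R, ((fun j => - b * c j + a * d j)%R :: rest); split.
- rewrite gram_cons rest0 /a /b.
  by rewrite (_ : (- (d i / r) * c i + c i / r * d i = 0)%R) ?mul0r ?addr0//; ring.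
- rewrite /a /b mulrAC -expr2 [(d i / r * _)%R]mulrAC -expr2 -mulrDl -r2.
  by rewrite divr_ge0 ?sqr_ge0// ltW.
- move=> x y; rewrite Gd !gram_cons !addrA; congr (_ + _)%R.
  transitivity ((a ^+ 2 + b ^+ 2) * (c x * c y + d x * d y))%R; last by rewrite ab1 mul1r.
  ring.
- by move=> u; rewrite gcols_rot// Ed.
Qed.

(* After reduction the first column is the same for both families, as in the
   Cholesky decomposition. *)
Lemma gcols_gram cs ds u : (forall a b, gram cs a b = gram ds a b) ->
  gcols cs phi u = gcols ds phi u.
Proof.
(* The induction runs over a list outside which all variances vanish; each round removes one
   coordinate. *)
have : forall i, i \notin enum J -> gram cs i i = 0%R.
  by move=> i; rewrite mem_enum.
elim: (enum J) cs ds u => [|i s IH] cs ds u s0 G.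
  by rewrite !gcols_zero// => j; rewrite -?G s0.
have [gi|gi] := eqVneq (gram cs i i) 0%R.
  apply: IH => // j js; have [->//|ji] := eqVneq j i.
  by apply: s0; rewrite inE negb_or ji.
have csN : cs <> [::] by move=> cs0; move: gi; rewrite cs0 /gram big_nil eqxx.
have dsN : ds <> [::] by move=> ds0; move: gi; rewrite G ds0 /gram big_nil eqxx.
have [c [cr [cr0 c0 Gc <-]]] := gcols_reduce i csN.
have [d [dr [dr0 d0 Gd <-]]] := gcols_reduce i dsN.
have cE : (c i * c i = gram cs i i)%R by rewrite -Gc gram_cons cr0 addr0.
have dE : (d i * d i = gram cs i i)%R by rewrite G -Gd gram_cons dr0 addr0.
have cd : c i = d i.
  by apply/eqP; rewrite -(eqrXn2 (n := 2)) ?expr2 ?cE ?dE.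
have ci0 : c i != 0%R by apply: contraNneq gi => ci; rewrite -cE ci mul0r.
(* The first column is row [i] of the Gram matrix divided by [c i], since the other columns vanish
   at [i]. *)
have {}cd : c = d.
  apply/funext => j; apply: (mulfI ci0).
  transitivity (gram cs i j); first by rewrite -Gc gram_cons (gram_diag0 _ cr0) addr0.
  by rewrite G -Gd gram_cons (gram_diag0 _ dr0) addr0 cd.
apply: eq_integral => t _; rewrite cd; apply: IH.
  move=> j js; have [->//|ji] := eqVneq j i.
  have : gram cs j j = 0%R by apply: s0; rewrite inE negb_or ji.
  rewrite -Gc gram_cons => /eqP; rewrite paddr_eq0 ?gram_diag_ge0//; last first.
    by rewrite -expr2 sqr_ge0.
  by move=> /andP[_ /eqP].
move=> a b; apply: (@addrI _ (c a * c b)%R).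
by rewrite -gram_cons Gc G -Gd gram_cons cd.
Qed.

End GaussianColumns.

Section Independence.
Context {R : realType} d (Omega : measurableType d) (P : probability Omega R).
Local Open Scope ereal_scope.
Notation gam := (@normal_prob R 0%R 1%R).
Variables (X : Omega -> R) (G : set (set Omega)) (c : R).
Hypotheses (mX : measurable_fun setT X) (mG : G `<=` measurable)
  (GI : setI_closed G) (GT : G setT).
Hypothesis XG : forall A E, measurable A -> G E ->
  P (X @^-1` A `&` E) = P (X @^-1` A) * P E.
Hypothesis XN : forall A, measurable A -> P (X @^-1` A) = gam [set t | A (c * t)%R].

(** The same points with a smaller sigma-algebra: the identity map into [Omega'] stands for all the
    other variables at once, so no infinite product space is needed. *)
Let Omega' := g_sigma_algebraType G.

Let measurable_sub (E : set Omega) : measurable (E : set Omega') -> measurable E.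
Proof. by apply: smallest_sub => //; exact: sigma_algebra_measurable. Qed.

Let measurable_id : measurable_fun setT (fun w : Omega => w : Omega').
Proof. by move=> _ B mB; rewrite setTI; exact: measurable_sub. Qed.

Let mid_mixin := isMeasurableFun.Build _ _ _ _ _ measurable_id.
Let idG : {mfun Omega >-> Omega'} := HB.pack (fun w : Omega => w : Omega') mid_mixin.
Let mX_mixin := isMeasurableFun.Build _ _ _ _ _ mX.
Let XG_ : {mfun Omega >-> R} := HB.pack X mX_mixin.

(** Both sides are finite measures in [E] that agree on the intersection-stable family [G], which
    contains the whole space. *)
Lemma indep_sigma A E : measurable A -> <<s G >> E ->
  P (X @^-1` A `&` E) = P (X @^-1` A) * P E.
Proof.
move=> mA mE.
have mXA : measurable (X @^-1` A) by rewrite -[X @^-1` A]setTI; exact: mX.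
have PXA : P (X @^-1` A) \is a fin_num by exact: fin_num_measure.
have PXA0 : (0 <= fine (P (X @^-1` A)))%R by rewrite fine_ge0.
pose m1 := mrestr P mXA.
pose m2 := mscale (NngNum PXA0) P.
have m1E B : m1 B = P (X @^-1` A `&` B) by rewrite setIC.
have m2E B : m2 B = P (X @^-1` A) * P B by rewrite -[X in X * _](fineK PXA).
suff m12 : m1 E = m2 E by rewrite -m1E m12 m2E.
apply: (@g_sigma_algebra_measure_unique _ _ _ G mG (fun=> setT) (fun=> GT) _ m1 m2) => //.
- by rewrite bigcup_const.
- by move=> B GB; rewrite [LHS]m1E [RHS]m2E XG.
- by move=> _; rewrite [ltLHS]m1E setIT ltey_eq PXA.
Qed.


(** By [indep_sigma] the joint law of [X] and the identity into [Omega'] is a product measure, so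
    Tonelli applies; [XN] then replaces the law of [X] by that of [c] times a standard normal. *)
Lemma ge0_integral_indep (F : R * Omega' -> \bar R) :
  measurable_fun setT F -> (forall z, 0 <= F z) ->
  \int[P]_w F (X w, w) = \int[P]_w \int[gam]_t F ((c * t)%R, w).
Proof.
move=> mF F0.
have mpair : measurable_fun setT (fun w : Omega => (X w, w : Omega')).
  by apply/measurable_fun_pairP; split.
have mp_mixin := isMeasurableFun.Build _ _ _ _ _ mpair.
pose XI : {mfun Omega >-> (R * Omega')%type} := HB.pack (fun w : Omega => (X w, w : Omega')) mp_mixin.
pose P' := distribution P idG.
pose law := distribution P XG_.
have E1 : \int[P]_w F (X w, w) = \int[distribution P XI]_z F z.
  by rewrite ge0_integral_distribution.
have E2 : \int[distribution P XI]_z F z = \int[law \x P']_z F z.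
  apply: eq_measure_integral => A mA _; apply/esym.
  apply: product_measure_unique => // B E mB mE.
  by rewrite /= /distribution /pushforward/= -indep_sigma.
rewrite E1 E2 fubini_tonelli2//.
rewrite /P' ge0_integral_distribution//; last 2 first.
- exact: measurable_fun_fubini_tonelli_G.
- by move=> y; apply: integral_ge0.
apply: eq_integral => w _ /=; rewrite /fubini_G/=.
have mc : measurable_fun setT (fun t : measurableTypeR R => (c * t)%R : R) by exact: mulrl_measurable.
have mFw : measurable_fun setT (fun x => F (x, w)).
  by apply: (measurableT_comp mF); exact: pair2_measurable.
rewrite -[RHS](@ge0_integral_pushforward _ _ _ _ _ _ mc gam setT (fun x => F (x, w)))//.
apply: eq_measure_integral => A mA _.
by rewrite /law/= /distribution /pushforward/= XN.
Qed.

End Independence.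

Section CenteredGaussian.
Context {R : realType}.
Local Open Scope ereal_scope.
Notation mu := (@lebesgue_measure R).
Notation gam := (@normal_prob R 0%R 1%R).

Lemma ge0_integral_lebesgue_scale (f : R -> \bar R) (s : R) : (0 < s)%R ->
  measurable_fun [set: R] f -> (forall x, 0 <= f x) ->
  s%:E * \int[mu]_x f (s * x)%R = \int[mu]_x f x.
Proof.
move=> s0 mf f0.
have ms : measurable_fun setT (fun x : measurableTypeR R => (s * x)%R : measurableTypeR R).
  exact: mulrl_measurable.
rewrite -(@ge0_integral_pushforward _ _ _ _ _ _ ms mu setT f)//.
pose s' := NngNum (ltW s0).
rewrite -(@ge0_integral_mscale _ _ _ (pushforward mu (fun x : measurableTypeR R => (s * x)%R : measurableTypeR R)) setT measurableT s' f)//.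
apply: eq_measure_integral => A mA _; apply/esym.
apply: (@lebesgue_measure_unique R (mscale s' (pushforward mu _))) => //= _ [[u v]] _ <-.
rewrite /mscale/= /pushforward.
have -> : (fun x : R => s * x)%R @^-1` `](u, v).1, (u, v).2]%classic = `](u / s)%R, (v / s)%R]%classic.
  by apply/seteqP; split => x /=; rewrite !in_itv/= ltr_pdivrMr// ler_pdivlMr// mulrC.
rewrite !lebesgue_measure_itv/= !lte_fin ltr_pM2r ?invr_gt0//.
by case: ifP => // _; rewrite ?mule0// -!EFinB -EFinM mulrBr !mulrA ![(s * _)%R]mulrC !mulfK ?gt_eqF.
Qed.

(** Rescaling a standard normal covers the degenerate case [v = 0] as well, so only standard normal
    integrals occur from here on. *)
Lemma gauss_law_scale (v : R) (A : set R) : (0 <= v)%R -> measurable A ->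
  gauss_law v A = gam [set t | A (Num.sqrt v * t)%R].
Proof.
move=> v0 mA; rewrite /gauss_law; case: ifPn => [/eqP ->|vN0].
  rewrite sqrtr0 diracE.
  have [A0|A0] := boolP (0%R \in A).
    rewrite (_ : [set t | _] = setT) ?probability_setT//.
    by apply/seteqP; split => // t _ /=; rewrite mul0r; rewrite inE in A0.
  rewrite (_ : [set t | _] = set0) ?measure0//.
  by apply/seteqP; split => // t /=; rewrite mul0r => ?; move: A0; rewrite notin_setE.
have vgt0 : (0 < v)%R by rewrite lt_neqAle eq_sym vN0.
set s := Num.sqrt v; have s0 : (0 < s)%R by rewrite sqrtr_gt0.
have sN0 : s != 0%R by rewrite gt_eqF.
have mpdf m r (B : set R) : measurable_fun B (fun x => (normal_pdf m r x)%:E).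
  by apply: measurable_funTS; apply/measurable_EFinP; exact: measurable_normal_pdf.
have mB : measurable ([set t | A (s * t)%R] : set R).
  by rewrite -[X in measurable X]setTI; exact: (@mulrl_measurable R setT s).
rewrite /normal_prob integral_mkcond -(ge0_integral_lebesgue_scale s0); last 2 first.
- by apply: (measurable_restrictT _ mA).1.
- by move=> x; rewrite patchE; case: ifPn => // _; rewrite lee_fin normal_pdf_ge0.
rewrite [RHS]integral_mkcond -ge0_integralZl//; last 3 first.
- apply: (measurableT_comp (f := ((fun x => (normal_pdf 0 s x)%:E) \_ A))).
    exact: (measurable_restrictT _ mA).1.
  exact: mulrl_measurable.
- by move=> x _; rewrite patchE; case: ifPn => // _; rewrite lee_fin normal_pdf_ge0.
- by rewrite lee_fin ltW.
apply: eq_integral => x _; rewrite !patchE.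
have -> : (x \in [set t | A (s * t)%R]) = ((s * x)%R \in A) by apply/idP/idP; rewrite !inE.
case: ifPn => [_|_]; last by rewrite mule0.
rewrite -EFinM !normal_pdfE ?oner_neq0//; congr EFin.
rewrite mulrA; congr (_ * _)%R.
  rewrite /normal_peak expr1n -!mulrnAr sqrtrM ?sqr_ge0// sqrtr_sqr gtr0_norm// invfM mulrA divff//.
  by rewrite sqrtrM ?ler01// sqrtr1 mul1r mul1r.
rewrite /normal_fun !subr0 expr1n exprMn; congr expR.
rewrite -!mulNr -[(s ^+ 2 *+ 2)%R]mulr_natr invfM -[in RHS](mul1r (1 *+ 2)^-1)%R.
by field.
Qed.

Lemma centered_gaussianE d (Omega : measurableType d) (P : probability Omega R)
    (X : Omega -> R) (v : R) (A : set R) :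
  (0 <= v)%R -> centered_gaussian P X v -> measurable A ->
  P (X @^-1` A) = gam [set t | A (Num.sqrt v * t)%R].
Proof. by move=> v0 [_ XE] mA; rewrite XE// gauss_law_scale. Qed.

End CenteredGaussian.

Section IndependentFamily.
Context {R : realType} (I : choiceType) d (Omega : measurableType d) (P : probability Omega R).
Local Open Scope ereal_scope.
Notation gam := (@normal_prob R 0%R 1%R).

Definition upd (v : I -> R) (i : I) (t : R) : I -> R := fun j => if j == i then t else v j.

(** Plays the part of the conditional expectation given all coordinates but [i], when that
    coordinate is [c i] times a standard normal. *)
Definition gint (c : I -> R) (i : I) (f : (I -> R) -> \bar R) (v : I -> R) : \bar R :=
  \int[gam]_t f (upd v i (c i * t)%R).

Lemma gint_ge0 c i f : (forall v, 0 <= f v) -> forall v, 0 <= gint c i f v.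
Proof. by move=> f0 v; apply: integral_ge0. Qed.

Lemma ymeas_gint c i f : ymeas f -> (forall v, 0 <= f v) -> ymeas (gint c i f).
Proof.
move=> mf f0 d' T X mX; rewrite /gint.
apply: (@measurable_fun_fubini_tonelli_F _ _ T _ R gam
  (fun z => f (upd (X z.1) i (c i * z.2)%R))) => //.
apply: mf => j; rewrite /upd; case: (j == i); first by apply: measurable_funM.
exact: (measurableT_comp (mX j)).
Qed.

Variables (D : set I) (X : I -> Omega -> R) (v : I -> R).
Hypotheses (indX : mutually_independent P D X) (v0 : forall i, D i -> (0 <= v i)%R)
  (GX : forall i, D i -> centered_gaussian P (X i) (v i)).

(** Nothing, not even measurability, is known of the variables outside [D]; setting them to 0 lets
    functionals of all coordinates be evaluated. *)
Definition zext (w : Omega) (i : I) : R := if `[< D i >] then X i w else 0%R.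

Lemma measurable_zext i : measurable_fun setT (zext ^~ i).
Proof.
rewrite /zext; case: asboolP => Di; last exact: measurable_cst.
by have [mX _] := indX; exact: mX.
Qed.

(** Finite cylinder events of the variables other than [i], an intersection-stable family. *)
Let cyl (i : I) : set (set Omega) := [set E | exists (s : seq I) (B : I -> set R),
  [/\ uniq s, forall j, j \in s -> D j /\ j != i, forall j, measurable (B j) &
      E = \bigcap_(j in [set j | j \in s]) (X j @^-1` B j)]].

Let mXB j B : D j -> measurable B -> measurable (X j @^-1` B).
Proof.
by move=> Dj mB; have [mX _] := indX; rewrite -[X in measurable X]setTI; exact: (mX j Dj).
Qed.

Let cyl_measurable i : cyl i `<=` measurable.
Proof.
move=> _ [s [B [us Ds mB ->]]].
apply: fin_bigcap_measurable; first by exact: finite_seq.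
by move=> j /= /Ds[Dj _]; exact: mXB.
Qed.

Let cylT i : cyl i setT.
Proof.
exists [::], (fun=> setT); split => //.
by apply/seteqP; split => // w _ j.
Qed.

Let cylI i : setI_closed (cyl i).
Proof.
move=> _ _ [s [B [us Ds mB ->]]] [s' [B' [us' Ds' mB' ->]]].
exists (undup (s ++ s')), (fun j => (if j \in s then B j else setT) `&`
   (if j \in s' then B' j else setT)); split.
- exact: undup_uniq.
- by move=> j; rewrite mem_undup mem_cat => /orP[/Ds|/Ds'].
- by move=> j; apply: measurableI; case: ifP.
- apply/seteqP; split => [w [h h'] j /=|w h]; last split => j /= js.
  + rewrite mem_undup mem_cat => jss; split.
      by case: ifPn => // js; exact: h.
    by case: ifPn => // js; exact: h'.
  + have /= := h j; rewrite mem_undup mem_cat js /= => /(_ isT)[].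
    by rewrite ?js.
  + have /= := h j; rewrite mem_undup mem_cat js orbT /= => /(_ isT)[_].
    by rewrite ?js.
Qed.

(** The variables other than [i] are measurable for the sigma-algebra generated by [cyl i], of which
    [X i] is independent; [ge0_integral_indep] integrates [X i] out. *)
Lemma ge0_integral_zext_gint i f : D i -> ymeas f -> (forall u, 0 <= f u) ->
  \int[P]_w f (zext w) = \int[P]_w gint (Num.sqrt \o v) i f (zext w).
Proof.
move=> Di mf f0; have [mX prodX] := indX.
pose F (z : R * g_sigma_algebraType (cyl i)) := f (upd (zext z.2) i z.1).
have XG A E : measurable A -> cyl i E -> P (X i @^-1` A `&` E) = P (X i @^-1` A) * P E.
  move=> mA cE; have mE : measurable E by exact: cyl_measurable cE.
  have [s [B [us Ds mB EE]]] := cE.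
  pose B' j := if j == i then A else B j.
  have is_ : i \notin s by apply/negP => /Ds[_]; rewrite eqxx.
  have B'E j : j \in s -> B' j = B j.
    by move=> js; rewrite /B'; case: eqP => // ji; move: is_; rewrite -ji js.
  have Ds' j : j \in i :: s -> D j by rewrite inE => /predU1P[->//|/Ds[]].
  have mB' j : measurable (B' j) by rewrite /B'; case: ifP.
  have p1 := prodX (i :: s) B' _ Ds' mB'.
  have p2 := prodX s B us (fun j js => (Ds j js).1) mB.
  have E1 : X i @^-1` A `&` E = \bigcap_(j in [set j | j \in i :: s]) (X j @^-1` B' j).
    rewrite EE; apply/seteqP; split => [w [h h'] j /=|w h].
      rewrite inE => /predU1P[->|js]; first by rewrite /B' eqxx.
      by rewrite B'E//; exact: h'.
    split; first by have := h i (mem_head _ _); rewrite /B' eqxx.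
    by move=> j /= js; rewrite -B'E//; apply: h; rewrite /= inE js orbT.
  have mXA : measurable (X i @^-1` A) by exact: mXB.
  have fE (C : set Omega) : measurable C -> P C = (fine (P C))%:E.
    by move=> mC; rewrite fineK// fin_num_measure.
  rewrite (fE (X i @^-1` A `&` E)); last exact: measurableI.
  rewrite (fE (X i @^-1` A))// (fE E)// -EFinM; congr EFin.
  rewrite E1 p1 ?EE ?p2; last by rewrite /= is_.
  rewrite big_cons; congr (_ * _)%R; first by rewrite /B' eqxx.
  by apply: eq_big_seq => j js; rewrite B'E.
have mF : measurable_fun setT F.
  apply: mf => j; rewrite /upd; have [_|ji] := eqVneq j i; first exact: measurable_fst.
  rewrite /zext; have [Dj|Dj] := asboolP (D j); last exact: measurable_cst.
  apply: (measurableT_comp (f := X j : g_sigma_algebraType (cyl i) -> R)); last exact: measurable_snd.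
  move=> _ B mB; rewrite setTI; apply: sub_sigma_algebra.
  exists [:: j], (fun=> B); split => //.
    by move=> k; rewrite inE => /eqP ->.
  apply/seteqP; split => [w wB k /=|w h]; first by rewrite inE => /eqP ->.
  by apply: (h j); rewrite /= inE.
have := @ge0_integral_indep R d Omega P (X i) (cyl i) (Num.sqrt (v i)) (mX i Di)
  (@cyl_measurable i) (@cylI i) (@cylT i) XG _ F mF (fun=> f0 _).
move=> <-; last by move=> A mA; apply: centered_gaussianE => //; [exact: v0|exact: GX].
apply: eq_integral => w _; rewrite /F/=; congr f; apply/funext => j.
by rewrite /upd; case: eqP => // ->; rewrite /zext asboolT.
Qed.

End IndependentFamily.

(** * The log-Laplace transform of the activations *)

(** In the product of the two bounds the terms [r] and [- r] combine to [- r ^+ 2], and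
    [1 + u <= expR u]. This removes first-order terms from second differences. *)
Lemma ln_pair_le {R : realType} (p n m u r : R) : 0 < m -> 0 < p -> 0 < n -> 0 <= u ->
  p <= m * (1 + u) + r -> n <= m * (1 + u) - r -> ln p + ln n <= 2 * ln m + 2 * u.
Proof.
move=> m0 p0 n0 u0 pr nr.
have -> : 2 * ln m + 2 * u = ln ((m * expR u) ^+ 2).
  by rewrite lnXn ?mulr_gt0 ?expR_gt0// lnM ?posrE ?expR_gt0// expRK mulr2n; ring.
rewrite -lnM ?posrE// ler_ln ?posrE ?mulr_gt0 ?exprn_gt0 ?mulr_gt0 ?expR_gt0//.
apply: (@le_trans _ _ ((m * (1 + u)) ^+ 2)).
  apply: (@le_trans _ _ ((m * (1 + u) + r) * (m * (1 + u) - r))).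
    by rewrite ler_pM// ltW.
  by rewrite (_ : _ * _ = (m * (1 + u)) ^+ 2 - r ^+ 2) ?gerBl ?sqr_ge0//; ring.
apply: lerXn2r; rewrite ?nnegrE.
- by rewrite mulr_ge0 ?addr_ge0// ltW.
- by rewrite mulr_ge0 ?expR_ge0// ltW.
- by rewrite ler_pM2l// expR_ge1Dx.
Qed.

(** Inverting and squaring [1 - u / 2 <= expR (- (u / 2))] leaves a polynomial inequality equivalent
    to [0 <= u^2 (1 - 3 u + u^2)]. *)
Lemma expR_quad_ub {R : realType} (u : R) : `|u| <= 4^-1 -> expR u <= 1 + u + u ^+ 2.
Proof.
rewrite ler_norml => /andP[u1 u2].
have h : 1 - u / 2 <= expR (- (u / 2)) by exact: expR_ge1Dx.
have h0 : 0 < 1 - u / 2 by lra.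
have -> : expR u = (expR (- (u / 2)) ^+ 2)^-1.
  by rewrite -expRM_natl -expRN; congr expR; field.
apply: (@le_trans _ _ ((1 - u / 2) ^+ 2)^-1).
  by rewrite lef_pV2 ?posrE ?exprn_gt0 ?expR_gt0// ler_pXn2r ?nnegrE ?expR_ge0// ltW.
rewrite -div1r ler_pdivrMr ?exprn_gt0//.
have : 0 <= u ^+ 2 * (1 - 3 * u + u ^+ 2) by rewrite mulr_ge0 ?sqr_ge0//; nra.
by nra.
Qed.

Section BoundedExpectation.
Context {R : realType} d (T : measurableType d) (Q : probability T R).

Definition bmeas (g : T -> R) : Prop :=
  measurable_fun setT g /\ exists C, forall t, `|g t| <= C.

Lemma bmeas_integrable g : bmeas g -> Q.-integrable setT (EFin \o g).
Proof.
move=> [mg [C gC]].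
apply: (@le_integrable _ _ _ Q setT measurableT _ (EFin \o cst C)) => //.
- exact/measurable_EFinP.
- by move=> t _; rewrite /= lee_fin (le_trans (gC t))// ler_norm.
- by apply: finite_measure_integrable_cst.
Qed.

Lemma bmeas_cst c : bmeas (fun=> c).
Proof. by split; [exact: measurable_cst|exists `|c|]. Qed.

Lemma bmeasD f g : bmeas f -> bmeas g -> bmeas (fun t => f t + g t).
Proof.
move=> [mf [C fC]] [mg [C' gC']]; split; first exact: measurable_funD.
by exists (C + C') => t; rewrite (le_trans (ler_normD _ _))// lerD.
Qed.

Lemma bmeasM f g : bmeas f -> bmeas g -> bmeas (fun t => f t * g t).
Proof.
move=> [mf [C fC]] [mg [C' gC']]; split; first exact: measurable_funM.
by exists (C * C') => t; rewrite normrM ler_pM.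
Qed.

Lemma bmeas_sum (I : Type) (r : seq I) (f : I -> T -> R) :
  (forall i, bmeas (f i)) -> bmeas (fun t => \sum_(i <- r) f i t).
Proof.
move=> bf; elim: r => [|i r IH].
  by under eq_fun do rewrite big_nil; exact: bmeas_cst.
by under eq_fun do rewrite big_cons; exact: bmeasD.
Qed.

Lemma bmeas_expR f : bmeas f -> bmeas (fun t => expR (f t)).
Proof.
move=> [mf [C fC]]; split; first exact: measurableT_comp.
exists (expR C) => t; rewrite ger0_norm ?expR_ge0// ler_expR.
by rewrite (le_trans _ (fC t))// ler_norm.
Qed.

Definition Ex (g : T -> R) : R := (\int[Q]_t g t)%R.

Lemma ExE g : bmeas g -> (\int[Q]_t (g t)%:E)%E = (Ex g)%:E.
Proof.
move=> bg; rewrite /Ex /Rintegral fineK//.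
by apply: integrable_fin_num => //; exact: bmeas_integrable.
Qed.

Lemma ExD f g : bmeas f -> bmeas g -> Ex (fun t => f t + g t) = Ex f + Ex g.
Proof. by move=> bf bg; rewrite /Ex RintegralD//; exact: bmeas_integrable. Qed.

Lemma ExZ c g : bmeas g -> Ex (fun t => c * g t) = c * Ex g.
Proof. by move=> bg; rewrite /Ex RintegralZl//; exact: bmeas_integrable. Qed.

Lemma Ex_cst c : Ex (fun=> c) = c.
Proof. by rewrite /Ex Rintegral_cst// (_ : fine _ = 1) ?mulr1// [X in fine X]probability_setT. Qed.

Lemma Ex_le f g : bmeas f -> bmeas g -> (forall t, f t <= g t) -> Ex f <= Ex g.
Proof. by move=> bf bg fg; rewrite /Ex le_Rintegral//; exact: bmeas_integrable. Qed.

Lemma Ex_sum (I : Type) (r : seq I) (f : I -> T -> R) : (forall i, bmeas (f i)) ->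
  Ex (fun t => \sum_(i <- r) f i t) = \sum_(i <- r) Ex (f i).
Proof.
move=> bf; elim: r => [|i r IH].
  by under eq_fun do rewrite big_nil; rewrite big_nil Ex_cst.
under eq_fun do rewrite big_cons.
by rewrite big_cons ExD ?IH//; exact: bmeas_sum.
Qed.

Lemma Ex_expR_gt0 f : bmeas f -> 0 < Ex (fun t => expR (f t)).
Proof.
move=> bf; have [mf [C fC]] := bf.
apply: (@lt_le_trans _ _ (expR (- C))); first exact: expR_gt0.
rewrite -[leLHS]Ex_cst; apply: Ex_le.
- exact: bmeas_cst.
- exact: bmeas_expR.
- by move=> t; rewrite ler_expR; have := fC t; rewrite ler_norml => /andP[].
Qed.

(** The tangent to the exponential at the mean [m] lies below it and has expectation [expR m]. *)
Lemma Ex_expR_Jensen f : bmeas f -> Ex f <= ln (Ex (fun t => expR (f t))).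
Proof.
move=> bf; set m := Ex f.
rewrite -(expRK m) ler_ln ?posrE ?expR_gt0 ?Ex_expR_gt0//.
have -> : expR m = Ex (fun t => expR m * (1 - m) + expR m * f t).
  rewrite ExD ?Ex_cst ?ExZ -/m; [by ring|by []|exact: bmeas_cst|].
  by apply: bmeasM => //; exact: bmeas_cst.
apply: Ex_le.
- by apply: bmeasD; [exact: bmeas_cst|apply: bmeasM => //; exact: bmeas_cst].
- exact: bmeas_expR.
- move=> t; have -> : expR (f t) = expR m * expR (f t - m) by rewrite -expRD; congr expR; ring.
  by rewrite -mulrDr ler_pM2l ?expR_gt0// (le_trans _ (expR_ge1Dx _))//; lra.
Qed.

(** Both exponentials are expanded to second order in [t]; the linear terms [t * h] and [- t * h]
    disappear through [ln_pair_le]. *)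
Lemma Ex_expR_second_diff A B (C : R) (t : R) : bmeas A -> bmeas B ->
  0 <= C -> (forall x, `|B x| <= C) -> `|t| * C <= 4^-1 ->
  ln (Ex (fun x => expR (A x + t * B x))) + ln (Ex (fun x => expR (A x - t * B x)))
    <= 2 * ln (Ex (fun x => expR (A x))) + 2 * (t ^+ 2 * C ^+ 2).
Proof.
move=> bA bB C0 BC tC.
pose e x := expR (A x); have be : bmeas e by exact: bmeas_expR.
pose m := Ex e; pose h := Ex (fun x => e x * B x).
have m0 : 0 < m by exact: Ex_expR_gt0.
have btB s : bmeas (fun x => A x + s * B x).
  by apply: bmeasD => //; apply: bmeasM => //; exact: bmeas_cst.
have ub s : `|s| * C <= 4^-1 -> Ex (fun x => expR (A x + s * B x)) <= m * (1 + s ^+ 2 * C ^+ 2) + s * h.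
  move=> sC.
  have -> : m * (1 + s ^+ 2 * C ^+ 2) + s * h =
     Ex (fun x => (1 + s ^+ 2 * C ^+ 2) * e x + s * (e x * B x)).
    rewrite ExD ?ExZ// 1?mulrC//; first by apply: bmeasM.
    - by apply: bmeasM => //; exact: bmeas_cst.
    - by apply: bmeasM; [exact: bmeas_cst|exact: bmeasM].
  apply: Ex_le; first exact: bmeas_expR.
    apply: bmeasD; first by apply: bmeasM => //; exact: bmeas_cst.
    by apply: bmeasM; [exact: bmeas_cst|exact: bmeasM].
  move=> x; rewrite expRD -/(e x) [leRHS](_ : _ = e x * (1 + s * B x + s ^+ 2 * C ^+ 2)); last by ring.
  rewrite ler_pM2l ?expR_gt0// (le_trans (expR_quad_ub _))//.
    by rewrite normrM (le_trans _ sC)// ler_wpM2l.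
  rewrite lerD2l exprMn ler_wpM2l ?sqr_ge0//.
  by rewrite -ler_sqrt ?sqr_ge0// !sqrtr_sqr (ger0_norm C0).
have ubp := ub t tC.
have ubm : Ex (fun x => expR (A x - t * B x)) <= m * (1 + t ^+ 2 * C ^+ 2) - t * h.
  have := ub (- t); rewrite normrN sqrrN => /(_ tC); rewrite mulNr.
  by under eq_fun do rewrite mulNr.
have p0 := Ex_expR_gt0 (btB t).
have n0 : 0 < Ex (fun x => expR (A x - t * B x)).
  by have := Ex_expR_gt0 (btB (- t)); under eq_fun do rewrite mulNr.
by apply: ln_pair_le m0 p0 n0 _ ubp ubm; rewrite mulr_ge0 ?sqr_ge0.
Qed.

End BoundedExpectation.

Section Representation.
Context {R : realType}.
Notation gam := (@normal_prob R 0%R 1%R).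

(** The two cases in which iterated integrals merge into one: Tonelli and Fubini. *)
Definition nice (I : Type) (f : (I -> R) -> \bar R) : Prop :=
  (forall v, (0 <= f v)%E) \/ (exists C : R, forall v, (`|f v| <= C%:E)%E).

(** Realizing the iterated integral as an expectation on one probability space makes Jensen's
    inequality and dominated convergence available. *)
Lemma giter_repr (m : nat) : exists d (T : measurableType d) (Q : probability T R) (Y : T -> nat -> R),
  (forall i, measurable_fun setT (Y ^~ i)) /\
  forall f : (nat -> R) -> \bar R, ymeas f -> nice f ->
    giter m f = (\int[Q]_t f (Y t))%E.
Proof.
elim: m => [|m [d [T [Q [Y [mY E]]]]]].
  exists _, (measurableTypeR R), gam, (fun _ _ => 0); split.
    by move=> i; exact: measurable_cst.
  by move=> f _ _ /=; rewrite integral_cst//= probability_setT mule1.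
pose Y' (z : measurableTypeR R * T) i := if i == m then z.1 else Y z.2 i.
exists _, (measurableTypeR R * T)%type, (gam \x Q)%E, Y'.
have mY' i : measurable_fun setT (Y' ^~ i).
  rewrite /Y'; case: (i == m); first exact: measurable_fst.
  exact: (measurableT_comp (mY i)).
split => // f mf nf /=.
have mfY : measurable_fun setT (fun z => f (Y' z)) by exact: mf.
have E1 t : giter m (fun v => f (fun i => if i == m then t else v i)) = (\int[Q]_s f (Y' (t, s)))%E.
  rewrite E.
  - by [].
  - move=> d' T' X mX; apply: mf => i; case: (i == m) => //.
  - by case: nf => [f0|[C fC]]; [left|right; exists C].
rewrite (eq_integral (fun t => (\int[Q]_s f (Y' (t, s)))%E)); last by move=> t _.
case: nf => [f0|[C fC]].
  by rewrite -(@fubini_tonelli1 _ _ _ _ _ gam Q (fun z => f (Y' z))).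
have iC : (gam \x Q)%E.-integrable setT (fun z => f (Y' z)).
  apply: (@le_integrable _ _ _ (gam \x Q)%E setT measurableT _ (EFin \o cst C)) => //.
    by move=> z _; rewrite (le_trans (fC _))//= lee_fin ler_norm.
  pose PQ : probability (measurableTypeR R * T)%type R := (gam \x Q)%E.
  exact: (@finite_measure_integrable_cst _ _ _ PQ setT C measurableT).
by rewrite -(integral12_prod_meas1 iC).
Qed.

Lemma gexp_repr (k : nat) : exists d (T : measurableType d) (Q : probability T R) (Y : T -> 'I_k -> R),
  (forall i, measurable_fun setT (Y ^~ i)) /\
  forall f : ('I_k -> R) -> \bar R, ymeas f -> nice f -> gexp f = (\int[Q]_t f (Y t))%E.
Proof.
have [d [T [Q [Y [mY E]]]]] := giter_repr k.
exists d, T, Q, (fun t i => Y t (nat_of_ord i)); split => // f mf nf.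
rewrite /gexp E//.
- by move=> d' T' X mX; apply: mf => i; exact: mX.
- by case: nf => [f0|[C fC]]; [left|right; exists C].
Qed.

(** [giter] integrates its last coordinate outermost whereas [gcols] does so with the head of the
    list, hence [rev]. *)
Lemma giter_gcols (J : finType) (s : nat -> J -> R) (phi : (J -> R) -> \bar R) (m : nat) (u : J -> R) :
  giter m (fun v => phi (fun a => u a + \sum_(i < m) v i * s i a)) =
  gcols (rev [seq s i | i <- iota 0 m]) phi u.
Proof.
elim: m u => [|m IH] u.
  by rewrite /=; congr phi; apply/funext => a; rewrite big_ord0 addr0.
rewrite -addn1 iotaD map_cat rev_cat /= add0n addn1 /=.
apply: eq_integral => t _; rewrite -IH; congr giter; apply/funext => v; congr phi.
apply/funext => a; rewrite big_ord_recr /= eqxx addrA addrAC; congr (_ + _ + _).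
by apply: eq_bigr => i _; rewrite (ltn_eqF (ltn_ord i)).
Qed.

Definition mcol (k : nat) (s : 'M[R]_k) (i : nat) (a : 'I_k) : R :=
  if insub i is Some c then s a c else 0.

Lemma gexp_qN_gcols (k : nat) (q : 'M[R]_k) (phi : ('I_k -> R) -> \bar R) :
  gexp (fun N => phi (qN q N)) = gcols (rev [seq mcol (msqrt q) i | i <- iota 0 k]) phi (fun=> 0).
Proof.
rewrite -giter_gcols /gexp; congr giter; apply/funext => v; congr phi.
apply/funext => a; rewrite add0r; apply: eq_bigr => c _.
by rewrite /mcol valK mulrC.
Qed.

(** Summing over the columns of the symmetric root gives [s *m s]. Together with [gcols_gram], any
    columns with Gram matrix [q] may replace those of the root. *)
Lemma gram_msqrt (k : nat) (q : 'M[R]_k) a b : psd q ->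
  gram (rev [seq mcol (msqrt q) i | i <- iota 0 k]) a b = q a b.
Proof.
move=> pq; have [[sT _] sE] := msqrtP pq.
rewrite /gram (perm_big [seq mcol (msqrt q) i | i <- iota 0 k]) /=; last by rewrite perm_rev.
rewrite big_map (_ : iota 0 k = index_iota 0 k); last by rewrite /index_iota subn0.
rewrite big_mkord -[in RHS]sE mxE; apply: eq_bigr => c _.
by rewrite /mcol valK -{2}sT mxE.
Qed.

End Representation.

Section MatrixPairing.
Context {R : realType}.

Definition mxdot {m n} (eta y : 'M[R]_(m, n)) : R := \sum_(a < m) \sum_(b < n) eta a b * y a b.

Lemma mxdotDl m n (e1 e2 y : 'M[R]_(m, n)) : mxdot (e1 + e2) y = mxdot e1 y + mxdot e2 y.
Proof.
rewrite -big_split; apply: eq_bigr => a _; rewrite -big_split; apply: eq_bigr => b _.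
by rewrite mxE mulrDl.
Qed.

Lemma mxdotZl m n c (e y : 'M[R]_(m, n)) : mxdot (c *: e) y = c * mxdot e y.
Proof.
rewrite mulr_sumr; apply: eq_bigr => a _; rewrite mulr_sumr; apply: eq_bigr => b _.
by rewrite mxE mulrA.
Qed.

Lemma mxdotC m n (e y : 'M[R]_(m, n)) : mxdot e y = mxdot y e.
Proof. by apply: eq_bigr => a _; apply: eq_bigr => b _; rewrite mulrC. Qed.

Lemma mxdotDr m n (y e1 e2 : 'M[R]_(m, n)) : mxdot y (e1 + e2) = mxdot y e1 + mxdot y e2.
Proof. by rewrite mxdotC mxdotDl ![mxdot _ y]mxdotC. Qed.

Lemma mxdotZr m n c (y e : 'M[R]_(m, n)) : mxdot y (c *: e) = c * mxdot y e.
Proof. by rewrite mxdotC mxdotZl mxdotC. Qed.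

Lemma mxdotNl m n (e y : 'M[R]_(m, n)) : mxdot (- e) y = - mxdot e y.
Proof. by rewrite -scaleN1r mxdotZl mulN1r. Qed.

Lemma mxdotNr m n (e y : 'M[R]_(m, n)) : mxdot e (- y) = - mxdot e y.
Proof. by rewrite mxdotC mxdotNl mxdotC. Qed.

Lemma mxdot0l m n (y : 'M[R]_(m, n)) : mxdot 0 y = 0.
Proof. by rewrite -(scale0r 0) mxdotZl mul0r. Qed.

Lemma mxdot_delta m n (y : 'M[R]_(m, n)) a b : mxdot (delta_mx a b) y = y a b.
Proof.
rewrite /mxdot (bigD1 a)//= (bigD1 b)//= mxE !eqxx mul1r big1 ?addr0 => [|i ib].
  rewrite big1 ?addr0// => i ia; rewrite big1// => j _.
  by rewrite mxE (negbTE ia) mul0r.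
by rewrite mxE eqxx (negbTE ib) mul0r.
Qed.

Lemma mxdot_sqr m n (y : 'M[R]_(m, n)) : mxdot y y = sqnorm y.
Proof. by []. Qed.

Lemma sqnorm_ge0 m n (y : 'M[R]_(m, n)) : 0 <= sqnorm y.
Proof. by apply: sumr_ge0 => a _; apply: sumr_ge0 => b _; rewrite sqr_ge0. Qed.

Lemma sqnorm_entry m n (y : 'M[R]_(m, n)) a b : y a b ^+ 2 <= sqnorm y.
Proof.
rewrite /sqnorm (bigD1 a)//= (bigD1 b)//= -addrA lerDl addr_ge0//.
  by apply: sumr_ge0 => j _; rewrite sqr_ge0.
by apply: sumr_ge0 => i _; apply: sumr_ge0 => j _; rewrite sqr_ge0.
Qed.

(** The norm dual to the maximum norm, hence the Lipschitz constant of [mxdot e] on boxes. *)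
Definition norm1 {m n} (e : 'M[R]_(m, n)) : R := \sum_(a < m) \sum_(b < n) `|e a b|.

Lemma norm1_ge0 m n (e : 'M[R]_(m, n)) : 0 <= norm1 e.
Proof. by apply: sumr_ge0 => a _; apply: sumr_ge0. Qed.

Lemma norm1_0 m n : norm1 (0 : 'M[R]_(m, n)) = 0.
Proof. by apply: big1 => a _; apply: big1 => b _; rewrite mxE normr0. Qed.

Lemma mxdot_norm1 m n (e y : 'M[R]_(m, n)) (rho : R) : (forall i j, `|y i j| <= rho) ->
  `|mxdot e y| <= norm1 e * rho.
Proof.
move=> yr; rewrite (le_trans (ler_norm_sum _ _ _))// mulr_suml ler_sum// => a _.
rewrite (le_trans (ler_norm_sum _ _ _))// mulr_suml ler_sum// => b _.
by rewrite normrM ler_wpM2l.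
Qed.

Lemma mxdot_mbox m n (e y z : 'M[R]_(m, n)) (rho : R) : mbox y rho z ->
  `|mxdot e z - mxdot e y| <= norm1 e * rho.
Proof.
move=> zy; rewrite -mxdotNr -mxdotDr; apply: mxdot_norm1 => i j.
by rewrite !mxE ltW.
Qed.

End MatrixPairing.

Section Kappa.
Context {R : realType}.
Variables (sigma : R -> R) (M : R).
Hypotheses (csigma : continuous sigma) (Msigma : forall t, `|sigma t| <= M).
Variable k : nat.
Implicit Types (eta q y : 'M[R]_k).

Definition wexp eta (u : 'I_k -> R) : R :=
  \sum_(a < k) \sum_(b < k) eta a b * sigma (u a) * sigma (u b).

Definition gexpw eta (u : 'I_k -> R) : \bar R := (expR (wexp eta u))%:E.

Lemma wexpE eta u : wexp eta u = mxdot eta (\matrix_(a, b) (sigma (u a) * sigma (u b))).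
Proof. by apply: eq_bigr => a _; apply: eq_bigr => b _; rewrite mxE mulrA. Qed.

Lemma wexp_bound eta u : `|wexp eta u| <= norm1 eta * M ^+ 2.
Proof.
rewrite wexpE; apply: mxdot_norm1 => i j; rewrite mxE normrM expr2.
by rewrite ler_pM.
Qed.

Lemma measurable_sigma : measurable_fun setT sigma.
Proof. exact: continuous_measurable_fun. Qed.

Lemma measurable_sum_ord d (T : measurableType d) (I : Type) (r : seq I) (f : I -> T -> R) :
  (forall i, measurable_fun setT (f i)) -> measurable_fun setT (fun t => \sum_(i <- r) f i t).
Proof.
move=> mf; elim: r => [|i r IH].
  by under eq_fun do rewrite big_nil; exact: measurable_cst.
by under eq_fun do rewrite big_cons; exact: measurable_funD.
Qed.

Lemma measurable_wexp d (T : measurableType d) (X : T -> 'I_k -> R) eta :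
  (forall i, measurable_fun setT (X ^~ i)) -> measurable_fun setT (fun t => wexp eta (X t)).
Proof.
move=> mX; apply: measurable_sum_ord => a; apply: measurable_sum_ord => b.
apply: measurable_funM; first apply: measurable_funM => //.
  exact: (measurableT_comp measurable_sigma (mX a)).
exact: (measurableT_comp measurable_sigma (mX b)).
Qed.

Lemma ymeas_gexpw eta : ymeas (gexpw eta).
Proof.
move=> d T X mX; apply/measurable_EFinP; apply: measurableT_comp => //.
exact: measurable_wexp.
Qed.

Lemma gexpw_ge0 eta u : (0 <= gexpw eta u)%E.
Proof. by rewrite lee_fin expR_ge0. Qed.

Lemma measurable_qN d (T : measurableType d) (Y : T -> 'I_k -> R) q a :
  (forall i, measurable_fun setT (Y ^~ i)) -> measurable_fun setT (fun t => qN q (Y t) a).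
Proof.
by move=> mY; apply: measurable_sum_ord => c; apply: measurable_funM.
Qed.

Definition kapR eta q : R := fine (kappa sigma eta q).

Section WithRepresentation.
Context d (T : measurableType d) (Q : probability T R) (Y : T -> 'I_k -> R).
Hypothesis mY : forall i, measurable_fun setT (Y ^~ i).
Hypothesis QY : forall f : ('I_k -> R) -> \bar R, ymeas f -> nice f -> gexp f = (\int[Q]_t f (Y t))%E.

Let W eta q t := wexp eta (qN q (Y t)).

Let bW eta q : bmeas (W eta q).
Proof.
split; first by apply: measurable_wexp => a; exact: measurable_qN.
by exists (norm1 eta * M ^+ 2) => t; exact: wexp_bound.
Qed.

Lemma gexp_Ex eta q : gexp (fun N => gexpw eta (qN q N)) = (Ex Q (fun t => expR (W eta q t)))%:E.
Proof.
rewrite QY; first by rewrite -ExE//; exact: bmeas_expR.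
- by move=> d' T' X mX; apply: ymeas_gexpw => a; exact: measurable_qN.
- by left=> v; exact: gexpw_ge0.
Qed.

Lemma kappa_Ex eta q : kappa sigma eta q = (ln (Ex Q (fun t => expR (W eta q t))))%:E.
Proof.
rewrite /kappa -/(gexp (fun N => gexpw eta (qN q N))) gexp_Ex /elog.
by rewrite leNgt Ex_expR_gt0.
Qed.

Lemma kapR_Ex eta q : kapR eta q = ln (Ex Q (fun t => expR (W eta q t))).
Proof. by rewrite /kapR kappa_Ex. Qed.

Lemma ymat_Ex q a b : ymat sigma q a b = Ex Q (fun t => sigma (qN q (Y t) a) * sigma (qN q (Y t) b)).
Proof.
have M0 : 0 <= M by rewrite (le_trans _ (Msigma 0)).
rewrite mxE QY ?ExE//.
- split; last first.
    by exists (M * M) => t; rewrite normrM ler_pM.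
  by apply: measurable_funM; apply: (measurableT_comp measurable_sigma); exact: measurable_qN.
- move=> d' T' X mX; apply/measurable_EFinP.
  by apply: measurable_funM; apply: (measurableT_comp measurable_sigma); exact: measurable_qN.
- by right; exists (M * M) => v; rewrite lee_fin normrM ler_pM.
Qed.

Lemma mxdot_ymat_Ex eta q : mxdot eta (ymat sigma q) = Ex Q (W eta q).
Proof.
have M0 : 0 <= M by rewrite (le_trans _ (Msigma 0)).
have bs a : bmeas (fun t => sigma (qN q (Y t) a)).
  split; last by exists M.
  by apply: (measurableT_comp measurable_sigma); exact: measurable_qN.
have bt a b : bmeas (fun t => eta a b * sigma (qN q (Y t) a) * sigma (qN q (Y t) b)).
  by apply: bmeasM => //; apply: bmeasM => //; exact: bmeas_cst.
rewrite /W /wexp Ex_sum; last by move=> a; exact: bmeas_sum.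
apply: eq_bigr => a _; rewrite Ex_sum//; apply: eq_bigr => b _.
rewrite ymat_Ex -ExZ; last exact: bmeasM.
by congr Ex; apply/funext => t; rewrite mulrA.
Qed.

Lemma kapR_second_diff_repr eta xi q (t : R) : `|t| * (norm1 xi * M ^+ 2) <= 4^-1 ->
  kapR (eta + t *: xi) q + kapR (eta - t *: xi) q <=
  2 * kapR eta q + 2 * (t ^+ 2 * (norm1 xi * M ^+ 2) ^+ 2).
Proof.
move=> tC; rewrite !kapR_Ex.
have E1 s : W (eta + s *: xi) q = fun x => W eta q x + s * W xi q x.
  by apply/funext => x; rewrite /W !wexpE mxdotDl mxdotZl.
have E2 : W (eta - t *: xi) q = fun x => W eta q x - t * W xi q x.
  by apply/funext => x; rewrite -scaleNr E1 mulNr.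
rewrite E1 E2; apply: (@Ex_expR_second_diff _ _ _ Q) => //.
  by rewrite mulr_ge0 ?norm1_ge0// sqr_ge0.
by move=> x; exact: wexp_bound.
Qed.

Lemma cvg_qN (q : 'M[R]_k) (u : nat -> 'M[R]_k) (t : T) a :
  psd q -> (forall n, psd (u n)) -> u n @[n --> \oo] --> q ->
  qN (u n) (Y t) a @[n --> \oo] --> qN q (Y t) a.
Proof.
move=> pq pu uq.
have h : msqrt (u n) @[n --> \oo] --> msqrt q.
  apply: (cvg_comp u (@msqrt R k)); last exact: msqrt_cvg.
  move=> V /= VV; rewrite nbhs_simpl /=.
  have uV : \forall n \near \oo, psd (u n) -> V (u n) by exact: uq _ VV.
  by apply: (@filterS _ \oo _ _ _ _ uV) => n Vn; exact: Vn (pu n).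
apply: cvg_sumr => c; apply: cvgMl; last by move/cvg_mxP: h; exact.
Qed.

(** Dominated convergence with the constant bound of [wexp_bound]; the integrands converge because
    the square root and [sigma] are continuous. *)
Lemma kapR_seq (eta q : 'M[R]_k) (u : nat -> 'M[R]_k) :
  psd q -> (forall n, psd (u n)) -> u n @[n --> \oo] --> q ->
  kapR eta (u n) @[n --> \oo] --> kapR eta q.
Proof.
move=> pq pu uq; rewrite kapR_Ex; under eq_fun do rewrite kapR_Ex.
pose f_ n t := (expR (W eta (u n) t))%:E.
have [_ _ h] : [/\ Q.-integrable setT (fun t => (expR (W eta q t))%:E),
   (\int[Q]_x `|f_ n x - (expR (W eta q x))%:E|)%E @[n --> \oo] --> 0%E &
   (\int[Q]_x f_ n x)%E @[n --> \oo] --> (\int[Q]_x (expR (W eta q x))%:E)%E].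
  apply: (@dominated_convergence _ T R Q setT measurableT f_ _ (EFin \o cst (expR (norm1 eta * M ^+ 2)))).
  - by move=> n; apply/measurable_EFinP; exact: (bmeas_expR (bW eta (u n))).1.
  - by apply/measurable_EFinP; exact: (bmeas_expR (bW eta q)).1.
  - apply: aeW => t _; apply: cvg_EFin; first by exact: nearW.
    apply: (cvg_comp (fun n => W eta (u n) t) (@expR R)); last exact: continuous_expR.
    apply: cvg_sumr => a; apply: cvg_sumr => b; apply: cvgM; first apply: cvgM.
    + exact: cvg_cst.
    + by apply: (cvg_comp _ sigma (@cvg_qN q u t a pq pu uq)); exact: csigma.
    + by apply: (cvg_comp _ sigma (@cvg_qN q u t b pq pu uq)); exact: csigma.
  - exact: finite_measure_integrable_cst.
  - apply: aeW => t n _; rewrite /f_ /= lee_fin ger0_norm ?expR_ge0// ler_expR.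
    exact: le_trans (ler_norm _) (wexp_bound eta _).
apply: (cvg_comp (fun n => Ex Q (fun t => expR (W eta (u n) t))) (@ln R)); last first.
  by apply: continuous_ln; apply: Ex_expR_gt0.
rewrite ExE in h; last exact: bmeas_expR.
by have /fine_cvgP[_] := h.
Qed.

End WithRepresentation.

Lemma kappaE eta q : kappa sigma eta q = (kapR eta q)%:E.
Proof. by have [d [T [Q [Y [mY QY]]]]] := @gexp_repr R k; rewrite /kapR (kappa_Ex mY QY). Qed.

Lemma gexpw_kapR eta q : gexp (fun N => gexpw eta (qN q N)) = (expR (kapR eta q))%:E.
Proof.
have [d [T [Q [Y [mY QY]]]]] := @gexp_repr R k.
rewrite (gexp_Ex mY QY) (kapR_Ex mY QY) lnK// posrE; apply: Ex_expR_gt0.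
split; first by apply: measurable_wexp => a; exact: measurable_qN.
by exists (norm1 eta * M ^+ 2) => t; exact: wexp_bound.
Qed.

Lemma kapR0 q : kapR 0 q = 0.
Proof.
have [d [T [Q [Y [mY QY]]]]] := @gexp_repr R k.
rewrite (kapR_Ex mY QY) (_ : (fun t => _) = fun=> 1) ?Ex_cst ?ln1//.
by apply/funext => t; rewrite wexpE mxdot0l expR0.
Qed.

Lemma kapR_second_diff xi : exists C t0 : R, [/\ 0 <= C, 0 < t0 &
  forall eta q t, 0 <= t -> t <= t0 ->
    kapR (eta + t *: xi) q + kapR (eta - t *: xi) q <= 2 * kapR eta q + C * t ^+ 2].
Proof.
have [d [T [Q [Y [mY QY]]]]] := @gexp_repr R k.
set D := norm1 xi * M ^+ 2; have D0 : 0 <= D by rewrite mulr_ge0 ?norm1_ge0// sqr_ge0.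
have D1 : 0 < D + 1 by rewrite ltr_wpDl.
(* This [t0] ensures [t * D <= 4^-1], the range of [expR_quad_ub]; the added 1 guards against
   [D = 0]. *)
exists (2 * D ^+ 2), (4^-1 / (D + 1)); split.
- by rewrite mulr_ge0// sqr_ge0.
- by rewrite divr_gt0.
- move=> eta q t t0; rewrite ler_pdivlMr// => tD.
  have := @kapR_second_diff_repr _ T Q Y mY QY eta xi q t.
  rewrite -/D ger0_norm// => h; apply: le_trans (h _) _.
    by rewrite (le_trans _ tD)// ler_wpM2l// lerDl.
  by rewrite lerD2l mulrCA mulrA -mulrA [X in _ <= X]mulrC.
Qed.

Lemma kapR_Jensen eta q : mxdot eta (ymat sigma q) <= kapR eta q.
Proof.
have [d [T [Q [Y [mY QY]]]]] := @gexp_repr R k.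
rewrite (mxdot_ymat_Ex mY QY) (kapR_Ex mY QY); apply: Ex_expR_Jensen.
split; first by apply: measurable_wexp => a; exact: measurable_qN.
by exists (norm1 eta * M ^+ 2) => t; exact: wexp_bound.
Qed.


(** Dominated convergence is sequential, so uniformity on a box is obtained from a sequence of
    counterexamples in shrinking boxes. *)
Lemma kapR_cont eta q (e : R) : psd q -> 0 < e -> exists2 rho, 0 < rho &
  forall q', psd q' -> mbox q rho q' -> `|kapR eta q' - kapR eta q| < e.
Proof.
move=> pq e0; apply: contrapT => h.
have h' n : exists q', [/\ psd q', mbox q n.+1%:R^-1 q' & e <= `|kapR eta q' - kapR eta q|].
  apply: contrapT => hn; apply: h; exists n.+1%:R^-1; first by rewrite invr_gt0.
  move=> q' pq' q'q; rewrite ltNge; apply/negP => eq'; apply: hn.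
  by exists q'.
have [u hu] := choice h'.
have uq : u n @[n --> \oo] --> q.
  apply/cvg_mxP => a b; apply/cvgrPdist_lt => r r0.
  near=> n; rewrite distrC; have [_ /(_ a b) hn _] := hu n.
  by apply: lt_trans hn _; near: n; exact: near_infty_natSinv_lt (PosNum r0).
have [d [T [Q [Y [mY QY]]]]] := @gexp_repr R k.
have := @kapR_seq _ T Q Y mY QY eta q u pq (fun n => let: And3 p _ _ := hu n in p) uq.
move=> /cvgrPdist_lt/(_ _ e0) [N _ /(_ N (leqnn N))] /=.
by rewrite distrC ltNge; have [_ _ ->] := hu N.
Unshelve. all: by end_near. Qed.

Lemma kappa_star_leP y q (c : R) :
  (kappa_star sigma y q <= c%:E)%E <-> forall eta, mxdot eta y - kapR eta q <= c.
Proof.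
split=> [h eta|h].
  rewrite -lee_fin; apply: le_trans h; apply: ereal_sup_ubound; exists eta => //.
  by rewrite kappaE -EFinB.
apply: ge_ereal_sup => _ [eta _ <-]; rewrite kappaE -EFinB lee_fin.
exact: h.
Qed.

Lemma kappa_star_ge0 y q : (0 <= kappa_star sigma y q)%E.
Proof.
apply: ereal_sup_ubound; exists 0 => //.
by rewrite kappaE kapR0 -/(mxdot 0 y) mxdot0l sube0.
Qed.

(** If every [<eta, y>] is at most [kappa eta], the second difference at 0 and Jensen at [- t xi]
    give [t <xi, y> <= C t^2 + t <xi, ymat>]. Dividing by a small [t] yields one inequality, and
    [- xi] the other. *)
Lemma kappa_star_eq0 y q : (kappa_star sigma y q <= 0)%E <-> y = ymat sigma q.
Proof.
split=> [/kappa_star_leP h|->]; last first.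
  by apply/kappa_star_leP => eta; rewrite subr_le0 kapR_Jensen.
have key xi : mxdot xi y <= mxdot xi (ymat sigma q).
  have [C [t0 [C0 t00 SD]]] := kapR_second_diff xi.
  apply/ler_addgt0Pr => e e0.
  pose t := Num.min t0 (e / (C + 1)).
  have C1 : 0 < C + 1 by rewrite ltr_wpDl.
  have tgt0 : 0 < t by rewrite lt_min t00 divr_gt0.
  have := SD 0 q t (ltW tgt0); rewrite ge_min lexx => /(_ isT).
  rewrite !add0r kapR0 mulr0 add0r => sd.
  have h1 := h (t *: xi); rewrite mxdotZl in h1.
  have h2 := kapR_Jensen (- (t *: xi)) q; rewrite mxdotNl mxdotZl in h2.
  have te : t * C <= e.
    rewrite (@le_trans _ _ (e / (C + 1) * C))//; first by rewrite ler_wpM2r// ge_min lexx orbT.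
    by rewrite mulrAC ler_pdivrMr// ler_wpM2l ?lerDl// ltW.
  rewrite -(ler_pM2l tgt0) mulrDr.
  have : C * t ^+ 2 <= t * e by rewrite expr2 mulrCA ler_wpM2l// 1?mulrC// ltW.
  lra.
apply/matrixP => a b; apply/eqP; rewrite eq_le -!mxdot_delta key.
by have := key (- delta_mx a b); rewrite !mxdotNl lerN2.
Qed.

End Kappa.

(** * Local large deviation estimates *)

Section ExponentialBounds.
Context {R : realType} d (Omega : measurableType d) (P : probability Omega R).
Local Open Scope ereal_scope.

Let mexp (f : Omega -> R) (A : set Omega) : measurable_fun setT f ->
  measurable_fun A (fun w => (expR (f w))%:E).
Proof.
by move=> mf; apply: measurable_funTS; apply/measurable_EFinP; exact: measurableT_comp.
Qed.

Lemma integral_expR_ub (A : set Omega) (f : Omega -> R) (c : R) :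
  measurable A -> measurable_fun setT f -> (forall w, A w -> f w <= c)%R ->
  \int[P]_(w in A) (expR (f w))%:E <= (expR c)%:E * P A.
Proof.
move=> mA mf fc; rewrite -integral_cst//.
apply: ge0_le_integral => //.
- exact: (mexp mf).
- by move=> w Aw; rewrite lee_fin ler_expR fc.
Qed.

Lemma integral_expR_lb (A : set Omega) (f : Omega -> R) (c : R) :
  measurable A -> measurable_fun setT f -> (forall w, A w -> c <= f w)%R ->
  (expR c)%:E * P A <= \int[P]_(w in A) (expR (f w))%:E.
Proof.
move=> mA mf fc; rewrite -integral_cst//.
apply: ge0_le_integral => //.
- by move=> w _; rewrite lee_fin expR_ge0.
- exact: (mexp mf).
- by move=> w Aw; rewrite lee_fin ler_expR fc.
Qed.

Lemma integral_expR_markov (A B : set Omega) (f : Omega -> R) (c : R) :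
  measurable A -> measurable B -> measurable_fun setT f -> (forall w, B w -> c <= f w)%R ->
  (expR c)%:E * P (A `&` B) <= \int[P]_(w in A) (expR (f w))%:E.
Proof.
move=> mA mB mf fc.
apply: (@le_trans _ _ (\int[P]_(w in A `&` B) (expR (f w))%:E)).
  by apply: integral_expR_lb => //; [exact: measurableI|move=> w [_ /fc]].
by apply: ge0_subset_integral => //; [exact: measurableI|exact: (mexp mf)].
Qed.

End ExponentialBounds.

Section LocalEstimates.
Context {R : realType} (k m n : nat).
Variables (K : 'M[R]_(m, n) -> 'M[R]_k -> R) (D : set 'M[R]_k).

Hypothesis Kcont : forall eta q (e : R), D q -> 0 < e -> exists2 rho, 0 < rho &
  forall q', D q' -> mbox q rho q' -> `|K eta q' - K eta q| < e.

Definition mxmeas {d} {Omega : measurableType d} {m' n'} (S : Omega -> 'M[R]_(m', n')) : Prop :=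
  forall i j, measurable_fun setT (fun w => S w i j).

Lemma mxmeas_mbox {d} {Omega : measurableType d} {m' n'} (S : Omega -> 'M[R]_(m', n')) y rho :
  mxmeas S -> measurable (S @^-1` mbox y rho).
Proof.
move=> mS; rewrite (_ : _ @^-1` _ = \bigcap_(ij in [set: 'I_m' * 'I_n'])
    (fun w => `|S w ij.1 ij.2 - y ij.1 ij.2|) @^-1` [set r | r < rho]); last first.
  by apply/seteqP; split => [w h [i j] _|w h i j]; [exact: h|exact: (h (i, j))].
apply: fin_bigcap_measurable => // -[i j] _.
rewrite -[X in measurable X]setTI.
have mf : measurable_fun setT (fun w => `|S w i j - y i j|).
  by apply: measurableT_comp => //; apply: measurable_funB.
by apply: mf => //; rewrite (_ : [set r | r < rho] = `]-oo, rho[%classic).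
Qed.

Lemma mxmeas_mxdot {d} {Omega : measurableType d} {m' n'} (S : Omega -> 'M[R]_(m', n')) eta :
  mxmeas S -> measurable_fun setT (fun w => mxdot eta (S w)).
Proof.
move=> mS; apply: measurable_sum_ord => a; apply: measurable_sum_ord => b.
exact: measurable_funM.
Qed.

(* Integrated over boxes for [G]: the conditional logarithmic moment generating
   function of [N *: S] given [G] is exactly [N * K eta G]. *)
Definition cond_cgf {d} {Omega : measurableType d} (P : probability Omega R)
    (G : Omega -> 'M[R]_k) (S : Omega -> 'M[R]_(m, n)) (N : R) : Prop :=
  [/\ forall w, D (G w), mxmeas G, mxmeas S,
      forall eta, measurable_fun setT (fun w => K eta (G w)) &
      forall q rho eta,
        (\int[P]_(w in G @^-1` mbox q rho) (expR (N * mxdot eta (S w)))%:E =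
         \int[P]_(w in G @^-1` mbox q rho) (expR (N * K eta (G w)))%:E)%E].

(** The slack [e], half of the gap, is spent once on the variation of [<eta, S>] near [y] and once
    on that of [K eta] near [q]. The radius is fixed before the probability space, [G], [S] and [N],
    so one choice serves all [n]. *)
Lemma local_upper eta q y (c : R) : D q -> c < mxdot eta y - K eta q ->
  exists2 rho0, 0 < rho0 & forall rho, rho <= rho0 ->
    forall d (Omega : measurableType d) (P : probability Omega R) G S N, 0 <= N ->
      cond_cgf P G S N ->
      (P (G @^-1` mbox q rho `&` S @^-1` mbox y rho) <=
        (expR (- (N * c)))%:E * P (G @^-1` mbox q rho))%E.
Proof.
move=> Dq cK; pose e := (mxdot eta y - K eta q - c) / 2.
have e0 : 0 < e by rewrite divr_gt0// subr_gt0.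
have [r1 r10 Kr1] := Kcont eta Dq e0.
have n1 : 0 < norm1 eta + 1 by rewrite ltr_wpDl// norm1_ge0.
pose r2 := e / (norm1 eta + 1).
have r20 : 0 < r2 by rewrite divr_gt0.
exists (Num.min r1 r2); first by rewrite lt_min r10.
move=> rho; rewrite le_min => /andP[rr1 rr2] d Omega P G S N N0 [DG mG mS mK E].
set A := G @^-1` _; set B := S @^-1` _.
have mA : measurable A by exact: mxmeas_mbox.
have mB : measurable B by exact: mxmeas_mbox.
have mNS : measurable_fun setT (fun w => N * mxdot eta (S w)).
  by apply: measurable_funM => //; exact: mxmeas_mxdot.
have mNK : measurable_fun setT (fun w => N * K eta (G w)) by exact: measurable_funM.
have h1 : ((expR (N * (mxdot eta y - e)))%:E * P (A `&` B) <=
    (expR (N * (K eta q + e)))%:E * P A)%E.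
  apply: (@le_trans _ _ (\int[P]_(w in A) (expR (N * mxdot eta (S w)))%:E)%E).
    apply: integral_expR_markov => // w Bw; rewrite ler_wpM2l//.
    have := mxdot_mbox eta Bw; rewrite ler_norml => /andP[h _].
    have : norm1 eta * rho <= e; last by lra.
    apply: (@le_trans _ _ ((norm1 eta + 1) * r2)); last by rewrite /r2 mulrC divfK// gt_eqF.
    rewrite (@le_trans _ _ (norm1 eta * r2))//; first by rewrite ler_wpM2l// norm1_ge0.
    by rewrite ler_wpM2r ?ltW// ltrDl.
  rewrite E; apply: integral_expR_ub => // w Aw; rewrite ler_wpM2l//.
  have := Kr1 _ (DG w) (mbox_sub rr1 Aw); rewrite ltr_norml => /andP[_]; lra.
rewrite -(@lee_pmul2l _ (expR (N * (mxdot eta y - e)))%:E) ?lte_fin ?expR_gt0//.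
apply: (le_trans h1); rewrite muleA -EFinM -expRD.
rewrite (_ : N * (mxdot eta y - e) + - (N * c) = N * (K eta q + e))//.
by rewrite /e; field.
Qed.

(** The outward normals of the faces of a box: a point outside the box lies beyond one of its
    faces. *)
Definition sdelta (i : 'I_m * 'I_n * bool) : 'M[R]_(m, n) := (-1) ^+ i.2 *: delta_mx i.1.1 i.1.2.

Lemma sdelta_out (y z : 'M[R]_(m, n)) (e : R) : ~ mbox y e z ->
  exists i, mxdot (sdelta i) y + e <= mxdot (sdelta i) z.
Proof.
move=> h; apply: contrapT => hn; apply: h => a b.
rewrite ltNge; apply/negP => he; apply: hn.
have [s0|s0] := leP 0 (z a b - y a b).
  exists (a, b, false); rewrite /sdelta expr0 scale1r !mxdot_delta.
  by move: he; rewrite ger0_norm//; lra.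
exists (a, b, true); rewrite /sdelta expr1 scaleN1r !mxdotNl !mxdot_delta.
by move: he; rewrite ltr0_norm//; lra.
Qed.

(** For convex differentiable [K] this says that the gradient at [eta] lies in the open box of
    radius [e] about [y]. It is the Chernoff condition making exit through each face exponentially
    unlikely under the tilt by [eta]. *)
Definition exposing (eta : 'M[R]_(m, n)) q y (e : R) : Prop :=
  forall i, exists2 t, 0 < t &
    K (eta + t *: sdelta i) q - K eta q < t * (mxdot (sdelta i) y + e).

Lemma exists_gt_all (I : finType) (Q : I -> R -> Prop) :
  (forall i x y, Q i x -> 0 < y -> y <= x -> Q i y) -> (forall i, exists2 x, 0 < x & Q i x) ->
  exists2 x, 0 < x & forall i, Q i x.
Proof.
move=> Qle Qex.
have h : forall i, exists x, 0 < x /\ Q i x by move=> i; have [x x0 Qx] := Qex i; exists x.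
have [f hf] := choice h.
have m0 : 0 < \big[Num.min/1]_i f i by apply: lt_bigmin => // j _; case: (hf j).
exists (\big[Num.min/1]_i f i) => // i; have [fi0 Qfi] := hf i.
by apply: Qle Qfi m0 _; exact: bigmin_le.
Qed.

(** Under the weight [expR (N <eta, S>)], Chernoff bounds over the faces leave at least half of the
    mass inside the box about [y]; undoing the tilt there costs at most [norm1 eta * e] per unit of
    [N]. The bound [kap0] is a parameter so that [eta = 0] can be used with no loss at all. *)
Lemma local_lower eta q y (e : R) : D q -> 0 < e -> exposing eta q y e ->
  exists rho0 N0 : R, 0 < rho0 /\ forall kap0 rho, rho <= rho0 ->
    (forall q', D q' -> mbox q rho q' -> kap0 <= K eta q') ->
    forall d (Omega : measurableType d) (P : probability Omega R) G S N,
      0 <= N -> N0 <= N -> cond_cgf P G S N ->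
      ((2^-1 * expR (N * (kap0 - (mxdot eta y + norm1 eta * e))))%:E * P (G @^-1` mbox q rho) <=
        P (G @^-1` mbox q rho `&` S @^-1` mbox y e))%E.
Proof.
move=> Dq e0 expo.
have hti i : exists ti, 0 < ti /\ K (eta + ti *: sdelta i) q - K eta q < ti * (mxdot (sdelta i) y + e).
  by have [ti ti0 hi] := expo i; exists ti.
have [t ht] := choice hti.
(* Of the three [c], two absorb the variations of [K (eta + t i *: sdelta i)] and [K eta] over the
   box about [q]; the third remains as decay rate. *)
pose gap i c := K (eta + t i *: sdelta i) q - K eta q + 3 * c <= t i * (mxdot (sdelta i) y + e).
have [c c0 hc] : exists2 c, 0 < c & forall i, gap i c.
  apply: exists_gt_all => [i x z gx z0 zx|i]; first by move: gx; rewrite /gap; lra.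
  have [_ h] := ht i; exists ((t i * (mxdot (sdelta i) y + e) - (K (eta + t i *: sdelta i) q - K eta q)) / 3).
    by rewrite divr_gt0// subr_gt0.
  by rewrite /gap; lra.
have [r1 r10 Kr1] := Kcont eta Dq c0.
pose good i rho := forall q', D q' -> mbox q rho q' -> K (eta + t i *: sdelta i) q' <= K (eta + t i *: sdelta i) q + c.
have [r2 r20 Kr2] : exists2 r2, 0 < r2 & forall i, good i r2.
  apply: exists_gt_all => [i x z gx z0 zx q' Dq' qq'|i]; first by apply: gx => //; exact: mbox_sub qq'.
  have [r r0 Kr] := Kcont (eta + t i *: sdelta i) Dq c0.
  exists r => // q' Dq' qq'; have := Kr q' Dq' qq'; rewrite ltr_norml => /andP[_]; lra.
pose card := (#|{: 'I_m * 'I_n * bool}|%:R : R).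
(* From this threshold on, [card * expR (- (N * c))] is at most one half. *)
exists (Num.min r1 r2), (2 * card / c); split; first by rewrite lt_min r10.
move=> kap0 rho; rewrite le_min => /andP[rr1 rr2] hk d Omega P G S N N0 N0N [DG mG mS mK E].
set A := G @^-1` _; set B := S @^-1` _.
have mA : measurable A by exact: mxmeas_mbox.
have mB : measurable B by exact: mxmeas_mbox.
have mNS eta' : measurable_fun setT (fun w => N * mxdot eta' (S w)).
  by apply: measurable_funM => //; exact: mxmeas_mxdot.
have mNK eta' : measurable_fun setT (fun w => N * K eta' (G w)) by exact: measurable_funM.
have mexp (f : Omega -> R) (F : set Omega) : measurable_fun setT f -> measurable_fun F (fun w => (expR (f w))%:E).
  by move=> mf; apply: measurable_funTS; apply/measurable_EFinP; exact: measurableT_comp.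
pose I := (\int[P]_(w in A) (expR (N * mxdot eta (S w)))%:E)%E.
have IK : I = (\int[P]_(w in A) (expR (N * K eta (G w)))%:E)%E by exact: E.
have Ige : ((expR (N * kap0))%:E * P A <= I)%E.
  rewrite IK; apply: integral_expR_lb => // w Aw; rewrite ler_wpM2l//.
  exact: hk (DG w) Aw.
have I0 : (0 <= I)%E by apply: integral_ge0 => w _; rewrite lee_fin expR_ge0.
have Ifin : I \is a fin_num.
  rewrite ge0_fin_numE// IK.
  apply: (@le_lt_trans _ _ ((expR (N * (K eta q + c)))%:E * P A)%E).
    apply: integral_expR_ub => // w Aw; rewrite ler_wpM2l//.
    have := Kr1 _ (DG w) (mbox_sub rr1 Aw); rewrite ltr_norml => /andP[_]; lra.
  by rewrite lte_mul_pinfty ?lee_fin ?expR_ge0//; rewrite (le_lt_trans (probability_le1 P mA))// ltry.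
pose out := (\int[P]_(w in A `\` B) (expR (N * mxdot eta (S w)))%:E)%E.
pose inn := (\int[P]_(w in A `&` B) (expR (N * mxdot eta (S w)))%:E)%E.
have Isplit : (I = inn + out)%E.
  rewrite /I -[X in (\int[P]_(w in X) _)%E](setUIDK A B) ge0_integral_setU//.
  - exact: measurableI.
  - exact: measurableD.
  - exact: (mexp _ _ (mNS eta)).
  - by apply/disj_setPS => w [[_ Bw] [_]].
have outle : (out <= (card * expR (- (N * c)))%:E * I)%E.
  pose h i w := N * (mxdot (eta + t i *: sdelta i) (S w) - t i * (mxdot (sdelta i) y + e)).
  have mh i : measurable_fun setT (h i).
    by apply: measurable_funM => //; apply: measurable_funB => //; exact: mxmeas_mxdot.
  apply: (@le_trans _ _ (\int[P]_(w in A) (\sum_i (expR (h i w))%:E))%E).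
    apply: (@le_trans _ _ (\int[P]_(w in A `\` B) (\sum_i (expR (h i w))%:E))%E).
      apply: ge0_le_integral => //.
      - exact: measurableD.
      - exact: (mexp _ _ (mNS eta)).
      - by apply: emeasurable_sum => i; exact: (mexp _ _ (mh i)).
      - move=> w [Aw /sdelta_out[i hi]]; rewrite (bigD1 i)//=.
        apply: (@le_trans _ _ (expR (h i w))%:E).
          rewrite lee_fin ler_expR /h ler_wpM2l// mxdotDl mxdotZl -addrA lerDl.
          by rewrite -mulrBr mulr_ge0 ?subr_ge0// ltW// (ht i).1.
        by rewrite leeDl// sume_ge0// => j _; rewrite lee_fin expR_ge0.
    apply: ge0_subset_integral => //.
    - exact: measurableD.
    - by apply: emeasurable_sum => i; exact: (mexp _ _ (mh i)).
    - by move=> w _; rewrite sume_ge0// => j _; rewrite lee_fin expR_ge0.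
  rewrite ge0_integral_sum//; last by move=> i; exact: (mexp _ _ (mh i)).
  pose x := fine ((expR (- (N * c)))%:E * I).
  have xE : ((expR (- (N * c)))%:E * I = x%:E)%E by rewrite /x fineK// fin_numM.
  rewrite EFinM -muleA xE -EFinM.
  have -> : card * x = \sum_(i : 'I_m * 'I_n * bool) x by rewrite sumr_const /card mulr_natl.
  rewrite -sumEFin; apply: lee_sum => i _; rewrite -xE.
  rewrite /h (eq_integral (fun w => (expR (- (N * (t i * (mxdot (sdelta i) y + e)))))%:E *
      (expR (N * mxdot (eta + t i *: sdelta i) (S w)))%:E)%E); last first.
    by move=> w _; rewrite -EFinM -expRD; congr (expR _)%:E; ring.
  rewrite ge0_integralZl//; last exact: (mexp _ _ (mNS _)).
  rewrite E IK -!ge0_integralZl//; [|exact: (mexp _ _ (mNK _))|exact: (mexp _ _ (mNK _))].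
  apply: ge0_le_integral => //.
  - by apply: emeasurable_funM => //; exact: (mexp _ _ (mNK _)).
  - by apply: emeasurable_funM => //; exact: (mexp _ _ (mNK _)).
  - move=> w Aw; rewrite -!EFinM -!expRD lee_fin ler_expR.
    rewrite -!mulrN -!mulrDr ler_wpM2l//.
    have /(_ (G w) (DG w) (mbox_sub rr2 Aw)) := Kr2 i.
    have := Kr1 _ (DG w) (mbox_sub rr1 Aw); rewrite ltr_norml => /andP[+ _].
    have := hc i; rewrite /gap; lra.
have card0 : 0 <= card by [].
have small : card * expR (- (N * c)) <= 2^-1.
  have Nc : 2 * card <= N * c by rewrite -ler_pdivrMr.
  rewrite expRN -[_ / _]/(card / expR (N * c)) ler_pdivrMr ?expR_gt0//.
  have := expR_ge1Dx (N * c); lra.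
have inn_ge : ((2^-1)%:E * I <= inn)%E.
  have : (out <= (2^-1)%:E * I)%E by rewrite (le_trans outle)// lee_wpmul2r// lee_fin.
  have inn0 : (0 <= inn)%E by apply: integral_ge0 => w _; rewrite lee_fin expR_ge0.
  have out0 : (0 <= out)%E by apply: integral_ge0 => w _; rewrite lee_fin expR_ge0.
  move: Isplit Ifin inn0 out0; move: (I) (inn) (out) => [i| |] [a| |] [b| |] //=.
  by rewrite -!EFinM -EFinD => -[] -> _ _ _; rewrite !lee_fin; lra.
have inn_le : (inn <= (expR (N * (mxdot eta y + norm1 eta * e)))%:E * P (A `&` B))%E.
  apply: integral_expR_ub => //; first exact: measurableI.
  move=> w [_ Bw]; rewrite ler_wpM2l//.
  by have := mxdot_mbox eta Bw; rewrite ler_norml => /andP[_]; lra.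
rewrite -(@lee_pmul2l _ (expR (N * (mxdot eta y + norm1 eta * e)))%:E) ?lte_fin ?expR_gt0//.
apply: le_trans inn_le; apply: le_trans inn_ge.
rewrite muleA -EFinM mulrCA -expRD (_ : _ + _ = N * kap0); last by ring.
rewrite EFinM -muleA.
by rewrite lee_pmul2l// lte_fin invr_gt0.
Qed.

End LocalEstimates.

Section Exposing.
Context {R : realType} (k m n : nat).
Variables (K : 'M[R]_(m, n) -> 'M[R]_k -> R) (q : 'M[R]_k).

(** An upper bound on the second derivative in each direction, without derivatives; it takes the
    place of the smoothness assumed in Gartner-Ellis. *)
Definition semiconcave : Prop := forall xi, exists C t0 : R, [/\ 0 <= C, 0 < t0 &
  forall eta t, 0 <= t -> t <= t0 ->
    K (eta + t *: xi) q + K (eta - t *: xi) q <= 2 * K eta q + C * t ^+ 2].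

Hypotheses (K0 : K 0 q = 0) (SD : semiconcave).

Lemma mxdot_sdelta (i : 'I_m * 'I_n * bool) : mxdot (sdelta i : 'M[R]_(m, n)) (sdelta i) = 1.
Proof.
case: i => [[a b] s]; rewrite /sdelta /= mxdotZl mxdotZr mxdot_delta mxE !eqxx mulr1.
by rewrite -signr_addb addbb.
Qed.

Lemma norm1_le (eta : 'M[R]_(m, n)) (H : R) : sqnorm eta <= H -> norm1 eta <= (m * n)%:R * (H + 1).
Proof.
move=> h; have hx a b : `|eta a b| <= H + 1.
  have := le_trans (sqnorm_entry eta a b) h; rewrite -(real_normK (num_real _)).
  by have := sqr_ge0 (`|eta a b| - 1); nra.
apply: (@le_trans _ _ (\sum_(a < m) \sum_(b < n) (H + 1))).
  by apply: ler_sum => a _; apply: ler_sum => b _.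
by rewrite !sumr_const !card_ord -mulrnA mulr_natl mulnC.
Qed.

Lemma near_max (T : Type) (F : T -> R) (c tau : R) (x0 : T) : (forall x, F x <= c) -> 0 < tau ->
  exists x, forall x', F x' <= F x + tau.
Proof.
move=> Fc tau0.
have hs : has_sup (range F).
  by split; [exists (F x0), x0|exists c => _ [x _ <-]].
have [_ [x _ <-] hx] := sup_adherent tau0 hs.
exists x => x'; rewrite -lerBlDr; apply: ltW; apply: le_lt_trans hx.
by rewrite lerD2r; apply: ub_le_sup; [case: hs|exists x'].
Qed.

(* Maximize [<eta, y> - K eta - delta / 2 |eta|^2] up to [tau]: the almost
   critical [eta] exposes [y - delta eta], which is close to [y]. *)
Lemma exposing_exists (y : 'M[R]_(m, n)) (c1 c rho : R) :
  (forall eta, mxdot eta y - K eta q <= c1) -> c1 < c -> 0 < rho ->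
  exists eta y' e, [/\ 0 < e, mbox y' e `<=` mbox y rho, exposing K eta q y' e &
    mxdot eta y' + norm1 eta * e - K eta q <= c].
Proof.
move=> hc1 c1c rho0.
have c10 : 0 <= c1 by have := hc1 0; rewrite mxdot0l K0 subr0.
have c11 : 0 < c1 + 1 by rewrite ltr_wpDl.
(* Comparison with [eta = 0] gives [delta |eta|^2 <= 2 (c1 + 1)], so [delta *: eta] has squared norm
   at most [2 delta (c1 + 1)]; this [delta] makes that at most [(rho / 2)^2]. *)
pose delta := Num.min 1 (rho ^+ 2 / (8 * (c1 + 1))).
have d0 : 0 < delta by rewrite lt_min ltr01/= divr_gt0 ?exprn_gt0 ?mulr_gt0.
have d1 : delta <= 1 by rewrite ge_min lexx.
have d2 : 2 * delta * (c1 + 1) <= (rho / 2) ^+ 2.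
  have : delta <= rho ^+ 2 / (8 * (c1 + 1)) by rewrite ge_min lexx orbT.
  rewrite ler_pdivlMr ?mulr_gt0// => h.
  have -> : (rho / 2) ^+ 2 = rho ^+ 2 / 4 by field.
  lra.
pose H := 2 * (c1 + 1) / delta.
have H0 : 0 <= H by rewrite divr_ge0 ?mulr_ge0// ltW.
pose L := (m * n)%:R * (H + 1) + 1.
have L0 : 0 < L by rewrite ltr_wpDl// mulr_ge0// addr_ge0.
(* [L] exceeds [norm1 eta] whenever [|eta|^2 <= H], so the radius [e] adds at most [c - c1] to the
   cost. *)
pose e := Num.min (rho / 2) ((c - c1) / L).
have e0 : 0 < e by rewrite lt_min !divr_gt0// subr_gt0.
have er : e <= rho / 2 by rewrite ge_min lexx.
have eL : e * L <= c - c1 by rewrite -ler_pdivlMr// ge_min lexx orbT.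
pose good (i : 'I_m * 'I_n * bool) (tau : R) := exists2 t, 0 < t &
  forall eta, (forall eta', mxdot eta' y - K eta' q - delta / 2 * mxdot eta' eta' <=
      mxdot eta y - K eta q - delta / 2 * mxdot eta eta + tau) ->
    K (eta + t *: sdelta i) q - K eta q < t * (mxdot (sdelta i) (y - delta *: eta) + e).
have [tau tau0 gtau] : exists2 tau, 0 < tau & forall i, good i tau.
  apply: exists_gt_all => [i x z [t t0 gx] z0 zx|i].
    exists t => // eta h; apply: gx => eta'; apply: le_trans (h eta') _.
    by rewrite lerD2l.
  have [C [t0 [C0 t00 SDi]]] := SD (sdelta i).
  rewrite /good; move: (sdelta i) (mxdot_sdelta i) SDi => xi xi1 SDi.
  (* With this [t] the quadratic terms use at most half of [t * e], and [tau = t * e / 4] a further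
     quarter. *)
  pose t := Num.min t0 (e / (2 * (C + 1))).
  have C1 : 0 < C + 1 by rewrite ltr_wpDl.
  have tp : 0 < t by rewrite lt_min t00/= divr_gt0// mulr_gt0.
  have tC : 2 * t * (C + 1) <= e.
    have : t <= e / (2 * (C + 1)) by rewrite ge_min lexx orbT.
    by rewrite ler_pdivlMr ?mulr_gt0//; lra.
  exists (t * e / 4); first by rewrite divr_gt0// mulr_gt0.
  exists t => // eta h.
  have := SDi eta t (ltW tp); rewrite ge_min lexx => /(_ isT) sd.
  (* Near maximality bounds [K] from below at [eta - t *: xi]; the second difference turns this into
     an upper bound at [eta + t *: xi]. *)
  have := h (eta - t *: xi).
  rewrite !(mxdotDl, mxdotDr, mxdotNl, mxdotNr, mxdotZl, mxdotZr) xi1.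
  rewrite [mxdot eta xi]mxdotC => hh.
  have te : t ^+ 2 * (C + 1) * 2 <= t * e.
    have -> : t ^+ 2 * (C + 1) * 2 = t * (2 * t * (C + 1)) by ring.
    by rewrite ler_wpM2l// ltW.
  have dt : delta * t ^+ 2 <= t ^+ 2 by rewrite ler_piMl ?sqr_ge0.
  have tep : 0 < t * e by rewrite mulr_gt0.
  have t2 : 0 < t ^+ 2 by rewrite exprn_gt0.
  set X := K (eta + t *: xi) q in sd *.
  set Y := K (eta - t *: xi) q in sd hh.
  set u := mxdot xi y in hh *; set v := mxdot xi eta in hh *.
  have : X - K eta q <= t * (u - delta * v) + C * t ^+ 2 + delta * t ^+ 2 / 2 + t * e / 4 by nra.
  by nra.
pose tau1 := Num.min tau 1.
have tau10 : 0 < tau1 by rewrite lt_min tau0/= ltr01.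
pose F eta := mxdot eta y - K eta q - delta / 2 * mxdot eta eta.
have Fc eta : F eta <= c1.
  have := hc1 eta; have : 0 <= delta / 2 * mxdot eta eta.
    by rewrite mulr_ge0 ?divr_ge0 ?(ltW d0)//; exact: sqnorm_ge0.
  by rewrite /F; lra.
have [eta heta] := near_max (0 : 'M[R]_(m, n)) Fc tau10.
have etaH : mxdot eta eta <= H.
  have := heta 0; rewrite /F !mxdot0l K0 mulr0 !subr0.
  have := hc1 eta; have : tau1 <= 1 by rewrite ge_min lexx orbT.
  rewrite /H ler_pdivlMr// => ? ? ?; lra.
have etan : norm1 eta * e <= c - c1.
  apply: le_trans eL; rewrite mulrC ler_wpM2l ?(ltW e0)//.
  by rewrite (le_trans (norm1_le etaH))// /L lerDl.
exists eta, (y - delta *: eta), e; split => //.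
- move=> z zy a b.
  have : `|delta * eta a b| <= rho / 2.
    rewrite -(@ler_pXn2r _ 2)// ?nnegrE ?divr_ge0 ?(ltW rho0)//.
    rewrite real_normK ?num_real// (le_trans _ d2)// exprMn.
    apply: (@le_trans _ _ (delta ^+ 2 * H)).
      by rewrite ler_wpM2l ?sqr_ge0// (le_trans (sqnorm_entry eta a b)).
    by rewrite /H le_eqVlt; apply/orP; left; apply/eqP; field; rewrite gt_eqF.
  have := zy a b; rewrite !mxE ltr_norml !ler_norml => /andP[h1 h2] /andP[h3 h4].
  by rewrite ltr_norml; apply/andP; split; lra.
- move=> i; have [t t0 gt] := gtau i; exists t => //; apply: gt => eta'.
  apply: le_trans (heta eta') _; rewrite lerD2l ge_min lexx//.
- rewrite !(mxdotDr, mxdotNr, mxdotZr).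
  have := hc1 eta; have : 0 <= delta * mxdot eta eta.
    by rewrite mulr_ge0 ?(ltW d0)//; exact: sqnorm_ge0.
  lra.
Qed.

(** The hypothesis at [- (t *: xi)] bounds [K] below there, and the second difference at 0 bounds it
    above at [t *: xi]. The tilt [eta = 0] is free, as the case of an infinite width ratio
    demands. *)
Lemma exposing_zero (y : 'M[R]_(m, n)) (e : R) :
  (forall eta, mxdot eta y - K eta q <= 0) -> 0 < e -> exposing K 0 q y e.
Proof.
move=> h e0 i; have [C [t0 [C0 t00 SDi]]] := SD (sdelta i).
move: (sdelta i) SDi => xi SDi.
pose t := Num.min t0 (e / (C + 1)).
have C1 : 0 < C + 1 by rewrite ltr_wpDl.
have tp : 0 < t by rewrite lt_min t00/= divr_gt0.
have tC : t * (C + 1) <= e by rewrite -ler_pdivlMr// ge_min lexx orbT.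
exists t => //; have := SDi 0 t (ltW tp); rewrite ge_min lexx => /(_ isT).
have := h (- (t *: xi)); rewrite !add0r K0 mulr0 add0r mxdotNl mxdotZl subr0.
set u := mxdot _ _; set X := K (t *: _) q; set Y := K (- _) q.
move=> h1 h2; have t2 : 0 < t ^+ 2 by rewrite exprn_gt0.
have : t * (t * (C + 1)) <= t * e by rewrite ler_wpM2l// ltW.
nra.
Qed.

End Exposing.

(** * From local estimates to the large deviation principle *)

(** Compactness as an induction principle. If [Q A] failed, the sets [B] with [Q (A - B)] would form
    a proper filter containing [A] but without cluster point in [A]. *)
Lemma compact_ideal (T : topologicalType) (A : set T) (Q : set T -> Prop) : compact A ->
  Q set0 -> (forall B C, Q B -> Q C -> Q (B `|` C)) -> (forall B C, B `<=` C -> Q C -> Q B) ->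
  (forall x, A x -> exists2 U, nbhs x U & Q U) -> Q A.
Proof.
move=> cA Q0 QU Qsub Qloc; apply: contrapT => QA.
pose F : set_system T := [set B | Q (A `\` B)].
have FF : ProperFilter F.
  apply: Build_ProperFilter_ex.
    move=> B FB; apply: contrapT => Bn; apply: QA; apply: Qsub FB => x Ax; split => // Bx.
    by apply: Bn; exists x.
  split.
  - by rewrite /F /= setDT.
  - by move=> B C FB FC; rewrite /F /= setDIr; exact: QU.
  - by move=> B C BC; apply: Qsub; apply: setDS.
have FA : F A by rewrite /F /= setDv.
have [x [Ax xF]] := cA F FF FA.
have [U Ux QUx] := Qloc x Ax.
have FU : F (~` U) by apply: Qsub QUx => z [_ /contrapT].
by have [z []] := xF _ _ FU Ux.
Qed.

Section Measurability.
Context {R : realType} d (Omega : measurableType d) (m n : nat).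

(** An open set is a countable union of boxes with rational centres and radii [1 / (j + 1)]. *)
Lemma mxmeas_open (Z : Omega -> 'M[R]_(m, n)) (O : set 'M[R]_(m, n)) :
  mxmeas Z -> open O -> measurable (Z @^-1` O).
Proof.
move=> mZ oO.
pose Q (i : 'M[rat]_(m, n) * nat) := mbox (map_mx (@ratr R) i.1) i.2.+1%:R^-1.
have -> : O = \bigcup_(i in [set i | Q i `<=` O]) Q i.
  apply/seteqP; split => [z Oz|z [i QO Qz]]; last exact: QO.
  have /nbhs_mboxP[rho r0 rO] : nbhs z O by apply: open_nbhs_nbhs.
  have [j jr] : exists j : nat, j.+1%:R^-1 < rho / 2.
    have r20 : 0 < rho / 2 by rewrite divr_gt0.
    have [N _ hN] := near_infty_natSinv_lt (PosNum r20).
    by exists N; exact: hN (leqnn N).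
  have hq (ab : 'I_m * 'I_n) : exists r : rat, `|z ab.1 ab.2 - ratr r| < j.+1%:R^-1.
    have j0 : 0 < j.+1%:R^-1 :> R by rewrite invr_gt0.
    have zz : z ab.1 ab.2 - j.+1%:R^-1 < z ab.1 ab.2 + j.+1%:R^-1 by rewrite ltrBlDr -addrA ltrDl addr_gt0.
    have [r] := rat_in_itvoo zz.
    by rewrite in_itv/= => /andP[h1 h2]; exists r; rewrite ltr_norml; move: h1 h2; move: (ratr r) (z _ _) (j.+1%:R^-1) => x y e ? ?; lra.
  have [f hf] := choice hq.
  exists (\matrix_(a, b) f (a, b), j) => /=.
    move=> y yq; apply: rO => a b; have := yq a b; rewrite !mxE /= => h1.
    have h2 := hf (a, b); rewrite distrC in h2.
    have := ler_distD (ratr (f (a, b))) (y a b) (z a b); move: jr h1 h2 => /=.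
    by move: (j.+1%:R^-1) => e; lra.
  by move=> a b; rewrite !mxE; exact: hf (a, b).
rewrite preimage_bigcup bigcup_mkcond; apply: countable_bigcupT_measurable => // i.
by case: ifP => // _; rewrite /Q; exact: mxmeas_mbox.
Qed.

Lemma mxmeas_closed (Z : Omega -> 'M[R]_(m, n)) (C : set 'M[R]_(m, n)) :
  mxmeas Z -> closed C -> measurable (Z @^-1` C).
Proof.
move=> mZ cC; rewrite -(setCK C) preimage_setC; apply: measurableC.
exact: (mxmeas_open mZ (closed_openC cC)).
Qed.

End Measurability.

Definition moutside {R : realType} {m p : nat} (r : R) : set 'M[R]_(m, p) :=
  [set z | exists i j, r < `|z i j|].

Section LocalLDP.
Context {R : realType} d (Omega : measurableType d) (P : probability Omega R).
Variable v : nat -> R.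
Hypotheses (v0 : forall n, 0 < v n) (voo : v n @[n --> \oo] --> +oo).

(** The prefactor [C] absorbs the number of boxes in a finite cover, which the exponential scale
    does not see. *)
Definition loc_ub {m p} (Z : nat -> Omega -> 'M[R]_(m, p)) (z : 'M[R]_(m, p)) (a : R) : Prop :=
  exists (rho C : R) (n0 : nat), 0 < rho /\ forall n, (n0 <= n)%N ->
    (P (Z n @^-1` mbox z rho) <= (C * expR (- (v n * a)))%:E)%E.

Definition loc_lb {m p} (Z : nat -> Omega -> 'M[R]_(m, p)) (z : 'M[R]_(m, p)) (a : R) : Prop :=
  forall rho, 0 < rho -> exists n0, forall n, (n0 <= n)%N ->
    ((expR (- (v n * a)))%:E <= P (Z n @^-1` mbox z rho))%E.

Definition exp_tight {m p} (Z : nat -> Omega -> 'M[R]_(m, p)) (a : R) : Prop :=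
  exists (r C : R) (n0 : nat), forall n, (n0 <= n)%N ->
    (P (Z n @^-1` moutside r) <= (C * expR (- (v n * a)))%:E)%E.

Lemma v_large (c : R) : exists n0, forall n, (n0 <= n)%N -> c <= v n.
Proof.
have /cvgryPge/(_ c) [N _ hN] := voo.
by exists N => n Nn; exact: hN.
Qed.

Lemma exp_rate_contra (C a b : R) (n0 n1 : nat) (u : nat -> \bar R) : a < b ->
  (forall n, (n0 <= n)%N -> (u n <= (C * expR (- (v n * b)))%:E)%E) ->
  (forall n, (n1 <= n)%N -> ((expR (- (v n * a)))%:E <= u n)%E) -> False.
Proof.
move=> ab ub lb.
have ba0 : 0 < b - a by rewrite subr_gt0.
have [n2 h2] := v_large ((`|C| + 1) / (b - a)).
pose n := maxn n0 (maxn n1 n2).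
have /and3P[n0n n1n n2n] : [&& n0 <= n, n1 <= n & n2 <= n]%N by rewrite -!geq_max.
have := le_trans (lb n n1n) (ub n n0n); rewrite lee_fin.
have hv : (`|C| + 1) <= v n * (b - a) by rewrite -ler_pdivrMr//; exact: h2.
have -> : expR (- (v n * b)) = expR (- (v n * a)) * expR (- (v n * (b - a))).
  by rewrite -expRD; congr expR; ring.
rewrite mulrCA -{1}[expR (- (v n * a))]mulr1 ler_pM2l ?expR_gt0// expRN ler_pdivlMr ?expR_gt0// mul1r.
have := expR_ge1Dx (v n * (b - a)); have := ler_norm C; lra.
Qed.

Context {m p : nat} (Z : nat -> Omega -> 'M[R]_(m, p)) (I : 'M[R]_(m, p) -> \bar R).
Hypotheses (mZ : forall n, mxmeas (Z n)) (I0 : forall z, (0 <= I z)%E).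
Hypothesis ZU : forall z a, (a%:E < I z)%E -> loc_ub Z z a.
Hypothesis ZL : forall z a, (I z < a%:E)%E -> loc_lb Z z a.
Hypothesis ZT : forall a, exp_tight Z a.

Let ereal_mid (x : \bar R) (a : R) : (a%:E < x)%E -> exists2 b, a < b & (b%:E < x)%E.
Proof.
case: x => [x| |]//; rewrite ?lte_fin => ax.
  by exists ((a + x) / 2); rewrite ?lte_fin; lra.
by exists (a + 1); [lra|rewrite ltry].
Qed.

Let mout r : closed (~` @moutside R m p r).
Proof.
rewrite (_ : ~` _ = [set z : 'M[R]_(m, p) | forall i j, `|z i j| <= r]).
  by apply: compact_closed; [exact: mx_hausdorff|exact: mcube_compact].
apply/seteqP; split => [z zn i j|z zr [i [j]]]; last by rewrite ltNge zr.
by rewrite leNgt; apply/negP => h; apply: zn; exists i, j.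
Qed.

Let moutm n r : measurable (Z n @^-1` @moutside R m p r).
Proof. by rewrite -[X in _ @^-1` X]setCK preimage_setC; apply: measurableC; exact: (mxmeas_closed (mZ n) (@mout r)). Qed.

(** The local bounds alone decide this: an upper bound of rate [b] on a box about [z] contradicts a
    lower bound of smaller rate on a smaller box about [z'] inside it. *)
Lemma local_lsc : lower_semicontinuous I.
Proof.
move=> z a /ereal_mid[b ab /ZU[rho [C [n0 [r0 ub]]]]].
exists (mbox z (rho / 2)); first by apply: nbhs_mbox; rewrite divr_gt0.
move=> z' zz'; rewrite ltNge; apply/negP => Iz'.
have Iz'c : (I z' < ((a + b) / 2)%:E)%E by apply: le_lt_trans Iz' _; rewrite lte_fin; lra.
have r20 : 0 < rho / 2 by rewrite divr_gt0.
have [n1 lb] := ZL Iz'c r20.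
apply: (@exp_rate_contra C ((a + b) / 2) b n0 n1 (fun n => P (Z n @^-1` mbox z rho))) => //.
  by lra.
move=> n /lb h; apply: (le_trans h); apply: le_measure; rewrite ?inE; try exact: mxmeas_mbox.
move=> w /= h' i j; have := ler_distD (z' i j) (Z n w i j) (z i j).
have := h' i j; have := zz' i j; lra.
Qed.

(** A point outside the cube with rate at most [a] would have a neighbourhood inside [moutside r] of
    probability decaying slower than the tightness bound at level [a + 1]. *)
Lemma local_sublevel_compact (a : R) : compact [set z | (I z <= a%:E)%E].
Proof.
have [r [C [n0 ub]]] := ZT (a + 1).
apply: (@subclosed_compact _ _ [set z : 'M[R]_(m, p) | forall i j, `|z i j| <= r]).
- have /lower_semicontinuousP/(_ a) := local_lsc.
  rewrite -closedC; congr closed; apply/seteqP; split => z /=.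
    by move/negP; rewrite -leNgt.
  by move=> h; apply/negP; rewrite -leNgt.
- exact: mcube_compact.
- move=> z /= Iz i j; rewrite leNgt; apply/negP => rz.
  have e0 : 0 < `|z i j| - r by rewrite subr_gt0.
  have Izc : (I z < (a + 2^-1)%:E)%E by apply: le_lt_trans Iz _; rewrite lte_fin ltrDl invr_gt0.
  have [n1 lb] := ZL Izc e0.
  apply: (@exp_rate_contra C (a + 2^-1) (a + 1) n0 n1 (fun n => P (Z n @^-1` moutside r))) => //.
    by lra.
  move=> n /lb h; apply: (le_trans h); apply: le_measure; rewrite ?inE//; first exact: mxmeas_mbox.
  move=> w /= /(_ i j) h'; exists i, j.
  have := ler_distD (Z n w i j) (z i j) 0; rewrite !subr0 distrC.
  lra.
Qed.

Lemma local_upper_closed (F : set 'M[R]_(m, p)) (a : R) : closed F ->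
  (forall z, F z -> (a%:E < I z)%E) ->
  exists (C : R) (n0 : nat), forall n, (n0 <= n)%N -> (P (Z n @^-1` F) <= (C * expR (- (v n * a)))%:E)%E.
Proof.
move=> cF Fa; have [r [C [n0 ub]]] := ZT a.
pose cube := [set z : 'M[R]_(m, p) | forall i j, `|z i j| <= r].
(* The ideal ranges over arbitrary sets, so the bound is put on an enclosing [B'] whose preimages
   are measurable. *)
pose Q (B : set 'M[R]_(m, p)) := exists B', [/\ B `<=` B', forall n, measurable (Z n @^-1` B') &
  exists (C : R) (n0 : nat), forall n, (n0 <= n)%N -> (P (Z n @^-1` B') <= (C * expR (- (v n * a)))%:E)%E].
have [B' [FB' mB' [C' [n0' ub']]]] : Q (F `&` cube).
  apply: compact_ideal.
  - by rewrite setIC; apply: compact_closedI => //; exact: mcube_compact.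
  - exists set0; split => //; first by move=> n; rewrite preimage_set0.
    by exists 0, 0%N => n _; rewrite preimage_set0 measure0 mul0r.
  - move=> A B [A' [AA' mA' [CA [nA hA]]]] [B' [BB' mB' [CB [nB hB]]]].
    exists (A' `|` B'); split.
    + by move=> z [/AA'|/BB']; [left|right].
    + by move=> n; rewrite preimage_setU; exact: measurableU.
    + exists (CA + CB), (maxn nA nB) => n; rewrite geq_max => /andP[nAn nBn].
      rewrite preimage_setU mulrDl EFinD.
      by rewrite (le_trans (measureU2 _ _ _))// leeD ?hA ?hB.
  - by move=> A B AB [B' [BB' mB' h]]; exists B'; split => //; exact: subset_trans AB BB'.
  - move=> z [Fz _]; have [rho [Cz [nz [r0 h]]]] := ZU (Fa z Fz).
    exists (mbox z rho); first exact: nbhs_mbox.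
    exists (mbox z rho); split => //; first by move=> n; exact: mxmeas_mbox.
    by exists Cz, nz.
exists (C' + C), (maxn n0 n0') => n; rewrite geq_max => /andP[n0n n0'n].
apply: (@le_trans _ _ (P (Z n @^-1` B' `|` Z n @^-1` moutside r))).
  apply: le_measure; rewrite ?inE.
  - exact: (mxmeas_closed (mZ n) cF).
  - exact: measurableU.
  - move=> w Fw; have [h|h] := pselect (cube (Z n w)); first by left; apply: FB'.
    right; apply: contrapT => hn; apply: h => i j; rewrite leNgt; apply/negP => hr.
    by apply: hn; exists i, j.
rewrite mulrDl EFinD; rewrite (le_trans (measureU2 _ _ _))//.
by rewrite leeD ?ub ?ub'.
Qed.


Lemma limn_esup_le (u : nat -> \bar R) (x : R) :
  (forall e, 0 < e -> exists n0, forall n, (n0 <= n)%N -> (u n <= (x + e)%:E)%E) ->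
  (limn_esup u <= x%:E)%E.
Proof.
move=> h; apply/lee_addgt0Pr => e e0; have [n0 hn] := h e e0.
rewrite -EFinD; apply: (@le_trans _ _ (ereal_sup (u @` [set n | (n0 <= n)%N]))).
  by apply: ereal_inf_lbound; exists [set n | (n0 <= n)%N] => //; exists n0.
by apply: ge_ereal_sup => _ [n n0n <-]; exact: hn.
Qed.

Lemma limn_einf_ge (u : nat -> \bar R) (x : R) (n0 : nat) :
  (forall n, (n0 <= n)%N -> (x%:E <= u n)%E) -> (x%:E <= limn_einf u)%E.
Proof.
move=> h; rewrite /limn_einf leeNr -EFinN; apply: limn_esup_le => e e0.
exists n0 => n /h hn; rewrite leeNl -EFinN; apply: le_trans hn.
by rewrite lee_fin opprD opprK gerBl ltW.
Qed.

Lemma elog_scaled_ub (x : \bar R) (C a e w : R) : 0 < w -> 0 < e -> (x <= (C * expR (- (w * a)))%:E)%E ->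
  ln C / e <= w -> (0 <= x)%E -> ((w^-1)%:E * elog x <= (- a + e)%:E)%E.
Proof.
move=> w0 e0; case: x => // x; rewrite !lee_fin => xC Cw x0 /=.
case: ifPn => [_|]; first by rewrite gt0_muleNy ?lte_fin ?invr_gt0// leNye.
rewrite -ltNge => xp.
have C0 : 0 < C by rewrite -(@pmulr_lgt0 _ (expR (- (w * a)))) ?expR_gt0// (lt_le_trans xp).
have : ln x <= ln C - w * a.
  by rewrite -[X in _ <= _ + X]expRK -lnM ?posrE ?expR_gt0// ler_ln ?posrE// mulr_gt0 ?expR_gt0.
rewrite -EFinM lee_fin ler_pdivrMl// => h; apply: le_trans h _.
by move: Cw; rewrite ler_pdivrMr//; lra.
Qed.

Lemma elog_scaled_lb (x : \bar R) (a w : R) : 0 < w -> ((expR (- (w * a)))%:E <= x)%E ->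
  ((- a)%:E <= (w^-1)%:E * elog x)%E.
Proof.
move=> w0; case: x => // [x|_] /=; last by rewrite gt0_muley ?lte_fin ?invr_gt0// leey.
rewrite lee_fin => xC; have xp : 0 < x by rewrite (lt_le_trans _ xC) ?expR_gt0.
rewrite (_ : (x <= 0) = false); last by apply/negbTE; rewrite -ltNge.
rewrite -EFinM lee_fin ler_pdivlMl// mulrN -[leLHS]expRK ler_ln ?posrE ?expR_gt0//.
Qed.

Let ereal_real_between (x y : \bar R) : (x < y)%E -> exists a : R, (x < a%:E)%E /\ (a%:E < y)%E.
Proof.
case: x y => [r| |] [s| |]//=.
- by rewrite lte_fin => rs; exists ((r + s) / 2); rewrite !lte_fin; split; lra.
- by move=> _; exists (r + 1); rewrite lte_fin ltrDl ltr01 ltry.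
- by move=> _; exists (s - 1); rewrite ltNyr lte_fin gtrDl oppr_lt0 ltr01.
- by move=> _; exists 0; rewrite ltNyr ltry.
Qed.

Lemma local_LDP : LDP P v Z I /\ good_rate_function I.
Proof.
have rI : rate_function I by split => //; exact: local_lsc.
split; last by split => //; exact: local_sublevel_compact.
split => //; split => [F cF|O oO].
  rewrite leNgt; apply/negP; rewrite lteNl => /ereal_real_between[a [ya aF]].
  move: ya; apply/negP; rewrite -leNgt leeNr -EFinN.
  have [C [n0 h]] : exists (C : R) (n0 : nat), forall n, (n0 <= n)%N -> (P (Z n @^-1` F) <= (C * expR (- (v n * a)))%:E)%E.
    apply: local_upper_closed => // z Fz; apply: lt_le_trans aF _.
    by apply: ereal_inf_lbound; exists z.
  apply: limn_esup_le => e e0; have [n1 h1] := v_large (ln C / e).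
  exists (maxn n0 n1) => n; rewrite geq_max => /andP[n0n n1n].
  by apply: (@elog_scaled_ub _ C) => //; [exact: h|exact: h1].
rewrite leNgt; apply/negP; rewrite lteNr => /ereal_real_between[a [Oa ay]].
move: ay; apply/negP; rewrite -leNgt leeNl -EFinN.
have [_ [z Oz <-] Iza] := ereal_inf_lt Oa.
have /nbhs_mboxP[rho r0 rO] : nbhs z O by apply: open_nbhs_nbhs.
have [n0 h] := ZL Iza r0.
apply: (@limn_einf_ge _ _ n0) => n n0n; apply: elog_scaled_lb => //.
apply: le_trans (h n n0n) _; apply: le_measure; rewrite ?inE.
- exact: mxmeas_mbox.
- exact: (mxmeas_open (mZ n) oO).
- by move=> w /rO.
Qed.

End LocalLDP.

(** * One step of the recursion over the layers *)

Section ErealFacts.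
Context {R : realType}.

Lemma cvg_ereal_gt (u : nat -> R) (g : \bar R) (x : R) :
  (u n)%:E @[n --> \oo] --> g -> (x%:E < g)%E -> exists n0, forall n, (n0 <= n)%N -> x < u n.
Proof.
case: g => [g| |] //.
  move=> /fine_cvgP[_ ug]; rewrite lte_fin => xg.
  have e0 : 0 < g - x by rewrite subr_gt0.
  have /cvgrPdist_lt/(_ _ e0) [N _ hN] := ug.
  exists N => n Nn; have := hN n Nn; rewrite /= ltr_norml => /andP[_]; lra.
move=> /cvgeyPgt/(_ x) [N _ hN] _.
by exists N => n Nn; have := hN n Nn; rewrite /= lte_fin.
Qed.

Lemma cvg_ereal_lt (u : nat -> R) (g x : R) :
  (u n)%:E @[n --> \oo] --> g%:E -> g < x -> exists n0, forall n, (n0 <= n)%N -> u n < x.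
Proof.
move=> /fine_cvgP[_ ug] xg.
have e0 : 0 < x - g by rewrite subr_gt0.
have /cvgrPdist_lt/(_ _ e0) [N _ hN] := ug.
exists N => n Nn; have := hN n Nn; rewrite /= ltr_norml => /andP[+ _]; lra.
Qed.

Lemma ereal_split_lt (x y : \bar R) (a : R) : (0 <= x)%E -> (0 <= y)%E -> (a%:E < x + y)%E ->
  exists a1 a2, [/\ (a1%:E < x)%E, (a2%:E < y)%E & a1 + a2 = a].
Proof.
case: x y => [x| |] [y| |] //=.
- rewrite -EFinD !lee_fin lte_fin => x0 y0 axy.
  by exists (x - (x + y - a) / 2), (y - (x + y - a) / 2); rewrite !lte_fin; split; lra.
- by move=> _ _ _; exists (x - 1), (a - x + 1); rewrite lte_fin ltry; split => //; lra.
- by move=> _ _ _; exists (a - y + 1), (y - 1); rewrite lte_fin ltry; split => //; lra.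
- by move=> _ _ _; exists a, 0; rewrite !ltry addr0.
Qed.

Lemma ereal_split_gt (x y : \bar R) (a : R) : (0 <= x)%E -> (0 <= y)%E -> (x + y < a%:E)%E ->
  exists a1 a2, [/\ (x < a1%:E)%E, (y < a2%:E)%E & a1 + a2 < a].
Proof.
case: x y => [x| |] [y| |] //=.
rewrite -EFinD !lee_fin lte_fin => x0 y0 axy.
by exists (x + (a - x - y) / 3), (y + (a - x - y) / 3); rewrite !lte_fin; split; lra.
Qed.

End ErealFacts.

Section Step.
Context {R : realType} d (Omega : measurableType d) (P : probability Omega R).
Variables (v N : nat -> R) (gam : \bar R).
Hypotheses (v0 : forall n, 0 < v n) (voo : v n @[n --> \oo] --> +oo)
  (N0 : forall n, 0 < N n) (Noo : N n @[n --> \oo] --> +oo)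
  (gam1 : (1 <= gam)%E) (Nv : (N n / v n)%:E @[n --> \oo] --> gam).
Context {k m p : nat} (K : 'M[R]_(m, p) -> 'M[R]_k -> R) (D : set 'M[R]_k).
Hypothesis Kcont : forall eta q (e : R), D q -> 0 < e -> exists2 rho, 0 < rho &
  forall q', D q' -> mbox q rho q' -> `|K eta q' - K eta q| < e.
Hypothesis K0 : forall q, D q -> K 0 q = 0.
Hypothesis SD : forall q, D q -> semiconcave K q.
Variables (G : nat -> Omega -> 'M[R]_k) (S : nat -> Omega -> 'M[R]_(m, p)).
Hypothesis GS : forall n, cond_cgf K D P (G n) (S n) (N n).

Definition legendre (y : 'M[R]_(m, p)) (q : 'M[R]_k) : \bar R :=
  ereal_sup (range (fun eta => (mxdot eta y - K eta q)%:E)).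

Lemma legendre_gt y q (c : R) : (c%:E < legendre y q)%E -> exists eta, c < mxdot eta y - K eta q.
Proof. by move=> /ereal_sup_gt[_ [eta _ <-]]; rewrite lte_fin; exists eta. Qed.

Lemma legendre_le y q (c : R) : (legendre y q <= c%:E)%E -> forall eta, mxdot eta y - K eta q <= c.
Proof.
move=> h eta; rewrite -lee_fin; apply: le_trans h.
by apply: ereal_sup_ubound; exists eta.
Qed.

Lemma legendre_ge0 y q : D q -> (0 <= legendre y q)%E.
Proof.
by move=> Dq; apply: ereal_sup_ubound; exists 0 => //; rewrite mxdot0l K0// subrr.
Qed.

Let Nlarge (c : R) : exists n0, forall n, (n0 <= n)%N -> c <= N n.
Proof. exact: v_large Noo c. Qed.

(** [local_upper] gives decay [N n * c] for [c] below the Legendre transform. If moreover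
    [a / c < gam], then [v n * a <= N n * c] eventually; the quotient form serves finite and
    infinite [gam] alike. *)
Lemma step_local_ub y q (a : R) : D q -> (a%:E < gam * legendre y q)%E ->
  exists rho0 n0, 0 < rho0 /\ forall rho n, rho <= rho0 -> (n0 <= n)%N ->
    (P (G n @^-1` mbox q rho `&` S n @^-1` mbox y rho) <=
      (expR (- (v n * a)))%:E * P (G n @^-1` mbox q rho))%E.
Proof.
move=> Dq ag.
have [a0|a0] := ltP a 0.
  exists 1, 0%N; split => // rho n _ _; have [_ mG mS _ _] := GS n.
  apply: (@le_trans _ _ (P (G n @^-1` mbox q rho))).
    apply: le_measure; rewrite ?inE; last exact: subIsetl.
      by apply: measurableI; exact: mxmeas_mbox.
    exact: mxmeas_mbox.
  rewrite -[leLHS]mul1e lee_wpmul2r// lee_fin -[leLHS]expR0 ler_expR.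
  by rewrite -mulrN mulr_ge0 ?(ltW (v0 n))// oppr_ge0 ltW.
have [c [c0 cleg acg]] : exists c : R, [/\ 0 < c, (c%:E < legendre y q)%E & ((a / c)%:E < gam)%E].
  have := legendre_ge0 y Dq; move: ag gam1; case: (legendre y q) => [l| |] //; case: gam => [g| |] //.
  - rewrite -EFinM lte_fin !lee_fin => agl g1 l0.
    have g0 : 0 < g by rewrite (lt_le_trans _ g1).
    have alg : a / g < l by rewrite ltr_pdivrMr// mulrC.
    have ag0 : 0 <= a / g by rewrite divr_ge0// ltW.
    have c0 : 0 < (a / g + l) / 2 by lra.
    exists ((a / g + l) / 2); split; rewrite ?lte_fin//; first by lra.
    by rewrite ltr_pdivrMr// mulrC -ltr_pdivrMr//; lra.
  - rewrite lee_fin => + _ l0; have [->|lN0] := eqVneq l 0.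
      by rewrite mule0 lte_fin ltNge a0.
    move=> _; have lp : 0 < l by rewrite lt_neqAle eq_sym lN0.
    by exists (l / 2); rewrite ltry lte_fin; split => //; lra.
  - rewrite lee_fin => _ g1 _; have g0 : 0 < g by rewrite (lt_le_trans _ g1).
    have a1 : 0 < a + 1 by rewrite ltr_wpDl.
    exists (a + 1); rewrite ltry lte_fin; split => //.
    by rewrite ltr_pdivrMr//; nra.
  - by move=> _ _ _; exists 1; rewrite !ltry.
have [eta ceta] := legendre_gt cleg.
have [rho0 [r0 hub]] := local_upper Kcont Dq ceta.
have [n0 hn0] := cvg_ereal_gt Nv acg.
exists rho0, n0; split => // rho n rr n0n.
apply: le_trans (hub rho rr _ _ P (G n) (S n) (N n) (ltW (N0 n)) (GS n)) _.
rewrite lee_wpmul2r// lee_fin ler_expR lerN2.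
have := hn0 n n0n; rewrite ltr_pdivrMr// mulrAC ltr_pdivlMr// => h.
by rewrite mulrC ltW.
Qed.

(** For infinite [gam] the product is finite only if [legendre y q = 0], and then the free tilt
    [eta = 0] works. For finite [gam] an exposing tilt of cost below [a / gam] is used. *)
Lemma step_local_lb y q (a rho : R) : D q -> (gam * legendre y q < a%:E)%E -> 0 < rho ->
  exists rho0 n0, 0 < rho0 /\ forall n, (n0 <= n)%N ->
    ((2^-1 * expR (- (v n * a)))%:E * P (G n @^-1` mbox q rho0) <=
      P (G n @^-1` mbox q rho0 `&` S n @^-1` mbox y rho))%E.
Proof.
move=> Dq ga rho_gt0; have l0 := legendre_ge0 y Dq.
have PS n r1 r2 : (r1 `<=` r2) -> measurable (S n @^-1` r1) -> measurable (S n @^-1` r2) ->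
    forall q r, (P (G n @^-1` mbox q r `&` S n @^-1` r1) <= P (G n @^-1` mbox q r `&` S n @^-1` r2))%E.
  move=> r12 m1 m2 q' r; have [_ mG _ _ _] := GS n.
  apply: le_measure; rewrite ?inE.
  - by apply: measurableI => //; exact: mxmeas_mbox.
  - by apply: measurableI => //; exact: mxmeas_mbox.
  - by apply: setIS => w; exact: r12.
have [[g gE]|[gE lE]] : (exists g : R, gam = g%:E) \/ (gam = +oo%E /\ legendre y q = 0%E).
  move: gam1 ga l0; case: gam => [g| |] //; first by left; exists g.
  move=> _ ga l0; right; split => //; apply/eqP; rewrite eq_le l0 andbT leNgt.
  by apply/negP => lp; move: ga; rewrite gt0_mulye.
- have g1 : 1 <= g by move: gam1; rewrite gE lee_fin.
  have g0 : 0 < g by rewrite (lt_le_trans _ g1).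
  have [c1 lE] : exists c1 : R, legendre y q = c1%:E.
    move: ga l0; rewrite gE; case: (legendre y q) => [c1| |] //; first by exists c1.
    by rewrite gt0_muley ?lte_fin.
  move: ga l0; rewrite gE lE -EFinM lte_fin lee_fin => gca c10.
  have cag : c1 < a / g by rewrite ltr_pdivlMr// mulrC.
  pose c := (c1 + a / g) / 2.
  (* Of the cost [c] allowed per neuron, [c'] pays for the tilt and [c - c'] for the variation of
     [K eta] over the box. *)
  pose c' := (c1 + c) / 2.
  have cc : c1 < c' by rewrite /c' /c; lra.
  have c'c : 0 < c - c' by rewrite /c' /c; lra.
  have cp : 0 < c by lra.
  have gac : g < a / c.
    by rewrite ltr_pdivlMr// mulrC -ltr_pdivlMr// /c; lra.
  have lc1 : (legendre y q <= c1%:E)%E by rewrite lE.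
  have [eta [y' [e [e0 ye expo cost]]]] := exposing_exists (K0 Dq) (SD Dq) (legendre_le lc1) cc rho_gt0.
  have [r1 [M0 [r10 hlb]]] := local_lower Kcont Dq e0 expo.
  have [r2 r20 hk] := Kcont eta Dq c'c.
  have [n1 hn1] := Nlarge M0.
  have Nvg : (N n / v n)%:E @[n --> \oo] --> g%:E by rewrite -gE.
  have [n2 hn2] := cvg_ereal_lt Nvg gac.
  exists (Num.min r1 r2), (maxn n1 n2); split; first by rewrite lt_min r10.
  move=> n; rewrite geq_max => /andP[n1n n2n].
  have [_ mG mS _ _] := GS n.
  apply: le_trans (PS n (mbox y' e) (mbox y rho) ye _ _ q (Num.min r1 r2)); try exact: mxmeas_mbox.
  apply: le_trans (hlb (K eta q - (c - c')) (Num.min r1 r2) _ _ _ _ P (G n) (S n) (N n) _ _ (GS n)).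
  + rewrite lee_wpmul2r// lee_fin ler_wpM2l ?invr_ge0// ler_expR.
    have : N n * c <= v n * a.
      have := hn2 n n2n; rewrite ltr_pdivlMr// mulrAC ltr_pdivrMr// => h.
      by rewrite [v n * a]mulrC ltW.
    have : N n * (mxdot eta y' + norm1 eta * e - K eta q) <= N n * c' by rewrite ler_wpM2l// ltW.
    by rewrite !mulrBr !mulrDr; lra.
  + by rewrite ge_min lexx.
  + move=> q' Dq' qq'; have := hk q' Dq' (mbox_sub _ qq'); rewrite ge_min lexx orbT => /(_ isT).
    by rewrite ltr_norml => /andP[+ _]; lra.
  + exact: ltW.
  + exact: hn1.
- have a0 : 0 < a by move: ga; rewrite lE mule0 lte_fin.
  have lc1 : (legendre y q <= 0%:E)%E by rewrite lE.
  have expo := exposing_zero (K0 Dq) (SD Dq) (legendre_le lc1) rho_gt0.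
  have [r1 [M0 [r10 hlb]]] := local_lower Kcont Dq rho_gt0 expo.
  have [n1 hn1] := Nlarge M0.
  exists r1, n1; split => // n n1n.
  apply: le_trans (hlb 0 r1 _ _ _ _ P (G n) (S n) (N n) _ _ (GS n)).
  + rewrite lee_wpmul2r// lee_fin ler_wpM2l ?invr_ge0// ler_expR.
    by rewrite mxdot0l norm1_0 mul0r addr0 subr0 mulr0 oppr_le0 mulr_ge0// ltW.
  + exact: lexx.
  + by move=> q' Dq' _; rewrite K0.
  + exact: ltW.
  + exact: hn1.
Qed.

Variable I : 'M[R]_k -> \bar R.
Hypothesis I0 : forall q, (0 <= I q)%E.

Let mG n : mxmeas (G n). Proof. by have [] := GS n. Qed.
Let mS n : mxmeas (S n). Proof. by have [] := GS n. Qed.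

(** At each [q] the rate splits as [a1 + a2], with [a1] for reaching a box about [q] and [a2] for
    the transition from it. Finitely many boxes cover [Dc], and a common radius about [y] is their
    minimum. *)
Lemma step_ub (Dc : set 'M[R]_k) y (a : R) : compact Dc -> Dc `<=` D ->
  (forall n w, Dc (G n w)) ->
  (forall q b, Dc q -> (b%:E < I q)%E -> loc_ub P v G q b) ->
  (forall q, Dc q -> (a%:E < I q + gam * legendre y q)%E) ->
  loc_ub P v S y a.
Proof.
move=> cDc DcD GDc GU aI.
pose Q (B : set 'M[R]_k) := exists B' (rho C : R) (n0 : nat),
  [/\ B `<=` B', forall n, measurable (G n @^-1` B'), 0 < rho &
   forall n, (n0 <= n)%N -> (P (G n @^-1` B' `&` S n @^-1` mbox y rho) <= (C * expR (- (v n * a)))%:E)%E].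
have mSb n r : measurable (S n @^-1` mbox y r) by exact: mxmeas_mbox.
have mono n (B : set Omega) r1 r2 : measurable B -> r1 <= r2 ->
    (P (B `&` S n @^-1` mbox y r1) <= P (B `&` S n @^-1` mbox y r2))%E.
  move=> mB r12; apply: le_measure; rewrite ?inE; try exact: measurableI.
  by apply: setIS => w; exact: mbox_sub.
have [B' [rho [C [n0 [DB mB r0 h]]]]] : Q Dc.
  apply: compact_ideal => //.
  - exists set0, 1, 0, 0%N; split => //; first by move=> n; rewrite preimage_set0.
    by move=> n _; rewrite preimage_set0 set0I measure0 mul0r.
  - move=> A B [A' [rA [CA [nA [AA mA rA0 hA]]]]] [B' [rB [CB [nB [BB mB rB0 hB]]]]].
    exists (A' `|` B'), (Num.min rA rB), (CA + CB), (maxn nA nB); split.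
    + by move=> z [/AA|/BB]; [left|right].
    + by move=> n; rewrite preimage_setU; exact: measurableU.
    + by rewrite lt_min rA0.
    + move=> n; rewrite geq_max => /andP[nAn nBn].
      rewrite preimage_setU setIUl mulrDl EFinD.
      rewrite (le_trans (measureU2 _ _ _))//; try exact: measurableI.
      apply: leeD.
        by apply: le_trans (hA n nAn); apply: mono => //; rewrite ge_min lexx.
      by apply: le_trans (hB n nBn); apply: mono => //; rewrite ge_min lexx orbT.
  - move=> A B AB [B' [r [C [n0 [BB mB r0 h]]]]]; exists B', r, C, n0; split => //.
    exact: subset_trans AB BB.
  - move=> q Dq; have Dq' := DcD q Dq.
    have gl0 : (0 <= gam * legendre y q)%E.
      by rewrite mule_ge0 ?legendre_ge0// (le_trans _ gam1).
    have [a1 [a2 [a1I a2g aE]]] := ereal_split_lt (I0 q) gl0 (aI q Dq).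
    have [r1 [C [n1 [r10 h1]]]] := GU q a1 Dq a1I.
    have [r2 [n2 [r20 h2]]] := step_local_ub Dq' a2g.
    exists (mbox q (Num.min r1 r2)); first by apply: nbhs_mbox; rewrite lt_min r10.
    exists (mbox q (Num.min r1 r2)), (Num.min r1 r2), C, (maxn n1 n2); split => //.
    + by move=> n; exact: mxmeas_mbox.
    + by rewrite lt_min r10.
    + move=> n; rewrite geq_max => /andP[n1n n2n].
      apply: le_trans (h2 _ n _ n2n) _; first by rewrite ge_min lexx orbT.
      have -> : C * expR (- (v n * a)) = expR (- (v n * a2)) * (C * expR (- (v n * a1))).
        by rewrite mulrCA -expRD -aE; congr (_ * expR _); ring.
      rewrite EFinM lee_wpmul2l ?lee_fin ?expR_ge0//.
      apply: le_trans (h1 n n1n); apply: le_measure; rewrite ?inE; try exact: mxmeas_mbox.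
      by move=> w; apply: mbox_sub; rewrite ge_min lexx.
exists rho, C, n0; split => // n n0n; apply: le_trans (h n n0n).
apply: le_measure; rewrite ?inE//; first exact: measurableI.
by move=> w Sw; split => //; exact/DB/GDc.
Qed.

Lemma step_lb y (a : R) :
  (forall q b, D q -> (I q < b%:E)%E -> loc_lb P v G q b) ->
  (exists q, D q /\ (I q + gam * legendre y q < a%:E)%E) ->
  loc_lb P v S y a.
Proof.
move=> GL [q [Dq Ia]] rho r0.
have gl0 : (0 <= gam * legendre y q)%E.
  by rewrite mule_ge0 ?legendre_ge0// (le_trans _ gam1).
have [a1 [a2 [a1I a2g aE]]] := ereal_split_gt (I0 q) gl0 Ia.
have [r1 [n1 [r10 h1]]] := step_local_lb Dq a2g r0.
have [n2 h2] := GL q a1 Dq a1I r1 r10.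
have ap : 0 < a - (a1 + a2) by rewrite subr_gt0.
(* The spare rate [a - (a1 + a2)] eventually outweighs the factor one half from the tilting. *)
have [n3 h3] := v_large voo ((a - (a1 + a2))^-1).
exists (maxn n1 (maxn n2 n3)) => n; rewrite !geq_max => /and3P[n1n n2n n3n].
apply: (@le_trans _ _ (P (G n @^-1` mbox q r1 `&` S n @^-1` mbox y rho))); last first.
  apply: le_measure; rewrite ?inE; last exact: subIsetr.
    by apply: measurableI; exact: mxmeas_mbox.
  exact: mxmeas_mbox.
apply: le_trans (h1 n n1n).
apply: (@le_trans _ _ ((2^-1 * expR (- (v n * a2)))%:E * (expR (- (v n * a1)))%:E)%E); last first.
  by rewrite lee_wpmul2l ?h2// lee_fin mulr_ge0 ?invr_ge0 ?expR_ge0.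
rewrite -EFinM lee_fin -mulrA -expRD ler_pdivlMl//.
have -> : expR (- (v n * a)) = expR (- (v n * (a - (a1 + a2)))) * expR (- (v n * a2) + - (v n * a1)).
  by rewrite -expRD; congr expR; ring.
rewrite mulrA -[leRHS]mul1r ler_pM2r ?expR_gt0// expRN ler_pdivrMr ?expR_gt0// mul1r.
have := h3 n n3n; rewrite -[_^-1]mul1r ler_pdivrMr// => h.
by have := expR_ge1Dx (v n * (a - (a1 + a2))); lra.
Qed.

End Step.

(** * The Gaussian quadratic form of the output layer and its Legendre transform *)

Section QuadraticForm.
Context {R : realType} {k h : nat}.

Lemma mxdot_trace m n (e y : 'M[R]_(m, n)) : mxdot e y = \tr (e^T *m y).
Proof.
rewrite /mxtrace /mxdot exchange_big; apply: eq_bigr => b _.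
by rewrite mxE; apply: eq_bigr => a _; rewrite mxE.
Qed.

Lemma mxdot_mulmxr m n p (A : 'M[R]_(m, n)) (B : 'M[R]_(n, p)) (C : 'M[R]_(m, p)) :
  mxdot C (A *m B) = mxdot (A^T *m C) B.
Proof. by rewrite !mxdot_trace trmx_mul trmxK mulmxA. Qed.

(** The logarithmic moment generating function of [h] independent centered Gaussian vectors with
    covariance [g]. *)
Definition quadK (theta : 'M[R]_(k, h)) (g : 'M[R]_k) : R := 2^-1 * mxdot theta (g *m theta).

Lemma quadK_dot theta g : quadK theta g = mxdot (2^-1 *: (theta *m theta^T)) g.
Proof.
rewrite mxdotZl; congr (_ * _); rewrite !mxdot_trace trmx_mul trmxK.
by rewrite mulmxA mxtrace_mulC mulmxA.
Qed.

Lemma quadK0 g : quadK 0 g = 0.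
Proof. by rewrite /quadK mxdot0l mulr0. Qed.

Lemma quadK_cont (D : set 'M[R]_k) theta g (e : R) : D g -> 0 < e -> exists2 rho, 0 < rho &
  forall g', D g' -> mbox g rho g' -> `|quadK theta g' - quadK theta g| < e.
Proof.
move=> _ e0; pose T := 2^-1 *: (theta *m theta^T).
have T0 : 0 < norm1 T + 1 by rewrite ltr_wpDl// norm1_ge0.
exists (e / (norm1 T + 1)); first by rewrite divr_gt0.
move=> g' _ gg'; rewrite !quadK_dot (le_lt_trans (mxdot_mbox _ gg'))//.
by rewrite mulrA ltr_pdivrMr// mulrC ltr_pM2l// ltrDl.
Qed.

Lemma quadK_semiconcave g : semiconcave quadK g.
Proof.
move=> xi; exists `|2 * quadK xi g|, 1; split=> // eta t _ _.
have -> : quadK (eta + t *: xi) g + quadK (eta - t *: xi) g = 2 * quadK eta g + 2 * quadK xi g * t ^+ 2.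
  rewrite /quadK mulmxDr mulmxBr !mxdotDl !mxdotDr !mxdotNl !mxdotNr.
  by rewrite -scalemxAr !mxdotZl !mxdotZr; field.
by rewrite lerD2l ler_wpM2r ?sqr_ge0// ler_norm.
Qed.

(** For symmetric [g] the row space meets the kernel trivially: [u = w g] and [u g = 0] give
    [u u^T = 0]. Counting dimensions, they span everything. *)
Lemma sym_range_kernel (g : 'M[R]_k) (z : 'M[R]_(k, h)) : g^T = g ->
  exists theta z', z = g *m theta + z' /\ g *m z' = 0.
Proof.
move=> gT.
have cap0 : (g :&: kermx g = 0)%MS.
  apply/eqP/rowV0P => u; rewrite sub_capmx => /andP[/submxP[w uE] /sub_kermxP ug].
  suff : u *m u^T = 0.
    by move=> uu; apply: row_quad_eq0; rewrite uu mxE.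
  by rewrite {2}uE trmx_mul gT mulmxA ug mul0mx.
have full : row_full (g + kermx g)%MS.
  have := mxrank_sum_cap g (kermx g); rewrite cap0 mxrank0 addn0 mxrank_ker.
  by rewrite subnKC ?rank_leq_row// => r; apply/eqP.
have /sub_addsmxP[[u1 u2] /= zE] : (z^T <= g + kermx g)%MS by exact: submx_full.
exists u1^T.
exists ((kermx g)^T *m u2^T); split.
  by rewrite -[LHS]trmxK zE linearD/= !trmx_mul gT.
by rewrite mulmxA -{1}gT -trmx_mul mulmx_ker trmx0 mul0mx.
Qed.

(** A kernel component of [z] would let the supremum grow linearly at no quadratic cost, so a finite
    value forces [z = g theta], and [r = msqrt g *m theta] attains it. The converse is the square
    [|r - msqrt g *m theta|^2 >= 0]. *)
Lemma legendre_quadK (g : 'M[R]_k) (z : 'M[R]_(k, h)) (c : R) : psd g ->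
  (legendre quadK z g <= c%:E)%E <-> exists r, msqrt g *m r = z /\ sqnorm r / 2 <= c.
Proof.
move=> pg; have [[sT _] sE] := msqrtP pg; set s := msqrt g in sT sE *.
have gT : g^T = g by case: pg.
have quadE theta : mxdot theta (g *m theta) = sqnorm (s *m theta).
  by rewrite -sE -mulmxA mxdot_mulmxr sT mxdot_sqr.
split=> [lc|[r [rz rc]]].
  have le theta := legendre_le lc theta.
  have [theta [z' [zE gz']]] := sym_range_kernel z gT.
  have z'0 : z' = 0.
    have zz' : mxdot z' z = sqnorm z'.
      by rewrite zE mxdotDr mxdot_mulmxr gT gz' mxdot0l add0r mxdot_sqr.
    have h0 t : t * sqnorm z' <= c.
      have := le (t *: z'); rewrite mxdotZl zz' /quadK -scalemxAr gz' scaler0.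
      by rewrite mxdotC mxdot0l mulr0 subr0.
    have z'z' : sqnorm z' = 0.
      have := sqnorm_ge0 z'; rewrite le_eqVlt => /predU1P[//|zp].
      by have := h0 ((c + 1) / sqnorm z'); rewrite divfK ?gt_eqF//; lra.
    apply/matrixP => i j; rewrite mxE; apply/eqP; rewrite -sqrf_eq0 eq_le sqr_ge0 andbT.
    by rewrite -z'z' sqnorm_entry.
  exists (s *m theta); split; first by rewrite mulmxA sE zE z'0 addr0.
  have := le theta; rewrite /quadK {1}zE z'0 addr0 quadE; lra.
apply: ge_ereal_sup => _ [theta _ <-]; rewrite lee_fin (le_trans _ rc)//.
rewrite -rz mxdot_mulmxr sT /quadK quadE.
have := sqnorm_ge0 (r - s *m theta).
rewrite -!mxdot_sqr mxdotDl !mxdotDr !mxdotNl !mxdotNr.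
rewrite [mxdot r (s *m theta)]mxdotC; lra.
Qed.

End QuadraticForm.

(** * Exponential tightness of the output *)

Section Chernoff.
Context {R : realType} d (Omega : measurableType d) (P : probability Omega R).

Lemma measure_fin_cover (I : finType) (A : I -> set Omega) (B : set Omega) :
  measurable B -> (forall i, measurable (A i)) -> (forall w, B w -> exists i, A i w) ->
  (P B <= \sum_i P (A i))%E.
Proof.
move=> mB mA BA.
pose U (s : seq I) := [set w | exists2 i, i \in s & A i w].
have US i s : U (i :: s) = A i `|` U s.
  apply/seteqP; split => [w [j]|w].
    by rewrite inE => /predU1P[->|js]; [left|right; exists j].
  by case=> [Aw|[j js Aw]]; [exists i; rewrite ?inE ?eqxx|exists j; rewrite ?inE ?js ?orbT].
have h s : measurable (U s) /\ (P (U s) <= \sum_(i <- s) P (A i))%E.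
  elim: s => [|i s [mU IH]].
    by rewrite (_ : U [::] = set0) ?measure0 ?big_nil//; apply/seteqP; split => [w []|].
  rewrite US big_cons; split; first exact: measurableU.
  by rewrite (le_trans (measureU2 _ _ _))// leeD2l.
have [mU /(le_trans _)] := h (index_enum I); apply.
apply: le_measure; rewrite ?inE// => w /BA[i Ai].
by exists i; rewrite ?mem_index_enum.
Qed.

(** Chernoff along the signed coordinate directions: there [quadK] is half a diagonal entry of [G],
    at most [B / 2], so exceeding [a + B / 2] has rate at least [a]. *)
Lemma quadK_exp_tight (k h : nat) (D : set 'M[R]_k) (v : nat -> R) (B : R)
    (G : nat -> Omega -> 'M[R]_k) (Z : nat -> Omega -> 'M[R]_(k, h)) (a : R) :
  (forall n, 0 < v n) -> (forall n w i j, `|G n w i j| <= B) ->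
  (forall n, cond_cgf (@quadK R k h) D P (G n) (Z n) (v n)) ->
  exp_tight P v Z a.
Proof.
move=> v0 GB GZ.
pose card := (#|{: 'I_k * 'I_h * bool}|%:R : R).
exists (a + B / 2), card, 0%N => n _; have [DG mG mZ mK E] := GZ n.
pose A (i : 'I_k * 'I_h * bool) := [set w | a + B / 2 <= mxdot (sdelta i) (Z n w)].
have mD i := mxmeas_mxdot (sdelta i : 'M[R]_(k, h)) mZ.
have mA i : measurable (A i).
  have := mD i measurableT _ (measurable_itv `[a + B / 2, +oo[); rewrite setTI.
  by rewrite set_itvE.
have mO : measurable (Z n @^-1` moutside (a + B / 2)).
  rewrite (_ : _ @^-1` _ = \bigcup_(ij in [set: 'I_k * 'I_h])
      (fun w => `|Z n w ij.1 ij.2|) @^-1` [set r | a + B / 2 < r]); last first.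
    by apply/seteqP; split => [w [i [j hij]]|w [[i j] _ hij]]; [exists (i, j)|exists i, j].
  apply: fin_bigcup_measurable => // -[i j] _ /=.
  have mN : measurable_fun setT (fun w => `|Z n w i j|) by exact: measurableT_comp.
  have := mN measurableT _ (measurable_itv `]a + B / 2, +oo[).
  by rewrite setTI set_itvE.
apply: (@le_trans _ _ (\sum_i P (A i))%E).
  apply: measure_fin_cover => // w [i [j hij]].
  have [|s hs] := @sdelta_out _ _ _ 0 (Z n w) (a + B / 2).
    by move=> /(_ i j); rewrite mxE subr0 ltNge ltW.
  by exists s; move: hs; rewrite mxdotC mxdot0l add0r.
have -> : card * expR (- (v n * a)) = \sum_(i : 'I_k * 'I_h * bool) expR (- (v n * a)).
  by rewrite sumr_const /card mulr_natl.
rewrite -sumEFin; apply: lee_sum => i _.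
have GT : G n @^-1` mbox 0 (B + 1) = setT.
  by apply/seteqP; split => // w _ i' j'; rewrite mxE subr0 (le_lt_trans (GB _ _ _ _))// ltrDl.
have := E 0 (B + 1) (sdelta i); rewrite GT => {}E.
rewrite -(@lee_pmul2l _ (expR (v n * (a + B / 2)))%:E) ?lte_fin ?expR_gt0// -EFinM -expRD.
rewrite -[X in P X](setTI (A i)).
apply: (@le_trans _ _ (\int[P]_(w in setT) (expR (v n * mxdot (sdelta i) (Z n w)))%:E)%E).
  apply: integral_expR_markov => //; first by apply: measurable_funM => //; exact: mD.
  by move=> w Aw; rewrite ler_wpM2l// ltW.
rewrite E; apply: (@le_trans _ _ ((expR (v n * (B / 2)))%:E * P setT)%E).
  apply: integral_expR_ub => //; first exact: measurable_funM.
  move=> w _; rewrite ler_wpM2l ?(ltW (v0 n))// /quadK [leRHS]mulrC ler_wpM2l//.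
  case: i {mD mA A E} => [[i j] b]; rewrite /sdelta/= mxdotZl -scalemxAr mxdotZr mulrA -expr2.
  rewrite sqrr_sign mul1r mxdot_delta.
  rewrite mxE (bigD1 i)//= mxE !eqxx mulr1 big1 ?addr0 => [|i' ii']; last by rewrite mxE (negbTE ii') mulr0.
  exact: le_trans (ler_norm _) (GB _ _ _ _).
rewrite probability_setT mule1 lee_fin ler_expR. lra.
Qed.

End Chernoff.

(** * The Gaussian network *)

Section GaussianFunctionals.
Context {R : realType}.

Definition ymeasr (I : Type) (f : (I -> R) -> R) : Prop :=
  forall d (T : measurableType d) (X : T -> I -> R),
    (forall i, measurable_fun [set: T] (X^~ i)) ->
    measurable_fun [set: T] (fun t => f (X t)).

Lemma ymeasrP (I : Type) (f : (I -> R) -> R) : ymeas (EFin \o f) <-> ymeasr f.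
Proof.
by split=> mf d T X mX; [apply/measurable_EFinP; exact: mf|apply/measurable_EFinP; exact: mf].
Qed.

Lemma gcolsZ (J : finType) (cs : seq (J -> R)) (phi : (J -> R) -> \bar R) (r : R) u :
  ymeas phi -> (forall u, 0 <= phi u)%E -> 0 <= r ->
  gcols cs (fun u => r%:E * phi u)%E u = (r%:E * gcols cs phi u)%E.
Proof.
move=> mphi phi0 r0; elim: cs u => [//|c cs IH] u /=.
rewrite -ge0_integralZl//.
- by apply: eq_integral => t _; exact: IH.
- exact: measurable_gcols_line.
- by move=> t _; exact: gcols_ge0.
Qed.

Lemma gcols_expR (J : finType) (cs : seq (J -> R)) (c u : J -> R) :
  gcols cs (fun u => (expR (\sum_a c a * u a))%:E) u =
  (expR (\sum_a c a * u a + 2^-1 * \sum_a \sum_b c a * gram cs a b * c b))%:E.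
Proof.
have gramE cs' : \sum_a \sum_b c a * gram cs' a b * c b = \sum_(f <- cs') (\sum_a c a * f a) ^+ 2.
  rewrite [RHS](eq_bigr (fun f => \sum_a \sum_b (c a * f a) * (c b * f b))); last first.
    by move=> f _; rewrite expr2 mulr_suml; apply: eq_bigr => a _; rewrite mulr_sumr.
  rewrite [RHS]exchange_big; apply: eq_bigr => a _; rewrite [RHS]exchange_big; apply: eq_bigr => b _.
  rewrite /gram mulr_sumr mulr_suml; apply: eq_bigr => f _ /=; ring.
rewrite gramE; elim: cs u => [|f cs IH] u; first by rewrite /= big_nil mulr0 addr0.
rewrite /= big_cons; set s := \sum_a c a * f a; set q := \sum_(f <- cs) _.
have -> : (fun t => gcols cs (fun u => (expR (\sum_a c a * u a))%:E) (fun j => u j + t * f j)) =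
    (fun t => (expR (\sum_a c a * u a + 2^-1 * q))%:E * (expR (s * t))%:E)%E.
  apply/funext => t; rewrite IH -EFinM -expRD; congr (expR _)%:E.
  rewrite addrAC; congr (_ + _); rewrite /s mulr_suml -big_split; apply: eq_bigr => a _ /=; ring.
rewrite ge0_integralZl//; last first.
  by apply/measurable_EFinP; apply: measurableT_comp => //; exact: mulrl_measurable.
rewrite integral_normal_expR -EFinM -expRD; by congr (expR _)%:E; field.
Qed.

Lemma gexp_linear (k : nat) (g : 'M[R]_k) (c : 'I_k -> R) : psd g ->
  gexp (fun N => (expR (\sum_a c a * qN g N a))%:E) =
  (expR (2^-1 * \sum_a \sum_b c a * g a b * c b))%:E.
Proof.
move=> pg; rewrite (gexp_qN_gcols g (fun u => (expR (\sum_a c a * u a))%:E)) gcols_expR.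
congr (expR _)%:E; rewrite big1 ?add0r => [|a _]; last by rewrite mulr0.
congr (_ * _); apply: eq_bigr => a _; apply: eq_bigr => b _.
by rewrite gram_msqrt.
Qed.

Section IteratedIntegration.
Variable (I : choiceType) (c : I -> R).

Definition gints (s : seq I) (f : (I -> R) -> \bar R) : (I -> R) -> \bar R := foldr (gint c) f s.

Lemma gints_ge0 s f : (forall v, 0 <= f v)%E -> forall v, (0 <= gints s f v)%E.
Proof. by move=> f0; elim: s => [//|i s IH] v; exact: gint_ge0. Qed.

Lemma ymeas_gints s f : ymeas f -> (forall v, 0 <= f v)%E -> ymeas (gints s f).
Proof.
move=> mf f0; elim: s => [//|i s IH]; apply: ymeas_gint IH _.
exact: gints_ge0.
Qed.

(** When [f] sees the coordinates in [s] only through an affine map, integrating them out yields a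
    Gaussian vector with columns [c i * col i]. *)
Lemma gints_gcols (J : finType) (s : seq I) (col : I -> J -> R) f phi v u : uniq s ->
  (forall t : I -> R, f (fun j => if j \in s then t j else v j) =
     phi (fun a => u a + \sum_(i <- s) t i * col i a)) ->
  gints s f v = gcols [seq (fun a => c i * col i a) | i <- s] phi u.
Proof.
elim: s u v => [|i s IH] u v /=.
  move=> _ /(_ v) /= h; rewrite (_ : v = fun j => if j \in [::] then v j else v j) ?h; last exact/funext.
  by congr phi; apply/funext => a; rewrite big_nil addr0.
move=> /andP[si us] h; apply: eq_integral => t _; apply: IH => // t'.
have := h (upd t' i (c i * t)); rewrite (_ : (fun _ => _) = (fun j => if j \in s then t' j else upd v i (c i * t) j)).
  move=> ->; congr phi; apply/funext => a; rewrite big_cons {1}/upd eqxx addrA.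
  congr (_ + _); first by congr (_ + _); ring.
  rewrite big_seq [RHS]big_seq; apply: eq_bigr => j js; rewrite /upd.
  by case: eqP js => // ->; rewrite (negbTE si).
apply/funext => j; rewrite inE /upd; case: eqP => // ->.
by rewrite (negbTE si).
Qed.

End IteratedIntegration.

Lemma ge0_integral_zext_gints (I : choiceType) d (Omega : measurableType d) (P : probability Omega R)
    (D : set I) (X : I -> Omega -> R) (v : I -> R) (s : seq I) f :
  mutually_independent P D X -> (forall i, D i -> 0 <= v i) ->
  (forall i, D i -> centered_gaussian P (X i) (v i)) ->
  (forall i, i \in s -> D i) -> ymeas f -> (forall u, 0 <= f u)%E ->
  (\int[P]_w f (zext D X w) = \int[P]_w gints (Num.sqrt \o v) s f (zext D X w))%E.
Proof.
move=> ind v0 gX sD mf f0; elim: s sD => [//|i s IH] sD.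
rewrite IH /=; last by move=> j js; apply: sD; rewrite inE js orbT.
apply: (ge0_integral_zext_gint ind v0 gX).
- by apply: sD; rewrite inE eqxx.
- exact: ymeas_gints.
- exact: gints_ge0.
Qed.

End GaussianFunctionals.

Section GramMatrices.
Context {R : realType} {k : nat}.

Lemma psd_gram (I : Type) (r : seq I) (f : I -> 'I_k -> R) (c0 c1 : R) : 0 <= c0 -> 0 <= c1 ->
  psd (\matrix_(a, b) (c0 + c1 * \sum_(j <- r) f j a * f j b) : 'M[R]_k).
Proof.
move=> c00 c10; split.
  apply/matrixP => a b; rewrite !mxE; congr (_ + _ * _); apply: eq_bigr => j _.
  by rewrite mulrC.
move=> v; rewrite mxE.
have -> : \sum_j (v^T *m (\matrix_(a, b) (c0 + c1 * \sum_(j <- r) f j a * f j b))) 0 j * v j 0 =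
   c0 * (\sum_a v a 0) ^+ 2 + c1 * \sum_(j <- r) (\sum_a v a 0 * f j a) ^+ 2.
  rewrite [RHS](_ : _ = \sum_b \sum_a (v a 0 * (c0 + c1 * \sum_(j <- r) f j a * f j b)) * v b 0).
    by apply: eq_bigr => b _; rewrite mxE mulr_suml; apply: eq_bigr => a _; rewrite !mxE.
  rewrite [RHS](_ : _ = \sum_b \sum_a c0 * (v a 0 * v b 0) +
      \sum_b \sum_a c1 * \sum_(j <- r) (v a 0 * f j a) * (v b 0 * f j b)); last first.
    rewrite -big_split; apply: eq_bigr => b _; rewrite -big_split; apply: eq_bigr => a _ /=.
    rewrite mulrDr mulrDl; congr (_ + _); first by ring.
    rewrite mulrCA -mulrA; congr (_ * _); rewrite mulr_sumr mulr_suml.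
    by apply: eq_bigr => j _; ring.
  congr (_ + _).
    rewrite expr2 mulr_sumr mulr_sumr; apply: eq_bigr => b _.
    by rewrite -mulr_sumr -mulr_suml.
  under [RHS]eq_bigr => b _ do rewrite -mulr_sumr exchange_big.
  rewrite -mulr_sumr exchange_big; congr (_ * _); apply: eq_bigr => j _.
  by rewrite expr2 mulr_sumr; apply: eq_bigr => b _; rewrite mulr_suml.
apply: addr_ge0; first by rewrite mulr_ge0 ?sqr_ge0.
by rewrite mulr_ge0// sumr_ge0// => j _; rewrite sqr_ge0.
Qed.

Lemma SCb_gram (I : Type) (r : seq I) (f : I -> 'I_k -> R) (c0 c1 : R) : 0 <= c0 -> 0 <= c1 ->
  SCb c0 (\matrix_(a, b) (c0 + c1 * \sum_(j <- r) f j a * f j b) : 'M[R]_k).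
Proof.
move=> c00 c10; split; first exact: psd_gram.
rewrite (_ : _ - _ = \matrix_(a, b) (0 + c1 * \sum_(j <- r) f j a * f j b)); first exact: psd_gram.
by apply/matrixP => a b; rewrite !mxE mulr1; ring.
Qed.

End GramMatrices.

Section Network.
Context {R : realType}.
Variables (sigma : R -> R) (csigma : continuous sigma) (wd : nat -> nat) (Cb CW : R).
Hypotheses (Cb0 : 0 <= Cb) (CW0 : 0 < CW).
Variables (k : nat) (x : 'M[R]_(k, wd 0)).

Notation coord := ((nat * nat) + (nat * nat * nat))%type.
Implicit Types (v : coord -> R).

Definition preact (l i : nat) v (a : 'I_k) : R :=
  netZ sigma wd (fun l i => v (inl (l, i))) (fun l i j => v (inr (l, i, j))) (fun r => x a r) l i.

(** The activations at level 0 are the inputs, so the first layer obeys the same recursion as the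
    others. *)
Definition activ (l j : nat) v (a : 'I_k) : R :=
  if l is 0 then (if insub j is Some r then x a r else 0) else sigma (preact l j v a).

(** The covariance, over the inputs, of a preactivation in layer [l.+1] once the layers up to [l]
    are fixed. *)
Definition gcov (l : nat) v : 'M[R]_k :=
  \matrix_(a, b) (Cb + CW / (wd l)%:R * \sum_(j <- iota 0 (wd l)) activ l j v a * activ l j v b).

Lemma big_iota (m : nat) (F : nat -> R) : \sum_(j <- iota 0 m) F j = \sum_(j < m) F j.
Proof. by rewrite -(big_mkord xpredT) /index_iota subn0. Qed.

Lemma preactS l i v a : preact l.+1 i v a =
  v (inl (l.+1, i)) + \sum_(j <- iota 0 (wd l)) v (inr (l.+1, i, j)) * activ l j v a.
Proof.
rewrite big_iota; case: l => [|l] //=; congr (_ + _); apply: eq_bigr => r _.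
by rewrite /= valK.
Qed.

Definition layer (c : coord) : nat := match c with inl (l, _) => l | inr (l, _, _) => l end.
Definition neuron (c : coord) : nat := match c with inl (_, i) => i | inr (_, i, _) => i end.

(** Takes the place of measurability with respect to the parameters of the first [l] layers. *)
Definition layered (T : Type) (l : nat) (f : (coord -> R) -> T) : Prop :=
  forall v v', (forall c, (layer c <= l)%N -> v c = v' c) -> f v = f v'.

(** Within its own layer a neuron sees only its own parameters; this lets the neurons of a layer be
    integrated out separately. *)
Lemma preact_ext l i v v' : (forall c, (layer c < l)%N -> v c = v' c) ->
  (forall c, layer c = l -> neuron c = i -> v c = v' c) -> preact l i v = preact l i v'.
Proof.
elim: l i => [//|l IH] i h1 h2; apply/funext => a; rewrite !preactS.
rewrite h2//; congr (_ + _); apply: eq_bigr => j _; rewrite h2//; congr (_ * _).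
case: l IH h1 {h2} => [//|l] IH h1; rewrite /activ; congr sigma.
have h c : (layer c <= l.+1)%N -> v c = v' c by move=> cl; exact: h1.
have -> // : preact l.+1 j v = preact l.+1 j v'.
by apply: IH => c cl; [apply: h; exact: ltnW|move=> _; apply: h; rewrite cl].
Qed.

Lemma activ_layered l j : layered l (activ l j).
Proof.
move=> v v' h; apply/funext => a; case: l h => [//|l] h; rewrite /activ.
have -> // : preact l.+1 j v = preact l.+1 j v'.
by apply: preact_ext => c cl; [apply: h; exact: ltnW|move=> _; apply: h; rewrite cl].
Qed.

Lemma gcov_layered l : layered l (gcov l).
Proof.
move=> v v' h; apply/matrixP => a b; rewrite !mxE; congr (_ + _ * _); apply: eq_bigr => j _.
by rewrite (@activ_layered l j v v' h).
Qed.

Lemma gcov_SCb l v : SCb Cb (gcov l v).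
Proof. by apply: SCb_gram => //; rewrite divr_ge0// ltW. Qed.

Lemma preact_ymeasr l i a : ymeasr (fun v => preact l i v a).
Proof.
elim: l i => [|l IH] i d T X mX; first exact: measurable_cst.
under eq_fun do rewrite preactS.
apply: measurable_funD => //; apply: measurable_sum_ord => j.
apply: measurable_funM => //; case: l IH => [|l] IH; first exact: measurable_cst.
by apply: (measurableT_comp (measurable_sigma csigma)); exact: IH.
Qed.

Lemma activ_ymeasr l j a : ymeasr (fun v => activ l j v a).
Proof.
case: l => [|l] d T X mX; first exact: measurable_cst.
by apply: (measurableT_comp (measurable_sigma csigma)); exact: preact_ymeasr.
Qed.

Lemma gcov_mxmeas l d (T : measurableType d) (X : T -> coord -> R) :
  (forall i, measurable_fun [set: T] (X^~ i)) -> mxmeas (fun t => gcov l (X t)).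
Proof.
move=> mX a b; under eq_fun do rewrite mxE.
apply: measurable_funD => //; apply: measurable_funM => //; apply: measurable_sum_ord => j.
by apply: measurable_funM; exact: activ_ymeasr.
Qed.

Definition var (c : coord) : R :=
  match c with inl _ => Cb | inr (l, _, _) => CW / (wd l.-1)%:R end.

Lemma var_ge0 c : 0 <= var c.
Proof. by case: c => [//|[[l i] j]] /=; rewrite divr_ge0// ltW. Qed.

Definition inputs (l i : nat) : seq coord :=
  inl (l.+1, i) :: [seq inr (l.+1, i, j) | j <- iota 0 (wd l)].

Lemma inputs_uniq l i : uniq (inputs l i).
Proof.
rewrite /= map_inj_uniq ?iota_uniq ?andbT; last by move=> j j' [].
by apply/mapP => -[].
Qed.

Lemma layer_inputs l i c : c \in inputs l i -> layer c = l.+1 /\ neuron c = i.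
Proof. by rewrite inE => /predU1P[-> //|/mapP[j _ ->]]. Qed.

(* Integrating out the inputs of a neuron replaces its preactivations by a
   Gaussian vector with covariance [gcov l v]. *)
Lemma neuron_gints l i (H : (coord -> R) -> R) (phi : ('I_k -> R) -> \bar R) v :
  (forall v v', (forall c, c \notin inputs l i -> v c = v' c) -> H v = H v') ->
  (0 <= H v) -> ymeas phi -> (forall u, 0 <= phi u)%E ->
  gints (Num.sqrt \o var) (inputs l i) (fun v => (H v)%:E * phi (preact l.+1 i v))%E v =
  ((H v)%:E * gexp (fun N => phi (qN (gcov l v) N)))%E.
Proof.
move=> Hinv H0 mphi phi0.
pose col (c : coord) (a : 'I_k) := if c is inr (_, _, j) then activ l j v a else 1.
rewrite (@gints_gcols _ _ _ _ _ col _ (fun u => (H v)%:E * phi u)%E _ (fun=> 0)) ?inputs_uniq//; last first.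
  move=> t; set v' := (fun j => _).
  rewrite (_ : H v' = H v); last by apply: Hinv => c /negbTE cn; rewrite /v' cn.
  congr (_ * phi _)%E; apply/funext => a; rewrite preactS add0r big_cons big_map mulr1.
  rewrite {1}/v' inE eqxx; congr (_ + _).
  rewrite big_seq [RHS]big_seq; apply: eq_bigr => j jl; rewrite {1}/v' inE map_f// orbT.
  congr (_ * _); rewrite (@activ_layered l j v' v)// => c cl; rewrite /v'; case: ifPn => // /layer_inputs[ce _].
  by move: cl; rewrite ce ltnn.
rewrite gcolsZ//; congr (_ * _)%E.
have [pG _] := gcov_SCb l v.
rewrite gexp_qN_gcols; apply: gcols_gram => // a b.
rewrite gram_msqrt// /gram !big_cons !big_map mxE /= !mulr1 -expr2 sqr_sqrtr//; congr (_ + _).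
rewrite mulr_sumr; apply: eq_bigr => j _ /=.
have s2 : Num.sqrt (CW / (wd l)%:R) ^+ 2 = CW / (wd l)%:R by rewrite sqr_sqrtr// divr_ge0// ltW.
by rewrite -[in RHS]s2; ring.
Qed.

Section LayerMgf.
Context d (Omega : measurableType d) (P : probability Omega R).
Variables (D : set coord) (X : coord -> Omega -> R).
Hypotheses (ind : mutually_independent P D X)
  (gX : forall c, D c -> centered_gaussian P (X c) (var c)).
Variables (l : nat) (psi : nat -> ('I_k -> R) -> R) (kap : nat -> 'M[R]_k -> R).
Hypotheses (mpsi : forall i, ymeasr (psi i))
  (kapE : forall i g, psd g -> gexp (fun N => (expR (psi i (qN g N)))%:E) = (expR (kap i g))%:E).

Notation xi := (zext D X).

Let mexpsi i : ymeas (fun u => (expR (psi i u))%:E).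
Proof. by apply/ymeasrP => d' T X' mX; apply: measurableT_comp => //; exact: mpsi. Qed.

(** Measurability of [kap] itself is not assumed: its exponential along [gcov] is an integral over
    the parameters of one neuron. *)
Lemma kap_ymeasr i : ymeasr (fun v => expR (kap i (gcov l v))).
Proof.
apply/ymeasrP.
have -> : EFin \o (fun v => expR (kap i (gcov l v))) =
    gints (Num.sqrt \o var) (inputs l i) (fun v => (1%R)%:E * (expR (psi i (preact l.+1 i v)))%:E)%E.
  apply/funext => v /=; apply/esym.
  have e1 := @neuron_gints l i (fun=> 1) (fun u => (expR (psi i u))%:E) v (fun _ _ _ => erefl)
    ler01 (mexpsi i) (fun u => _).
  apply: (etrans (e1 _)) => [u|]; first by rewrite lee_fin expR_ge0.
  by rewrite /= mul1e kapE//; have [] := gcov_SCb l v.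
apply: ymeas_gints => [|v]; last by rewrite mul1e lee_fin expR_ge0.
under eq_fun do rewrite mul1e.
by move=> d' T X' mX; apply: mexpsi => a; exact: preact_ymeasr.
Qed.

Lemma kap_gcov_measurable i : measurable_fun setT (fun w => kap i (gcov l (xi w))).
Proof.
have -> : (fun w => kap i (gcov l (xi w))) = (fun w => ln (expR (kap i (gcov l (xi w))))).
  by apply/funext => w; rewrite expRK.
apply: measurableT_comp; first exact: measurable_ln.
by apply: kap_ymeasr => c; exact: (measurable_zext ind).
Qed.

(** Induction on the number of neurons. The last neuron is integrated out first, as neither [H] nor
    the other neurons depend on its parameters. The resulting factor depends on layers up to [l]
    only and joins the weight [H], which is why [H] is general. *)
Lemma layer_mgf (m : nat) (H : (coord -> R) -> R) :
  (forall i c, (i < m)%N -> c \in inputs l i -> D c) ->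
  ymeasr H -> (forall v, 0 <= H v) -> layered l H ->
  (\int[P]_w (H (xi w) * expR (\sum_(0 <= i < m) psi i (preact l.+1 i (xi w))))%:E =
   \int[P]_w (H (xi w) * expR (\sum_(0 <= i < m) kap i (gcov l (xi w))))%:E)%E.
Proof.
elim: m H => [|m IH] H sD mH H0 Hl.
  by apply: eq_integral => w _; rewrite !big_nil.
pose H' v := H v * expR (\sum_(0 <= i < m) psi i (preact l.+1 i v)).
pose H2 v := H v * expR (kap m (gcov l v)).
have mH' : ymeasr H'.
  move=> d' T X' mX; apply: measurable_funM; first exact: mH.
  apply: measurableT_comp => //; apply: measurable_sum_ord => i.
  by apply: mpsi => a; exact: preact_ymeasr.
transitivity (\int[P]_w ((H' (xi w))%:E * (expR (psi m (preact l.+1 m (xi w))))%:E))%E.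
  by apply: eq_integral => w _; rewrite big_nat_recr//= expRD mulrA -EFinM.
have F0 v : (0 <= (H' v)%:E * (expR (psi m (preact l.+1 m v)))%:E)%E.
  by rewrite -EFinM lee_fin !mulr_ge0 ?expR_ge0.
have mF : ymeas (fun v => (H' v)%:E * (expR (psi m (preact l.+1 m v)))%:E)%E.
  move=> d' T X' mX; apply: emeasurable_funM; first by apply/measurable_EFinP; exact: mH'.
  by apply: mexpsi => a; exact: preact_ymeasr.
have e1 := ge0_integral_zext_gints ind (fun c _ => var_ge0 c) gX (fun c => sD m c (ltnSn m)) mF F0.
apply: (etrans e1).
transitivity (\int[P]_w (H2 (xi w) * expR (\sum_(0 <= i < m) psi i (preact l.+1 i (xi w))))%:E)%E.
  apply: eq_integral => w _.
  rewrite (@neuron_gints l m H' (fun u => (expR (psi m u))%:E))//.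
  - rewrite kapE; last by have [] := gcov_SCb l (xi w).
    by rewrite -EFinM /H' /H2; congr (_%:E); rewrite mulrAC.
  - move=> v v' vv'; congr (_ * expR _).
      by apply: Hl => c cl; apply: vv'; apply/negP => /layer_inputs[cl' _]; move: cl; rewrite cl' ltnn.
    rewrite big_nat [RHS]big_nat; apply: eq_bigr => i im; congr psi; apply: preact_ext => c cl.
      by apply: vv'; apply/negP => /layer_inputs[cl' _]; move: cl; rewrite cl' ltnn.
    by move=> ci; apply: vv'; apply/negP => /layer_inputs[_ cm]; move: im; rewrite -ci cm ltnn.
  - by rewrite /H' mulr_ge0 ?expR_ge0.
have e2 := IH H2 (fun i c im => sD i c (leqW im)).
apply: (etrans (e2 _ _ _)).
- move=> d' T X' mX; apply: measurable_funM; first exact: mH.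
  exact: kap_ymeasr.
- by move=> v; rewrite mulr_ge0 ?expR_ge0.
- by move=> v v' vv'; rewrite /H2 (Hl v v' vv') (@gcov_layered l v v' vv').
by apply: eq_integral => w _; rewrite big_nat_recr//= expRD /H2 mulrAC mulrA.
Qed.

End LayerMgf.

End Network.

Section LayerCgf.
Context {R : realType}.
Variables (sigma : R -> R) (csigma : continuous sigma) (M : R) (Msigma : forall t, `|sigma t| <= M).
Variables (wd : nat -> nat) (Cb CW : R).
Hypotheses (Cb0 : 0 <= Cb) (CW0 : 0 < CW).
Variables (k : nat) (x : 'M[R]_(k, wd 0)).
Notation coord := ((nat * nat) + (nat * nat * nat))%type.
Notation preact := (@preact R sigma wd k x).
Notation activ := (@activ R sigma wd k x).
Notation gcov := (@gcov R sigma wd Cb CW k x).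
Context d (Omega : measurableType d) (P : probability Omega R).
Variables (D : set coord) (X : coord -> Omega -> R).
Hypotheses (ind : mutually_independent P D X)
  (gX : forall c, D c -> centered_gaussian P (X c) (var wd Cb CW c)).
Notation xi := (zext D X).

(** [layer_mgf] with the indicator of a box for [gcov l] as weight. The exponents may vary with the
    neuron, as they do at the output. *)
Lemma layer_cond_cgf (m p : nat) (K : 'M[R]_(m, p) -> 'M[R]_k -> R) (l : nat)
    (S : (coord -> R) -> 'M[R]_(m, p)) (N : R) (n : nat)
    (psi : 'M[R]_(m, p) -> nat -> ('I_k -> R) -> R) (kap : 'M[R]_(m, p) -> nat -> 'M[R]_k -> R) :
  (forall i c, (i < n)%N -> c \in inputs wd l i -> D c) -> N != 0 ->
  (forall i j, ymeasr (fun v => S v i j)) ->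
  (forall eta i, ymeasr (psi eta i)) ->
  (forall eta i g, psd g ->
     gexp (fun N => (expR (psi eta i (qN g N)))%:E) = (expR (kap eta i g))%:E) ->
  (forall eta v, N * mxdot eta (S v) = \sum_(0 <= i < n) psi eta i (preact l.+1 i v)) ->
  (forall eta g, N * K eta g = \sum_(0 <= i < n) kap eta i g) ->
  cond_cgf K (SCb Cb) P (fun w => gcov l (xi w)) (fun w => S (xi w)) N.
Proof.
move=> inD N0 mS mpsi kapE SE KE.
have mxi c : measurable_fun [set: Omega] (xi ^~ c) by exact: (measurable_zext ind).
split.
- by move=> w; exact: gcov_SCb.
- exact: gcov_mxmeas.
- by move=> i j; exact: mS.
- move=> eta; have -> : (fun w => K eta (gcov l (xi w))) =
      (fun w => N^-1 * \sum_(0 <= i < n) kap eta i (gcov l (xi w))).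
    by apply/funext => w; rewrite -KE mulKf.
  apply: measurable_funM => //; apply: measurable_sum_ord => i.
  exact: (kap_gcov_measurable csigma Cb0 CW0 x ind l (mpsi eta) (kapE eta)).
move=> q rho eta; pose B : set 'M[R]_k := mbox q rho.
have mkc (f : Omega -> R) : (\int[P]_(w in (fun w => gcov l (xi w)) @^-1` B) (f w)%:E =
    \int[P]_w (\1_B (gcov l (xi w)) * f w)%:E)%E.
  rewrite integral_mkcond; apply: eq_integral => w _; rewrite patchE indicE.
  rewrite (_ : (w \in _) = (gcov l (xi w) \in B)); last by apply/idP/idP; rewrite !inE.
  by case: (_ \in B); rewrite ?mul1r ?mul0r.
rewrite !mkc.
have h := layer_mgf csigma Cb0 CW0 x ind gX (l := l) (mpsi eta) (kapE eta) (m := n)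
  (H := fun v => \1_B (gcov l v)) inD _ _ _.
transitivity (\int[P]_w (\1_B (gcov l (xi w)) * expR (\sum_(0 <= i < n) psi eta i (preact l.+1 i (xi w))))%:E)%E.
  by apply: eq_integral => w _; rewrite SE.
apply: (etrans (h _ _ _)).
- move=> d' T X' mX.
  rewrite (_ : (fun t => _) = \1_((fun t => gcov l (X' t)) @^-1` B)); last first.
    by apply/funext => t; rewrite !indicE; congr (nat_of_bool _)%:R; apply/idP/idP; rewrite !inE.
  by apply: measurable_indic; apply: mxmeas_mbox; exact: gcov_mxmeas.
- by move=> v; rewrite indicE.
- by move=> v v' vv'; rewrite (@gcov_layered _ _ _ _ _ _ _ l v v' vv').
by apply: eq_integral => w _; rewrite -KE.
Qed.

Definition activ_gram (l : nat) (v : coord -> R) : 'M[R]_k :=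
  (wd l)%:R^-1 *: \matrix_(a, b) \sum_(j <- iota 0 (wd l)) activ l j v a * activ l j v b.

Lemma gcov_activ_gram l v : gcov l v = Cb *: const_mx 1 + CW *: activ_gram l v.
Proof. by apply/matrixP => a b; rewrite !mxE mulr1 mulrA. Qed.

Lemma hidden_cond_cgf l :
  (forall i c, (i < wd l.+1)%N -> c \in inputs wd l i -> D c) -> (0 < wd l.+1)%N ->
  cond_cgf (kapR sigma (k := k)) (SCb Cb) P (fun w => gcov l (xi w)) (fun w => activ_gram l.+1 (xi w))
    (wd l.+1)%:R.
Proof.
move=> inD n0.
have N0 : (wd l.+1)%:R != 0 :> R by rewrite pnatr_eq0 -lt0n.
apply: (@layer_cond_cgf _ _ _ l _ _ (wd l.+1) (fun eta _ => wexp sigma eta) (fun eta _ => kapR sigma eta)) => //.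
- move=> a b d' T X' mX; under eq_fun do rewrite !mxE.
  apply: measurable_funM => //; apply: measurable_sum_ord => j.
  by apply: measurable_funM; exact: activ_ymeasr.
- by move=> eta _ d' T X' mX; exact: (measurable_wexp csigma).
- by move=> eta _ g _; exact: (gexpw_kapR csigma Msigma).
- move=> eta v; rewrite /activ_gram mxdotZr mulVKf//.
  rewrite (_ : \matrix_(a, b) _ = \sum_(j <- iota 0 (wd l.+1)) \matrix_(a, b) (activ l.+1 j v a * activ l.+1 j v b)); last first.
    by apply/matrixP => a b; rewrite mxE summxE; apply: eq_bigr => j _; rewrite mxE.
  rewrite /index_iota subn0; elim: (iota _ _) => [|j s IH].
    by rewrite !big_nil mxdotC mxdot0l.
  by rewrite !big_cons mxdotDr IH wexpE.
- by move=> eta g; rewrite sumr_const_nat subn0 mulr_natl.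
Qed.

Definition scaled_output (h : nat) (v : R) (u : coord -> R) (L : nat) : 'M[R]_(k, h) :=
  \matrix_(a, i) (preact L i u a / Num.sqrt v).

(** The number of outputs is fixed, so the large parameter comes from the scaling: [v] times the
    pairing with [Z / sqrt v] has factor [sqrt v], whose square is the [v] in front of [quadK]. *)
Lemma output_cond_cgf h (L : nat) (v : R) : 0 < v ->
  (forall i c, (i < h)%N -> c \in inputs wd L i -> D c) ->
  cond_cgf (@quadK R k h) (SCb Cb) P (fun w => gcov L (xi w)) (fun w => scaled_output h v (xi w) L.+1) v.
Proof.
move=> v0 inD.
pose th (eta : 'M[R]_(k, h)) (i : nat) (a : 'I_k) : R := if insub i is Some j then eta a j else 0.
pose psi eta i (u : 'I_k -> R) := \sum_a (Num.sqrt v * th eta i a) * u a.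
pose kap eta i (g : 'M[R]_k) := v * (2^-1 * \sum_a \sum_b th eta i a * g a b * th eta i b).
have s2 : Num.sqrt v ^+ 2 = v by rewrite sqr_sqrtr// ltW.
have s0 : Num.sqrt v != 0 by rewrite gt_eqF// sqrtr_gt0.
apply: (@layer_cond_cgf _ _ _ L (fun u => scaled_output h v u L.+1) _ h psi kap) => //.
- by rewrite gt_eqF.
- move=> a b d' T X' mX; under eq_fun do rewrite !mxE.
  by apply: measurable_funM => //; exact: preact_ymeasr.
- move=> eta i d' T X' mX; apply: measurable_sum_ord => a.
  by apply: measurable_funM.
- move=> eta i g pg; rewrite gexp_linear//; congr (expR _)%:E.
  rewrite /kap mulrCA; congr (_ * _); rewrite mulr_sumr; apply: eq_bigr => a _.
  by rewrite mulr_sumr; apply: eq_bigr => b _; rewrite -[in RHS]s2; ring.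
- move=> eta u; rewrite big_mkord /mxdot mulr_sumr.
  under eq_bigr => a _ do rewrite mulr_sumr.
  rewrite exchange_big; apply: eq_bigr => i _; apply: eq_bigr => a _.
  by rewrite /th valK mxE -[X in X * _]s2; field.
- move=> eta g; rewrite big_mkord -mulr_sumr; congr (_ * _).
  rewrite /quadK -mulr_sumr; congr (_ * _); rewrite /mxdot exchange_big; apply: eq_bigr => i _.
  apply: eq_bigr => a _; rewrite mxE mulr_sumr; apply: eq_bigr => b _.
  by rewrite /th valK mulrA.
Qed.

End LayerCgf.

(** * The rate functions *)

Section RateFunctions.
Context {R : realType}.
Variables (sigma : R -> R) (csigma : continuous sigma) (M : R) (Msigma : forall t, `|sigma t| <= M).
Variables (Cb CW : R) (k : nat).
Hypothesis CW0 : 0 < CW.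

Lemma SCb_compact (B : R) : compact [set q : 'M[R]_k | SCb Cb q /\ forall i j, `|q i j| <= B].
Proof.
rewrite (_ : [set q | _] = [set q : 'M[R]_k | SCb Cb q] `&` [set q | forall i j, `|q i j| <= B]); last first.
  by apply/seteqP; split => q [].
rewrite setIC; apply: compact_closedI; first exact: mcube_compact.
apply: closedI; first exact: psd_closed.
apply: (@preimage_closed _ _ (fun q : 'M[R]_k => q - Cb *: const_mx 1) [set q | psd q]); last exact: psd_closed.
move=> q _; apply: (@cvgB _ _ _ (nbhs q) (nbhs_filter q)); [exact: cvg_id|exact: cvg_cst].
Qed.

Definition layer_out (g : 'M[R]_k) : 'M[R]_k := CW^-1 *: (g - Cb *: const_mx 1).

Lemma kappa_star_legendre (y q : 'M[R]_k) : kappa_star sigma y q = legendre (@kapR R sigma k) y q.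
Proof.
rewrite /kappa_star /legendre; apply: (congr1 (fun f => ereal_sup (range f))); apply/funext => eta.
by rewrite (kappaE csigma Msigma) -EFinB.
Qed.

Lemma kapR_legendre_ge0 (y q : 'M[R]_k) : (0 <= legendre (@kapR R sigma k) y q)%E.
Proof. by rewrite -kappa_star_legendre (kappa_star_ge0 csigma Msigma). Qed.

Lemma Jcond_legendre (gam : \bar R) (g' g : 'M[R]_k) : (1 <= gam)%E ->
  Jcond sigma Cb CW gam g' g = (gam * legendre (@kapR R sigma k) (layer_out g') g)%E.
Proof.
rewrite /layer_out -kappa_star_legendre; case: gam => [r| |] //= _.
have ks0 := kappa_star_ge0 csigma Msigma (CW^-1 *: (g' - Cb *: const_mx 1)) g.
have outE : (g' == Cb *: const_mx 1 + CW *: ymat sigma g) <->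
    CW^-1 *: (g' - Cb *: const_mx 1) = ymat sigma g.
  split=> [/eqP ->|<-].
    by rewrite addrAC subrr add0r scalerA mulVf ?gt_eqF// scale1r.
  by rewrite scalerA divff ?gt_eqF// scale1r addrC subrK.
rewrite /Delta; case: ifPn => [/outE|ne].
  by move=> /(kappa_star_eq0 csigma Msigma) le0; rewrite (_ : kappa_star _ _ _ = 0%E) ?mule0//; apply/eqP; rewrite eq_le le0.
rewrite gt0_mulye// ltNge; apply/negP => /(kappa_star_eq0 csigma Msigma)/outE.
by rewrite (negbTE ne).
Qed.

Lemma Jcond_ge0 (gam : \bar R) (g' g : 'M[R]_k) : (1 <= gam)%E -> (0 <= Jcond sigma Cb CW gam g' g)%E.
Proof.
by move=> gam1; rewrite Jcond_legendre// mule_ge0 ?kapR_legendre_ge0// (le_trans _ gam1).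
Qed.

Variables (L : nat) (gam : nat -> \bar R).
Hypothesis gam1 : forall l, (1 <= l <= L)%N -> (1 <= gam l)%E.
Variable g0 : 'M[R]_k.
Hypothesis Sg0 : SCb Cb g0.

Notation IG := (IG sigma Cb CW).

Lemma IG_ge0 l g : (l <= L)%N -> (0 <= IG l gam g0 g)%E.
Proof.
move=> lL; apply: le_ereal_inf_tmp => _ [gs _ <-].
rewrite big_nat; apply: sume_ge0 => i /andP[i1 il]; apply: Jcond_ge0; apply: gam1.
by rewrite i1 (leq_trans _ lL).
Qed.

(** With no layers the only possible endpoint is [g0]; for any other the infimum is over the empty
    set. *)
Lemma IG0 g : IG 0 gam g0 g = if g == g0 then 0%E else +oo%E.
Proof.
rewrite /Defs.IG; case: eqP => [->|gg0].
  apply/eqP; rewrite eq_le; apply/andP; split.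
    apply: ereal_inf_lbound; exists (fun=> g0); last by rewrite big_nil.
    by split => //; split => // -[].
  by apply: le_ereal_inf_tmp => _ [gs _ <-]; rewrite big_nil.
rewrite (_ : [set _ | _ in _] = set0) ?ereal_inf0//.
by apply/seteqP; split => // e [gs [g0E [gE _]] _]; apply: gg0; rewrite -gE g0E.
Qed.

(** One half of the dynamic programming recursion for the infimum over paths, in the form used by
    [step_ub]; [IG_step_lt] is the half used by [step_lb]. *)
Lemma IG_step_le l g g' : (l < L)%N -> SCb Cb g ->
  (IG l.+1 gam g0 g' <= IG l gam g0 g + gam l.+1 * legendre (@kapR R sigma k) (layer_out g') g)%E.
Proof.
move=> lL Sg; have gl1 : (1 <= gam l.+1)%E by exact: gam1.
rewrite -Jcond_legendre//; have J0 := Jcond_ge0 g' g gl1.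
(* A finite transition cost can be moved across the inequality; an infinite one makes the right-hand
   side [+oo], as [IG] is nonnegative. *)
case JE : (Jcond sigma Cb CW (gam l.+1) g' g) J0 => [j| |] // _; last first.
  by rewrite addey ?leey// gt_eqF// (lt_le_trans _ (IG_ge0 g (ltnW lL))).
rewrite -leeBlDr//; apply: le_ereal_inf_tmp => _ [gs [gs0 [gsl gsS]] <-].
rewrite leeBlDr//; apply: ereal_inf_lbound.
exists (fun i => if i == l.+1 then g' else gs i).
  split; first by rewrite /= gs0.
  split; first by rewrite eqxx.
  move=> i /andP[i1 il]; rewrite ltn_eqF//.
  by move: il; rewrite ltnS leq_eqVlt => /predU1P[->|il]; [rewrite gsl|apply: gsS; rewrite i1].
rewrite big_nat_recr//= eqxx (ltn_eqF (ltnSn l)) gsl JE; congr (_ + _)%E.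
rewrite big_nat [RHS]big_nat; apply: eq_bigr => i /andP[i1 il].
rewrite (ltn_eqF il) ltn_eqF//; by case: i i1 il => // i _ il /=; apply: ltnW.
Qed.

Lemma IG_step_lt l g' (a : R) : (l < L)%N -> (IG l.+1 gam g0 g' < a%:E)%E ->
  exists g, SCb Cb g /\ (IG l gam g0 g + gam l.+1 * legendre (@kapR R sigma k) (layer_out g') g < a%:E)%E.
Proof.
move=> lL; have gl1 : (1 <= gam l.+1)%E by exact: gam1.
move=> /ereal_inf_lt[_ [gs [gs0 [gsl gsS]] <-] lta].
exists (gs l); split.
  (* Only the matrices strictly between the ends are constrained; at [l = 0] the matrix [gs l] is
     [g0], covered by [Sg0]. *)
  by case: l {lL gl1 gsl lta} gsS => [|l] gsS; [rewrite gs0|apply: gsS; rewrite ltnSn].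
apply: le_lt_trans lta; rewrite big_nat_recr//= gsl Jcond_legendre//; apply: leeD2r.
apply: ereal_inf_lbound; exists gs => //; split => //; split => // i /andP[i1 il].
by apply: gsS; rewrite i1 ltnW.
Qed.

(** The factor 1 is the ratio of speeds in the output step, where [N] is [v] itself. *)
Lemma IZ_le n0 nL1 (x : 'M[R]_(k, n0)) (z : 'M[R]_(k, nL1)) g : g0 = g0mat Cb CW x -> SCb Cb g ->
  (IZ sigma Cb CW L gam x z <= IG L gam g0 g + 1 * legendre (@quadK R k nL1) z g)%E.
Proof.
move=> g0E Sg; have [pg _] := Sg; rewrite mul1e leNgt; apply/negP => /[dup] lt_IZ.
have IG0' := IG_ge0 g (leqnn L).
have l0 : (0 <= legendre (@quadK R k nL1) z g)%E.
  by apply: (@legendre_ge0 _ _ _ _ _ [set q | psd q]) => // q _; exact: quadK0.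
case lE : (legendre _ z g) l0 => [c| |] // _; last first.
  by rewrite addey ?ltNge ?leey// gt_eqF// (lt_le_trans _ IG0').
have /(legendre_quadK z c pg)[r [rz rc]] : (legendre (@quadK R k nL1) z g <= c%:E)%E by rewrite lE.
rewrite ltNge => /negP; apply.
apply: (@le_trans _ _ (IG L gam g0 g + (sqnorm r / 2)%:E)%E); last by apply: leeD2l; rewrite lee_fin.
by apply: ereal_inf_lbound; exists g, r; rewrite g0E.
Qed.

Lemma IZ_lt n0 nL1 (x : 'M[R]_(k, n0)) (z : 'M[R]_(k, nL1)) (a : R) : g0 = g0mat Cb CW x ->
  (IZ sigma Cb CW L gam x z < a%:E)%E ->
  exists g, SCb Cb g /\ (IG L gam g0 g + 1 * legendre (@quadK R k nL1) z g < a%:E)%E.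
Proof.
move=> g0E /ereal_inf_lt[_ [g [r [Sg [rz ->]]]] lta]; exists g; split => //.
rewrite mul1e; apply: le_lt_trans lta; rewrite g0E; apply: leeD2l.
by have [pg _] := Sg; apply/(legendre_quadK z _ pg); exists r.
Qed.

Lemma IZ_ge0 n0 nL1 (x : 'M[R]_(k, n0)) (z : 'M[R]_(k, nL1)) : g0 = g0mat Cb CW x ->
  (0 <= IZ sigma Cb CW L gam x z)%E.
Proof.
move=> g0E; apply: le_ereal_inf_tmp => _ [g [r [Sg [rz ->]]]].
by rewrite -g0E adde_ge0 ?IG_ge0// lee_fin divr_ge0 ?sqnorm_ge0.
Qed.

End RateFunctions.

(** * Induction over the layers and the output *)

Section NetworkLDP.
Context {R : realType}.
Variables (L n0 nL1 : nat) (Cb CW : R) (sigma : R -> R) (nn : nat -> nat -> nat)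
  (k : nat) (x : 'M[R]_(k, n0)) (lhat : nat) (gam : nat -> \bar R)
  (d : measure_display) (Omega : measurableType d) (P : probability Omega R)
  (b : nat -> nat -> nat -> Omega -> R) (W : nat -> nat -> nat -> nat -> Omega -> R) (M : R).

Notation wd n := (width n0 nL1 L nn n).
Notation coord := ((nat * nat) + (nat * nat * nat))%type.

Definition used (n : nat) : set coord := fun idx : coord =>
  match idx with
  | inl (l, i) => (1 <= l <= L.+1)%N /\ (i < wd n l)%N
  | inr (l, i, j) => (1 <= l <= L.+1)%N /\ (i < wd n l)%N /\ (j < wd n l.-1)%N
  end.

Definition param (n : nat) : coord -> Omega -> R := fun idx : coord =>
  match idx with inl (l, i) => b n l i | inr (l, i, j) => W n l i j end.

Hypotheses (Cb0 : 0 <= Cb) (CW0 : 0 < CW)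
  (nn1 : forall n l, (1 <= l <= L)%N -> (1 <= nn n l)%N)
  (nnoo : forall l, (1 <= l <= L)%N -> (fun n => (nn n l)%:R : R) @ \oo --> +oo)
  (ind : forall n, mutually_independent P (used n) (param n))
  (gb : forall n l i, (1 <= l <= L.+1)%N -> (i < wd n l)%N -> centered_gaussian P (b n l i) Cb)
  (gW : forall n l i j, (1 <= l <= L.+1)%N -> (i < wd n l)%N -> (j < wd n l.-1)%N ->
     centered_gaussian P (W n l i j) (CW / (wd n l.-1)%:R))
  (csigma : continuous sigma) (Msigma : forall t, `|sigma t| <= M)
  (lhatL : (1 <= lhat <= L)%N)
  (gam1 : forall l, (1 <= l <= L)%N -> (1 <= gam l)%E)
  (nngam : forall l, (1 <= l <= L)%N ->
     (fun n => ((nn n l)%:R / (nn n lhat)%:R : R)%:E) @ \oo --> gam l).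

Notation xi n := (zext (used n) (param n)).
Notation v := (fun n => (nn n lhat)%:R : R).
Let G l n w : 'M[R]_k := gcov sigma (wd:=wd n) Cb CW x l (xi n w).
Let g0 : 'M[R]_k := g0mat Cb CW x.

Let param_gaussian n c : used n c -> centered_gaussian P (param n c) (var (wd n) Cb CW c).
Proof. by case: c => [[l i] [h1 h2]|[[l i] j] [h1 [h2 h3]]]; [exact: gb|exact: gW]. Qed.

Let inputs_used n l i c : (l <= L)%N -> (i < wd n l.+1)%N -> c \in inputs (wd n) l i -> used n c.
Proof.
move=> lL il; rewrite inE => /predU1P[->|/mapP[j]]; first by split; rewrite ?ltnS.
by rewrite mem_iota add0n => /= jl ->; split; rewrite ?ltnS.
Qed.

Let v0 n : 0 < v n.
Proof. by rewrite ltr0n; exact: nn1. Qed.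

Let voo : v n @[n --> \oo] --> +oo.
Proof. exact: nnoo. Qed.

Lemma width_hidden n l : (1 <= l <= L)%N -> wd n l = nn n l.
Proof. by case: l => [//|l] lL; rewrite /width /= ltn_eqF. Qed.

Lemma width_output n : wd n L.+1 = nL1.
Proof. by rewrite /width /= eqxx. Qed.

Let Sg0 : SCb Cb g0.
Proof.
rewrite (_ : g0 = \matrix_(a, b) (Cb + CW / n0%:R * \sum_(r <- index_enum 'I_n0) x a r * x b r)) //.
by apply: (SCb_gram _ (fun r a => x a r)) => //; rewrite divr_ge0// ltW.
Qed.

Let G0E n w : G 0 n w = g0.
Proof.
apply/matrixP => a c; rewrite !mxE; congr (_ + _ * _).
by rewrite big_iota; apply: eq_bigr => r _; rewrite /= valK.
Qed.

Let bound : R := norm1 g0 + (Cb + CW * M ^+ 2).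

(** A deterministic bound, from [sigma] in the hidden layers and from the inputs at level 0; it
    places all values of [G] in the compact set [Dc]. *)
Let G_bound l n w i j : (l <= L)%N -> `|G l n w i j| <= bound.
Proof.
have M0 : 0 <= M by rewrite (le_trans _ (Msigma 0)).
have CM0 : 0 <= Cb + CW * M ^+ 2 by rewrite addr_ge0// mulr_ge0 ?sqr_ge0// ltW.
case: l => [|l] lL.
  rewrite G0E /bound (@le_trans _ _ (norm1 g0))// ?lerDl//.
  rewrite /norm1 (bigD1 i)//= (bigD1 j)//= -addrA lerDl addr_ge0//; first exact: sumr_ge0.
  by apply: sumr_ge0 => i' _; exact: sumr_ge0.
rewrite /bound (@le_trans _ _ (Cb + CW * M ^+ 2))// ?lerDr ?norm1_ge0//.
rewrite mxE (le_trans (ler_normD _ _))// ger0_norm// lerD2l.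
have N0 : 0 < (wd n l.+1)%:R :> R by rewrite ltr0n width_hidden// nn1.
rewrite normrM ger0_norm ?divr_ge0 ?(ltW CW0)// -mulrA ler_pM2l// mulrC ler_pdivrMr//.
rewrite (le_trans (ler_norm_sum _ _ _))// big_iota.
rewrite (@le_trans _ _ (\sum_(j0 < wd n l.+1) M ^+ 2))//.
  by apply: ler_sum => r _; rewrite normrM expr2 ler_pM//; exact: Msigma.
by rewrite sumr_const card_ord mulr_natr.
Qed.

Let Dc : set 'M[R]_k := [set q | SCb Cb q /\ forall i j, `|q i j| <= bound].

Let G_Dc l n w : (l <= L)%N -> Dc (G l n w).
Proof. by move=> lL; split=> [|i j]; [exact: gcov_SCb|exact: G_bound]. Qed.

Let kapR_contS (eta q : 'M[R]_k) (e : R) : SCb Cb q -> 0 < e -> exists2 rho, 0 < rho &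
  forall q', SCb Cb q' -> mbox q rho q' -> `|kapR sigma eta q' - kapR sigma eta q| < e.
Proof.
move=> [pq _] e0; have [rho r0 h] := kapR_cont csigma Msigma eta pq e0.
by exists rho => // q' [pq' _]; exact: h.
Qed.

Let kapR_semiconcave (q : 'M[R]_k) : SCb Cb q -> semiconcave (@kapR R sigma k) q.
Proof.
move=> _ xi; have [C [t0 [C0 t00 h]]] := kapR_second_diff csigma Msigma xi.
by exists C, t0; split => // eta t; exact: h.
Qed.

Let kapR_zero (q : 'M[R]_k) : SCb Cb q -> kapR sigma 0 q = 0.
Proof. by move=> _; exact: (kapR0 csigma Msigma). Qed.

Notation IG l g := (IG sigma Cb CW l gam g0 g).
Notation S l := (fun n w => activ_gram sigma (wd:=wd n) x l (xi n w)).

Let hidden_cgf l n : (l < L)%N ->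
  cond_cgf (@kapR R sigma k) (SCb Cb) P (G l n) (S l.+1 n) (nn n l.+1)%:R.
Proof.
move=> lL; rewrite -width_hidden//.
apply: (hidden_cond_cgf csigma Msigma Cb0 CW0 x (ind n) (@param_gaussian n)).
  by move=> i c il; apply: inputs_used => //; exact: ltnW.
have : (0 < wd n l.+1)%N by rewrite width_hidden// nn1.
exact.
Qed.

(** [G] is an affine image of the Gram matrix [S] with slope [CW], so local bounds pass between them
    by rescaling radii. *)
Let G_box l n (g : 'M[R]_k) (rho : R) :
  G l n @^-1` mbox g (CW * rho) = S l n @^-1` mbox (layer_out Cb CW g) rho.
Proof.
have e (w : Omega) i j : G l n w i j - g i j = CW * (S l n w i j - layer_out Cb CW g i j).
  rewrite /G gcov_activ_gram; move: (activ_gram _ _ _ _) => s; rewrite !mxE mulr1.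
  by field; rewrite gt_eqF.
apply/seteqP; split => w h i j; have := h i j; rewrite e normrM (ger0_norm (ltW CW0)) ltr_pM2l//.
Qed.

Lemma layer_bounds l : (l <= L)%N ->
  (forall g a, (a%:E < IG l g)%E -> loc_ub P v (G l) g a) /\
  (forall g a, (IG l g < a%:E)%E -> loc_lb P v (G l) g a).
Proof.
elim: l => [_|l IH lL].
  have GT n : G 0 n = fun=> g0 by apply/funext => w; exact: G0E.
  split=> g a; rewrite IG0; case: (g =P g0) => // gg0.
  - rewrite lte_fin => a0; exists 1, 1, 0%N; split => // n _.
    rewrite mul1r (@le_trans _ _ 1%:E)//.
      by apply: probability_le1; rewrite GT; apply: mxmeas_mbox => i j; exact: measurable_cst.
    by rewrite lee_fin -[leLHS]expR0 ler_expR oppr_ge0 mulr_ge0_le0 ?ltW.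
  (* A box whose radius is the gap at a differing entry misses the deterministic value [g0], so
     every rate is allowed. *)
  - move=> _; have [i [j gij]] : exists i j, g i j != g0 i j.
      apply: contrapT => h; apply: gg0; apply/matrixP => i j; apply/eqP.
      by apply: contrapT => /negP gij; apply: h; exists i, j.
    exists `|g0 i j - g i j|, 0, 0%N; split => [|n _].
      by rewrite normr_gt0 subr_eq0 eq_sym.
    rewrite mul0r GT (_ : _ @^-1` _ = set0) ?measure0//.
    by apply/seteqP; split => // w /(_ i j); rewrite ltxx.
  - rewrite lte_fin => a0 rho r0; exists 0%N => n _.
    rewrite GT (_ : _ @^-1` _ = setT) ?probability_setT.
      by rewrite lee_fin -[leRHS]expR0 ler_expR oppr_le0 mulr_ge0// ltW.
    by rewrite gg0; apply/seteqP; split => // w _; exact: mbox_center.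
have [IHu IHl] := IH (ltnW lL).
have IG0' g : (0 <= IG l g)%E by exact: (IG_ge0 csigma Msigma Cb CW0 gam1 g0 g (ltnW lL)).
have lL1 : (1 <= l.+1 <= L)%N by [].
have N0 n : 0 < (nn n l.+1)%:R :> R by rewrite ltr0n nn1.
have Nv : ((nn n l.+1)%:R / v n)%:E @[n --> \oo] --> gam l.+1 by exact: nngam.
split=> g a aIG.
- have [rho [C [n1 [r0 h]]]] := step_ub (y := layer_out Cb CW g) (a := a) v0 N0 (gam1 lL1) Nv
    kapR_contS kapR_zero (fun n => hidden_cgf n lL) IG0' (@SCb_compact R Cb k bound) (fun q => @proj1 _ _)
    (fun n w => G_Dc n w (ltnW lL)) (fun q c _ => IHu q c)
    (fun q Dq => lt_le_trans aIG (IG_step_le csigma Msigma CW0 gam1 g0 g lL (proj1 Dq))).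
  exists (CW * rho), C, n1; split => [|n n1n]; first by rewrite mulr_gt0.
  by rewrite G_box; exact: h.
- move=> rho r0; have r0' : 0 < rho / CW by rewrite divr_gt0.
  have [n1 h] := step_lb (y := layer_out Cb CW g) (a := a) v0 voo N0 (nnoo lL1) (gam1 lL1) Nv
    kapR_contS kapR_zero kapR_semiconcave (fun n => hidden_cgf n lL) IG0' (fun q c _ => IHl q c)
    (IG_step_lt csigma Msigma CW0 gam1 Sg0 lL aIG) r0'.
  exists n1 => n n1n; rewrite (_ : rho = CW * (rho / CW)); last by rewrite mulrC divfK// gt_eqF.
  by rewrite G_box; exact: h.
Qed.

Notation Z := (fun n w => scaled_output sigma (wd:=wd n) x nL1 (v n) (xi n w) L.+1).

Let output_cgf n : cond_cgf (@quadK R k nL1) (SCb Cb) P (G L n) (Z n) (v n).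
Proof.
apply: (output_cond_cgf csigma Cb0 CW0 x (ind n) (@param_gaussian n) (h := nL1) (L := L) (v0 n)).
by move=> i c ih; apply: inputs_used => //; rewrite width_output.
Qed.

Lemma output_LDP : LDP P v Z (IZ sigma Cb CW L gam x) /\
  good_rate_function (T := 'M[R]_(k, nL1)) (IZ sigma Cb CW L gam x).
Proof.
have [GU GL] := layer_bounds (leqnn L).
have IG0' g : (0 <= IG L g)%E by exact: (IG_ge0 csigma Msigma Cb CW0 gam1 g0 g (leqnn L)).
have one : (v n / v n)%:E @[n --> \oo] --> 1%E.
  by under eq_fun do rewrite divff ?gt_eqF//; exact: cvg_cst.
have quad0 (q : 'M[R]_k) : SCb Cb q -> quadK (0 : 'M[R]_(k, nL1)) q = 0 by move=> _; exact: quadK0.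
have qc (eta : 'M[R]_(k, nL1)) (q : 'M[R]_k) (e : R) := @quadK_cont R k nL1 (SCb Cb) eta q e.
apply: local_LDP => //.
- by move=> n; have [] := output_cgf n.
- by move=> z; exact: (IZ_ge0 csigma Msigma CW0 gam1 z (erefl g0)).
- move=> z a az; apply: (step_ub v0 v0 (lexx 1%E) one qc quad0 output_cgf IG0'
    (@SCb_compact R Cb k bound) (fun q => @proj1 _ _) (fun n w => G_Dc n w (leqnn L)) (fun q c _ => GU q c)).
  move=> q [Sq _]; apply: lt_le_trans az _.
  exact: (IZ_le csigma Msigma CW0 gam1 z (erefl g0) Sq).
- move=> z a az; apply: (step_lb v0 voo v0 voo (lexx 1%E) one qc quad0
    (fun q _ => @quadK_semiconcave R k nL1 q) output_cgf IG0' (fun q c _ => GL q c)).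
  exact: (IZ_lt (erefl g0) az).
- move=> a; apply: quadK_exp_tight v0 _ output_cgf => n w i j.
  exact: (G_bound n w i j (leqnn L)).
Qed.

(** The recursion reads only parameters within the widths, where the extension by 0 changes
    nothing. *)
Lemma netZ_zext n w (y : 'I_n0 -> R) l i : (l <= L.+1)%N -> (i < wd n l)%N ->
  netZ sigma (wd n) (fun l i => b n l i w) (fun l i j => W n l i j w) y l i =
  netZ sigma (wd n) (fun l i => xi n w (inl (l, i))) (fun l i j => xi n w (inr (l, i, j))) y l i.
Proof.
have bE l' i' : (1 <= l' <= L.+1)%N -> (i' < wd n l')%N -> xi n w (inl (l', i')) = b n l' i' w.
  by move=> h1 h2; rewrite /zext asboolT.
have WE l' i' j' : (1 <= l' <= L.+1)%N -> (i' < wd n l')%N -> (j' < wd n l'.-1)%N ->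
    xi n w (inr (l', i', j')) = W n l' i' j' w.
  by move=> h1 h2 h3; rewrite /zext asboolT.
elim: l i => [//|l IH] i lL il; case: l IH lL il => [|l] IH lL il.
  by rewrite /= bE//; congr (_ + _); apply: eq_bigr => r _; rewrite WE.
rewrite [LHS]/= [RHS]/= bE//; congr (_ + _); apply: eq_bigr => r _; rewrite WE//; congr (_ * sigma _).
exact: (IH r (ltnW lL) (ltn_ord r)).
Qed.

End NetworkLDP.

Theorem theorem2p1 (R : realType) (L n0 nL1 : nat) (Cb CW : R) (sigma : R -> R)
  (nn : nat -> nat -> nat) (k : nat) (x : 'M[R]_(k, n0))
  (lhat : nat) (gam : nat -> \bar R)
  (d : measure_display) (Omega : measurableType d) (P : probability Omega R)
  (b : nat -> nat -> nat -> Omega -> R)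
  (W : nat -> nat -> nat -> nat -> Omega -> R) :
  (1 <= L)%N -> (1 <= n0)%N -> (1 <= nL1)%N -> 0 <= Cb -> 0 < CW ->
  (* hidden widths n_l(n) >= 1 with n_l(n) -> oo *)
  (forall n l, (1 <= l <= L)%N -> (1 <= nn n l)%N) ->
  (forall l, (1 <= l <= L)%N -> (fun n => (nn n l)%:R : R) @ \oo --> +oo) ->
  (* the network: for each n, independent centered Gaussian biases and weights *)
  (forall n,
     mutually_independent P
       (fun idx : (nat * nat) + (nat * nat * nat) =>
          match idx with
          | inl (l, i) => (1 <= l <= L.+1)%N /\ (i < width n0 nL1 L nn n l)%N
          | inr (l, i, j) => (1 <= l <= L.+1)%N /\ (i < width n0 nL1 L nn n l)%N
                              /\ (j < width n0 nL1 L nn n l.-1)%N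
          end)
       (fun idx => match idx with
                   | inl (l, i) => b n l i
                   | inr (l, i, j) => W n l i j
                   end)) ->
  (forall n l i, (1 <= l <= L.+1)%N -> (i < width n0 nL1 L nn n l)%N ->
     centered_gaussian P (b n l i) Cb) ->
  (forall n l i j, (1 <= l <= L.+1)%N -> (i < width n0 nL1 L nn n l)%N ->
     (j < width n0 nL1 L nn n l.-1)%N ->
     centered_gaussian P (W n l i j) (CW / (width n0 nL1 L nn n l.-1)%:R)) ->
  (* (i) sigma continuous and bounded *)
  continuous sigma -> (exists M : R, forall t, `|sigma t| <= M) ->
  (* (ii) width ratios *)
  (1 <= lhat <= L)%N ->
  (forall l, (1 <= l <= L)%N -> (1 <= gam l)%E) ->
  (forall l, (1 <= l <= L)%N ->
     (fun n => ((nn n l)%:R / (nn n lhat)%:R : R)%:E) @ \oo --> gam l) ->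
  LDP P (fun n => (nn n lhat)%:R)
    (fun n (w : Omega) =>
       \matrix_(a < k, h < nL1)
         (netZ sigma (width n0 nL1 L nn n) (fun l i => b n l i w)
            (fun l i j => W n l i j w) (fun r => x a r) L.+1 h
          / Num.sqrt (nn n lhat)%:R))
    (IZ sigma Cb CW L gam x)
  /\ good_rate_function (T := 'M[R]_(k, nL1)) (IZ sigma Cb CW L gam x).
Proof.
move=> L1 n01 nL11 Cb0 CW0 nn1 nnoo ind gb gW csigma [M Msigma] lhatL gam1 nngam.
have [h1 h2] := output_LDP x Cb0 CW0 nn1 nnoo ind gb gW csigma Msigma lhatL gam1 nngam.
split=> //; apply: (eq_ind _ (fun F => LDP P _ F _) h1).
apply/funext => n; apply/funext => w; apply/matrixP => a h; rewrite !mxE; congr (_ / _).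
by apply/esym; apply: netZ_zext => //; rewrite width_output.
Qed.
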